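(* Let $\rho_0\in L^\infty$ be supported in $\overline{B_1}$ and satisfy $\int_{\partial B_r}\rho_0\,dS_r=0$ for almost every $r>0$, and let $\rho$ be the solution of the continuity equation with velocity $u$ and initial datum $\rho_0$. Then, for every accuracy parameter $\kappa\in(0,1)$, $$\mathcal G(\rho(t,\cdot))\to 0\quad\text{and}\quad \|\rho(t,\cdot)\|_{\dot H^{-1}(B_1)}\to0\qquad\text{as } t\to\infty.$$
   Context: $B_1\subset\mathbb R^2$ is the open unit disk, $B_r(x)$ the open disk of radius $r$ centered at $x$, $B_r=B_r(0)$, $(r,\theta)$ polar coordinates, $dS_r$ arc-length measure on $\partial B_r$. The velocity field is $u(r,\theta)=2\pi r^2(\sin\theta,-\cos\theta)$ (smooth, divergence free, tangent to $\partial B_1$). For $\rho_0\in L^\infty$ supported in $\overline{B_1}$ (extended by zero outside), $\rho(t,\cdot)$ denotes the solution of $\partial_t\rho+\operatorname{div}(u\rho)=0$ on $[0,\infty)\times B_1$, $\rho(0,\cdot)=\rho_0$; explicitly, each circle of radius $r$ is rigidly rotated, $\rho(t,r,\theta)=\rho_0(r,\theta+2\pi tr)$, so $\|\rho(t,\cdot)\|_{L^\infty}=\|\rho_0\|_{L^\infty}$. Geometric mixing scale: for fixed $\kappa\in(0,1)$ and a bounded $f$ supported in $\overline{B_1}$ (extended by zero), $\mathcal G(f)$ is the infimum of all $\varepsilon>0$ such that $\big|\frac1{|B_\varepsilon|}\int_{B_\varepsilon(x)}f\big|\le\kappa\|f\|_{L^\infty(B_1)}$ for every $x\in\mathbb R^2$.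 Functional mixing scale: $\|f\|_{\dot H^{-1}(B_1)}=\sup\{\int_{B_1}f\xi\,dx:\ \xi\in H^1(B_1),\ \|\nabla\xi\|_{L^2(B_1)}\le1\}$. *)

(* Defs.v *)
From HB Require Import structures.
From mathcomp Require Import all_boot all_order all_algebra.
From mathcomp Require Import all_classical all_reals all_analysis.
Set Implicit Arguments. Unset Strict Implicit. Unset Printing Implicit Defensive.
Import Order.TTheory GRing.Theory Num.Theory.
Import numFieldNormedType.Exports.
Local Open Scope classical_set_scope.
Local Open Scope ring_scope.

Section Defs.
Variable R : realType.

Definition leb2 : set (R * R) -> \bar R :=
  (@lebesgue_measure R \x @lebesgue_measure R)%E.

(* Euclidean norm (NB: the library norm on R * R is the max norm) *)
Definition eucl (x : R * R) : R := Num.sqrt (x.1 ^+ 2 + x.2 ^+ 2).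

Definition disk (x : R * R) (r : R) : set (R * R) :=
  [set y | eucl (y.1 - x.1, y.2 - x.2) < r].

Definition B1 : set (R * R) := disk (0, 0) 1.

(* the explicit solution: rho(t, r, theta) = rho0(r, theta + 2 pi t r),
   i.e. rho(t, x) = rho0(rotation of x by the angle 2 pi t |x|) *)
Definition rot (phi : R) (x : R * R) : R * R :=
  (x.1 * cos phi - x.2 * sin phi, x.1 * sin phi + x.2 * cos phi).

Definition sol (rho0 : R * R -> R) (t : R) : R * R -> R :=
  fun x => rho0 (rot (2 * pi * t * eucl x) x).

Definition circle_integral (f : R * R -> R) (r : R) : \bar R :=
  (\int[@lebesgue_measure R]_(th in `[0%R, (2 * pi)%R]) (f (r * cos th, r * sin th) * r)%:E)%E.

Definition LinfB1 (f : R * R -> R) : \bar R :=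
  ereal_inf [set M : \bar R | {ae leb2, forall x, B1 x -> ((`|f x|)%:E <= M)%E}].

Definition disk_avg (f : R * R -> R) (x : R * R) (eps : R) : R :=
  Rintegral leb2 (disk x eps) f / fine (leb2 (disk x eps)).

Definition geom_mix (kappa : R) (f : R * R -> R) : R :=
  inf [set eps : R | 0 < eps /\
    forall x : R * R, ((`|disk_avg f x eps|)%:E <= kappa%:E * LinfB1 f)%E].

Fixpoint iterD (vs : seq (R * R)) (f : R * R -> R) : R * R -> R :=
  match vs with
  | [::] => f
  | v :: vs' => 'D_v (iterD vs' f)
  end.

Definition smooth (f : R * R -> R) : Prop :=
  forall (vs : seq (R * R)) (x : R * R), differentiable (iterD vs f) x.

Definition test_fun (phi : R * R -> R) : Prop :=
  smooth phi /\ exists r : R, r < 1 /\ forall x, r <= eucl x -> phi x = 0.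

Definition e1 : R * R := (1, 0).
Definition e2 : R * R := (0, 1).

Definition L2B1 (g : R * R -> R) : Prop :=
  measurable_fun B1 g /\ (\int[leb2]_(x in B1) ((g x) ^+ 2)%:E < +oo)%E.

Definition weak_grad (xi g1 g2 : R * R -> R) : Prop :=
  forall phi, test_fun phi ->
    (\int[leb2]_(x in B1) (xi x * 'D_e1 phi x)%:E
       = - \int[leb2]_(x in B1) (g1 x * phi x)%:E)%E /\
    (\int[leb2]_(x in B1) (xi x * 'D_e2 phi x)%:E
       = - \int[leb2]_(x in B1) (g2 x * phi x)%:E)%E.

Definition H1B1_grad (xi g1 g2 : R * R -> R) : Prop :=
  L2B1 xi /\ L2B1 g1 /\ L2B1 g2 /\ weak_grad xi g1 g2.

Definition Hm1_admissible (xi : R * R -> R) : Prop :=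
  exists g1 g2, H1B1_grad xi g1 g2 /\
    (\int[leb2]_(x in B1) ((g1 x) ^+ 2 + (g2 x) ^+ 2)%:E <= 1)%E.

Definition Hm1_norm (f : R * R -> R) : \bar R :=
  ereal_sup [set (\int[leb2]_(x in B1) (f x * xi x)%:E)%E | xi in Hm1_admissible].

End Defs.

(* Main.v *)
(** Let [spin s tau] rotate the circle of radius [r] by the angle [s + tau r]; the solution
    at time [t] is [rho0 \o spin 0 (2 pi t)].  For a function [xi] on the disk whose gradient
    has norm at most [1], consider [E_f(s) = int_B1 xi (f \o spin s tau)], which is
    [2 pi]-periodic in [s] and, for [f = rho0], has mean zero because the circle means of
    [rho0] vanish.  It thus suffices to bound the oscillation of [E_f].
    - Differentiating in [s] produces the angular derivative of [f \o spin s tau];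
      integrating it by parts shows that [E_f] is Lipschitz with constant [||f||_2].
    - If [f] is smooth and supported in an annulus, the radial derivative of
      [f \o spin s tau] contains [tau] times the angular one, and integrating by parts in
      the radial direction expresses [tau E_f'] through quantities whose oscillation does
      not depend on [tau] or [xi].  Since [E_f'] vanishes somewhere, [E_f' = O(1 / tau)].
    Smooth annular functions being dense in L^2, the oscillation of [E_rho0] tends to zero
    as [tau] goes to infinity, uniformly in [xi]; this is the decay of the H^-1 norm.
    The averages over disks of radius [eps] are then controlled by testing the H^-1 norm
    against smooth cutoffs, whose gradients are bounded independently of the center. *)
Require Import Defs.
From HB Require Import structures.
From mathcomp Require Import all_boot all_order all_algebra.
From mathcomp Require Import all_classical all_reals all_analysis.
From mathcomp Require Import measurable_realfun ring lra.
Import Order.TTheory GRing.Theory Num.Theory.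
Import numFieldNormedType.Exports.
Local Open Scope classical_set_scope.
Local Open Scope ring_scope.

Set Implicit Arguments.
Unset Strict Implicit.

(** The test function [xi] is controlled only through its gradient: adding constants is free, so its
    L^2 norm may be arbitrarily large. Replacing the datum [f] by an annular [d] therefore cannot be
    paid for by [nrm X * nrm (f - d)]. What is uniform in [xi] is the Lipschitz constant of
    [E_(f - d)], at most [nrm (f - d)]: over one period the replacement costs at most
    [2 pi nrm (f - d)]. This is why an oscillation, and not a value, is estimated, the vanishing
    circle means serving only to convert one into the other. The annulus has two causes. The norm
    [|x|], hence the spin, is not smooth at the origin, and the argument divides [d] by [r], because
    [r d/dr] of [d1 \o spin s tau] contains [tau r] times the angular derivative of [d1]. Near the
    unit circle, vanishing makes [d] a test function for the weak gradient, so that integration by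
    parts leaves no boundary term. *)

(** * Lebesgue measure on the plane and Tonelli's theorem *)

Section plane_lebesgue_measure.
Variable R : realType.

Let leb2s : {measure
    set (measurableTypeR R * measurableTypeR R)%type -> \bar R} :=
  product_measure1 (@lebesgue_measure R) (@lebesgue_measure R).

Let leb20 : leb2 (@set0 (R * R)%type) = 0%E.
Proof. exact: (measure0 leb2s). Qed.

Let leb2_ge0 (A : set (R * R)%type) : (0 <= leb2 A)%E.
Proof. exact: (measure_ge0 leb2s). Qed.

Let leb2_sigma_additive : semi_sigma_additive (@leb2 R).
Proof. exact: (@measure_semi_sigma_additive _ _ _ leb2s). Qed.

HB.instance Definition _ := isMeasure.Build _ (R * R)%type _ (@leb2 R)
  leb20 leb2_ge0 leb2_sigma_additive.

Lemma leb2_rectangle (A B : set R) : measurable A -> measurable B ->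
  leb2 (A `*` B) = (lebesgue_measure A * lebesgue_measure B)%E.
Proof. by move=> mA mB; exact: product_measure1E. Qed.

Let leb2_sigma_finite : sigma_finite [set: R * R] (@leb2 R).
Proof.
pose I n : set R := [set` `[- n%:R, n%:R]%R].
have mI n : measurable (I n) by exact: measurable_itv.
exists (fun n => I n `*` I n); last first.
  move=> n; split; first exact: measurableX.
  rewrite leb2_rectangle// lebesgue_measure_itv/=; case: ifP => _.
    by rewrite -EFinB -EFinM ltry.
  by rewrite mul0e ltry.
apply/esym/seteqP; split => // -[x y] _.
exists (Num.truncn (Num.max `|x| `|y|)).+1 => //=.
have : Num.max `|x| `|y| <= (Num.truncn (Num.max `|x| `|y|)).+1%:R.
  by rewrite ltW// truncnS_gt.
by rewrite ge_max !ler_norml /I /= !in_itv => /andP[].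
Qed.

HB.instance Definition _ := Measure_isSigmaFinite.Build _ (R * R)%type _ (@leb2 R)
  leb2_sigma_finite.

(* [leb2] is by construction a measure on the product of two copies of
   [measurableTypeR R], which differs from [R * R] by its display only. *)
Lemma ge0_integral_product_display (f : R * R -> \bar R) :
  measurable_fun setT f -> (forall x, 0 <= f x)%E ->
  (\int[product_measure1 (@lebesgue_measure R) (@lebesgue_measure R)]_x f x =
   \int[leb2 (R:=R)]_x f x)%E.
Proof.
move=> mf f0.
have mid : @measurable_fun _ _ (measurableTypeR R * measurableTypeR R)%type
  (R * R)%type setT id by move=> _ A mA; rewrite setTI.
have := @ge0_integral_pushforward _ _ (measurableTypeR R * measurableTypeR R)%type
  (R * R)%type R id mid leb2s setT f measurableT mf.
by move=> <- // y _; exact: f0.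
Qed.

Lemma integral_product_display (f : R * R -> \bar R) : measurable_fun setT f ->
  (\int[product_measure1 (@lebesgue_measure R) (@lebesgue_measure R)]_x f x =
   \int[leb2 (R:=R)]_x f x)%E.
Proof.
move=> mf; rewrite integralE [RHS]integralE; congr (_ - _)%E.
  apply: ge0_integral_product_display; first exact: measurable_funepos.
  by move=> x; exact: funepos_ge0.
apply: ge0_integral_product_display; first exact: measurable_funeneg.
by move=> x; exact: funeneg_ge0.
Qed.

Lemma leb2_tonelli (f : R * R -> \bar R) :
  measurable_fun setT f -> (forall x, 0 <= f x)%E ->
  (\int[leb2 (R:=R)]_x f x =
   \int[lebesgue_measure]_x \int[lebesgue_measure]_y f (x, y))%E.
Proof.
move=> mf f0; rewrite -ge0_integral_product_display//.
exact: (@fubini_tonelli1 _ _ _ _ _ (@lebesgue_measure R) (@lebesgue_measure R) f mf f0).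
Qed.

End plane_lebesgue_measure.

(** * Measures given by a density *)

Section density_measure.
Context d (T : measurableType d) (R : realType).
Variables (mu : {measure set T -> \bar R}) (g : T -> R).
Hypotheses (mg : measurable_fun setT g) (g0 : forall x, 0 <= g x).

Let mgE : measurable_fun setT (EFin \o g). Proof. exact/measurable_EFinP. Qed.

Definition density_fun (A : set T) : \bar R := (\int[mu]_(x in A) (g x)%:E)%E.

Let density_fun0 : density_fun set0 = 0%E.
Proof. by rewrite /density_fun integral_set0. Qed.

Let density_fun_ge0 A : (0 <= density_fun A)%E.
Proof. by apply: integral_ge0 => x _; rewrite lee_fin. Qed.

Let density_fun_sigma_additive : semi_sigma_additive density_fun.
Proof.
move=> F mF tF mUF; rewrite /density_fun ge0_integral_bigcup//.
- apply: is_cvg_ereal_nneg_natsum_cond => n _ _.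
  exact: density_fun_ge0.
- exact: measurable_funTS mgE.
- by move=> x _; rewrite lee_fin.
Qed.

Definition density : {measure set T -> \bar R} :=
  HB.pack density_fun (isMeasure.Build _ _ _ density_fun
    density_fun0 density_fun_ge0 density_fun_sigma_additive).

Import HBNNSimple.

(** Both sides are monotone limits along simple functions increasing to [f]; for a simple function,
    linearity reduces the claim to indicators, where it is the definition of [density]. *)
Lemma ge0_integral_density (f : T -> \bar R) :
  measurable_fun setT f -> (forall x, 0 <= f x)%E ->
  (\int[density]_x f x = \int[mu]_x (f x * (g x)%:E))%E.
Proof.
move=> mf f0.
pose f_ := nnsfun_approx measurableT mf.
have cvgf x : (f_ n x)%:E @[n --> \oo] --> f x.
  by apply: cvg_nnsfun_approx.
transitivity (limn (fun n => \int[density]_x (f_ n x)%:E))%E.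
  rewrite -monotone_convergence//.
  - by apply: eq_integral => y _; apply/esym/cvg_lim.
  - by move=> n; exact/measurable_EFinP/measurable_funP.
  - by move=> n y _; rewrite lee_fin.
  - by move=> y _ m n mn; rewrite lee_fin; exact/lefP/nd_nnsfun_approx.
transitivity (limn (fun n => \int[mu]_x ((f_ n x)%:E * (g x)%:E)))%E; last first.
  rewrite -monotone_convergence//.
  - apply: eq_integral => y _; apply/cvg_lim => //.
    exact: cvgeZr.
  - move=> n; apply: emeasurable_funM => //.
    exact/measurable_EFinP/measurable_funP.
  - by move=> n y _; rewrite mule_ge0 ?lee_fin.
  - move=> y _ m n mn; apply: lee_wpmul2r; first by rewrite lee_fin.
    by rewrite lee_fin; exact/lefP/nd_nnsfun_approx.
congr (limn _); apply/funext => n.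
transitivity (\sum_(k \in range (f_ n)) (k%:E * density (f_ n @^-1` [set k])))%E.
  by rewrite integralT_nnsfun sintegralE.
transitivity (\sum_(k \in range (f_ n))
    \int[mu]_x ((k * \1_(f_ n @^-1` [set k]) x)%:E * (g x)%:E))%E; last first.
  rewrite -ge0_integral_fsum//.
  - apply: eq_integral => x _; rewrite -ge0_mule_fsuml; last first.
      by move=> i; rewrite nnfun_muleindic_ge0.
    by congr (_ * _)%E; rewrite fsumEFin// -fimfunE.
  - move=> r; apply: emeasurable_funM => //.
    exact/measurable_EFinP/measurable_funM.
  - move=> r x _; apply: mule_ge0; last by rewrite lee_fin.
    by rewrite EFinM nnfun_muleindic_ge0.
apply: eq_fsbigr => r; rewrite inE => -[y _ fy].
have r0 : 0 <= r by rewrite -fy.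
under eq_integral do rewrite EFinM -muleA.
rewrite ge0_integralZl//.
- congr (_ * _)%E; rewrite /density/= /density_fun integral_mkcond.
  apply: eq_integral => x _; rewrite patchE indicE.
  by case: (x \in _); rewrite ?mul1e ?mul0e.
- apply: emeasurable_funM => //.
  by apply/measurable_EFinP.
- by move=> x _; rewrite mule_ge0 ?lee_fin.
Qed.

End density_measure.

(** * Affine change of variables on the line *)

Section affine_substitution.
Variable R : realType.
Local Notation mu := (@lebesgue_measure R).

Lemma affine_preimage_itv (a b x y : R) : a != 0 ->
  (fun t => a * t + b) @^-1` `]x, y]%classic =
  (if 0 < a then `]((x - b) / a), ((y - b) / a)]
   else `[((y - b) / a), ((x - b) / a)[)%classic.
Proof.
move=> a0; case: ifPn => a1.
  apply/seteqP; split=> t /=; rewrite !in_itv/= ltr_pdivrMr// ler_pdivlMr//; lra.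
have {}a1 : a < 0 by rewrite lt_neqAle a0 leNgt.
by apply/seteqP; split=> t /=; rewrite !in_itv/= ler_ndivrMr// ltr_ndivlMr//; lra.
Qed.

(** The image of Lebesgue measure under the affine map, scaled by [|a|], gives half-open intervals
    their length, hence is Lebesgue measure by uniqueness. *)
Lemma ge0_integral_affine (a b : R) (f : R -> \bar R) : a != 0 ->
  measurable_fun setT f -> (forall x, 0 <= f x)%E ->
  (\int[mu]_x f x = `|a|%:E * \int[mu]_x f (a * x + b)%R)%E.
Proof.
move=> a0 mf f0.
have mphi : measurable_fun setT
    (fun t : measurableTypeR R => (a * t + b : measurableTypeR R)).
  by apply: measurable_funD => //; exact: measurable_funM.
pose nu : {measure set (measurableTypeR R) -> \bar R} :=
  mscale (NngNum (normr_ge0 a)) (pushforward mu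
    (fun t : measurableTypeR R => (a * t + b : measurableTypeR R))).
have -> : (\int[mu]_x f x = \int[nu mphi]_x f x)%E.
  apply: eq_measure_integral => A mA _.
  apply: (@lebesgue_measure_unique R (nu mphi)) => // _ [[x y]] _ <-.
  transitivity (`|a|%:E * mu ((fun t => a * t + b)%R @^-1` `]x, y]%classic))%E;
    last by [].
  rewrite affine_preimage_itv//.
  case: ifPn => a1; rewrite ?lebesgue_measure_itv/= ?lte_fin.
    rewrite gtr0_norm// ltr_pM2r ?invr_gt0// ltrD2r.
    case: ifPn => _; last by rewrite mule0.
    by rewrite -!EFinB -EFinM; congr EFin; field.
  have {}a1 : a < 0 by rewrite lt_neqAle a0 leNgt.
  rewrite ltr0_norm// ltr_nM2r ?invr_lt0// ltrD2r.
  case: ifPn => _; last by rewrite mule0.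
  by rewrite -!EFinB -EFinM; congr EFin; field.
rewrite ge0_integral_mscale//; congr (_ * _)%E.
by rewrite ge0_integral_pushforward.
Qed.

End affine_substitution.

(** * Translation, reflection, periodicity and the arctangent substitution *)

Section line_integrals.
Variable R : realType.
Local Notation mu := (@lebesgue_measure R).

Lemma ge0_integral_shift (c : R) (A : set R) (f : R -> \bar R) :
  measurable A -> measurable_fun setT f -> (forall x, 0 <= f x)%E ->
  (\int[mu]_(x in A) f x = \int[mu]_(x in (fun x => x + c)%R @^-1` A) f (x + c)%R)%E.
Proof.
move=> mA mf f0; rewrite integral_mkcond [RHS]integral_mkcond.
rewrite (@ge0_integral_affine _ 1 c) ?oner_neq0 ?normr1 ?mul1e//.
- by apply: eq_integral => x _; rewrite mul1r !patchE.
- exact/(measurable_restrictT _ _).1/measurable_funTS.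
- by move=> x; rewrite patchE; case: ifP.
Qed.

Lemma ge0_integral_opp (A : set R) (f : R -> \bar R) :
  measurable A -> measurable_fun setT f -> (forall x, 0 <= f x)%E ->
  (\int[mu]_(x in A) f x = \int[mu]_(x in -%R @^-1` A) f (- x)%R)%E.
Proof.
move=> mA mf f0; rewrite integral_mkcond [RHS]integral_mkcond.
rewrite (@ge0_integral_affine _ (-1) 0) ?oppr_eq0 ?oner_neq0//.
- rewrite normrN normr1 mul1e.
  by apply: eq_integral => x _; rewrite mulN1r addr0 !patchE.
- exact/(measurable_restrictT _ _).1/measurable_funTS.
- by move=> x; rewrite patchE; case: ifP.
Qed.

(** Shifting by a multiple of [T] replaces [c] by its residue [c'] in [[0, T)]. The windows []c', c'
    + T]] and []0, T]] then share []c', T]], and the remaining pieces differ by a shift by [T]. *)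
Lemma ge0_integral_period (T c : R) (f : R -> \bar R) :
  0 < T -> measurable_fun setT f -> (forall x, 0 <= f x)%E ->
  (forall x, f (x + T)%R = f x) ->
  (\int[mu]_(x in `]c, (c + T)%R]%classic) f x = \int[mu]_(x in `]0%R, T]%classic) f x)%E.
Proof.
move=> T0 mf f0 fT.
have shift_itv (d a b : R) :
    ((fun x => x + d) @^-1` `]a, b] = `](a - d), (b - d)])%classic.
  by apply/seteqP; split=> t /=; rewrite !in_itv/=; lra.
have fTn (n : nat) x : f (x + T *+ n)%R = f x.
  elim: n => [|n IH] in x *; first by rewrite mulr0n addr0.
  by rewrite mulrS addrA IH fT.
have fTz (k : int) x : f (x + T *~ k)%R = f x.
  case: k => n; first exact: fTn.
  by rewrite NegzE mulrNz -[LHS](fTn n.+1) -pmulrn subrK.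
pose k := Num.floor (c / T); pose c' := c - T *~ k.
have c'0 : 0 <= c'.
  rewrite subr_ge0 -mulrzl -ler_pdivlMr//; exact: floor_le.
have c'T : c' < T.
  have := floorD1_gt (c / T); rewrite intrD ltr_pdivrMr// mulrDl mul1r mulrzl.
  by rewrite /c' ltrBlDl.
transitivity (\int[mu]_(x in `]c', (c' + T)%R]%classic) f x)%E.
  rewrite (@ge0_integral_shift (T *~ k))// shift_itv /c' addrAC.
  by apply: eq_integral => x _; rewrite fTz.
have U1 : (`]c', c' + T] = `]c', T] `|` `]T, c' + T])%classic.
  by rewrite -itv_bndbnd_setU ?bnd_simp//; lra.
have U2 : (`]0, T] = `]0, c'] `|` `]c', T])%classic.
  by rewrite -itv_bndbnd_setU ?bnd_simp//; lra.
rewrite U1 U2 !ge0_integral_setU//=.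
- rewrite addeC; congr (_ + _)%E.
  rewrite (@ge0_integral_shift T)// shift_itv subrr addrK.
  by apply: eq_integral => x _; rewrite fT.
- exact: measurable_funTS.
- by apply/disj_setPLR => t /=; rewrite !in_itv/=; lra.
- exact: measurable_funTS.
- by apply/disj_setPLR => t /=; rewrite !in_itv/=; lra.
Qed.

Lemma measurable_tan_restrict :
  measurable_fun setT (fun a : R => if a \in `](- (pi / 2)), (pi / 2)[%classic then tan a else 0).
Proof.
pose D := `](- (pi / 2)), (pi / 2)[%classic : set R.
have mD : measurable D by exact: measurable_itv.
have -> : (fun a : R => if a \in D then tan a else 0) = tan \_ D by [].
suff : measurable_fun D (@tan R) by move/(measurable_restrictT _ mD).
apply: subspace_continuous_measurable_fun => //.
apply: continuous_in_subspaceT => x; rewrite inE => xD.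
have {}xD : - (pi / 2) < x < pi / 2 by move: xD; rewrite /D/= in_itv.
by apply: continuous_tan; rewrite gt_eqF// cos_gt0_pihalf.
Qed.

(** Two measures on the line are compared: the image under [tan] of Lebesgue measure on the
    interval, and the measure with density [1 / (1 + m^2)]. On []a, b]] both give [atan b - atan a],
    the second by the fundamental theorem of calculus, so they coincide. This avoids a substitution
    rule for integrands that are merely measurable. *)
Lemma ge0_integral_atan (h : R -> \bar R) :
  measurable_fun setT h -> (forall x, 0 <= h x)%E ->
  (\int[mu]_(a in `](- (pi / 2))%R, (pi / 2)%R[%classic) h a =
   \int[mu]_m (h (atan m) * ((1 + m ^+ 2)^-1)%:E))%E.
Proof.
move=> mh h0.
pose D := `](- (pi / 2)), (pi / 2)[%classic : set R.
have mD : measurable D by exact: measurable_itv.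
pose phi (a : measurableTypeR R) : measurableTypeR R :=
  if a \in D then tan a else 0.
have mphi : measurable_fun setT phi by exact: measurable_tan_restrict.
have mind : measurable_fun setT (\1_D : measurableTypeR R -> R) by [].
have ind0 x : 0 <= \1_D x :> R by [].
have cder (x : R) : {for x, continuous (fun m : R => (1 + m ^+ 2)^-1)}.
  apply: (@continuousV _ _ (fun m : R => 1 + m ^+ 2)).
    by rewrite gt_eqF// ltr_wpDr// sqr_ge0.
  by apply: continuousD; [exact: cvg_cst|exact: exprn_continuous].
have mden : measurable_fun setT (fun m : measurableTypeR R => (1 + m ^+ 2)^-1 : R).
  by apply: continuous_measurable_fun => x; exact: cder.
have den0 (m : R) : 0 <= (1 + m ^+ 2)^-1.
  by rewrite invr_ge0 addr_ge0// sqr_ge0.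
have matan : measurable_fun setT (@atan R).
  by apply: continuous_measurable_fun => x; exact: continuous_atan.
pose nu1 : {measure set (measurableTypeR R) -> \bar R} :=
  pushforward (density mu mind ind0) phi.
pose nu2 : {measure set (measurableTypeR R) -> \bar R} := density mu mden den0.
have nu1E (A : set (measurableTypeR R)) : measurable A ->
    nu1 mphi A = mu (D `&` phi @^-1` A).
  move=> mA; rewrite /nu1/= /pushforward/= /density_fun integral_indic//.
  by rewrite -(setTI (_ @^-1` _)); apply: mphi.
have nu12 (A : set (measurableTypeR R)) : measurable A -> nu1 mphi A = nu2 A.
  pose g n : set (measurableTypeR R) := `](- n%:R), n%:R]%classic.
  move=> mA; refine (@measure_unique _ R (measurableTypeR R) (@ocitv R) g erefl
    _ _ _ (nu1 mphi) nu2 _ _ A mA) => //.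
  - exact: (@measurableI _ (ocitv_type R)).
  - by move=> n; exact: is_ocitv.
  - apply/seteqP; split => // x _; exists (Num.truncn `|x|).+1 => //=.
    have := truncnS_gt `|x|; rewrite ltr_norml /g/= in_itv/= => /andP[-> /ltW].
    by [].
  - move=> _ [[a b]] _ <-; rewrite -[(a, b).1]/a -[(a, b).2]/b.
    have [ba|ab] := leP b a.
      by rewrite set_itv_ge ?bnd_simp -?leNgt// !measure0.
    have E : D `&` phi @^-1` `]a, b]%classic = `](atan a), (atan b)]%classic.
      apply/seteqP; split=> t /=; rewrite !in_itv/= /phi.
        move=> [tD]; rewrite mem_set//= => /andP[at_ tb].
        by have tE := tanK tD; rewrite -{1}tE lt_atan//= -tE le_atan.
      move=> /andP[at_ tb]; have tD : D t.
        rewrite /D/= in_itv/= (lt_trans (atan_gtNpi2 a))//=.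
        exact: le_lt_trans (atan_ltpi2 b).
      split => //; rewrite mem_set//.
      have : tan t \in `]a, b].
        rewrite in_itv/=; apply/andP; split.
          by rewrite ltNge; apply/negP => /le_atan; rewrite tanK// leNgt at_.
        by rewrite leNgt; apply/negP => /lt_atan; rewrite tanK// ltNge tb.
      by rewrite in_itv.
    rewrite nu1E ?E; last exact: measurable_itv.
    rewrite lebesgue_measure_itv/= lte_fin lt_atan// -EFinB.
    rewrite /nu2/= /density_fun integral_itv_obnd_cbnd; last first.
      exact/measurable_funTS/measurable_EFinP.
    rewrite (@continuous_FTC2 _ _ (@atan R))//.
    + apply: continuous_subspaceT => x; exact: cder.
    + split => [x _| |].
      * by have [] := is_derive1_atan x.
      * by apply: cvg_at_right_filter; exact: continuous_atan.
      * by apply: cvg_at_left_filter; exact: continuous_atan.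
    + by move=> x _; rewrite derive1E; have [] := is_derive1_atan x.
  - move=> k; rewrite nu1E; last exact: measurable_itv.
    apply: (@le_lt_trans _ _ (mu D)).
      apply: le_measure; rewrite ?inE//.
      apply: measurableI => //; rewrite -(setTI (_ @^-1` _)).
      by apply: (mphi) => //; exact: measurable_itv.
    by rewrite /D lebesgue_measure_itv/=; case: ifP => _; rewrite -?EFinB ltry.
transitivity (\int[nu1 mphi]_m h (atan m))%E.
  have mhat : measurable_fun setT ((h \o @atan R) : measurableTypeR R -> _).
    exact: measurableT_comp.
  transitivity (\int[density mu mind ind0]_x ((h \o @atan R) \o phi) x)%E;
    last by rewrite ge0_integral_pushforward.
  rewrite (ge0_integral_density mu mind ind0 (measurableT_comp mhat mphi));
    last by move=> x; exact: h0.
  rewrite [LHS]integral_mkcond; apply: eq_integral => x _.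
  rewrite patchE indicE /= /phi; case: ifPn => xD; last by rewrite mule0.
  by rewrite mule1 tanK// -inE.
transitivity (\int[nu2]_m h (atan m))%E.
  by apply: eq_measure_integral => A mA _; exact: nu12.
by rewrite ge0_integral_density//; exact: measurableT_comp.
Qed.

End line_integrals.

(** * Integration in polar coordinates *)

Section polar_coordinates.
Variable R : realType.
Local Notation mu := (@lebesgue_measure R).

Lemma measurable_cos : measurable_fun setT (@cos R).
Proof. by apply: continuous_measurable_fun => x; exact: continuous_cos. Qed.

Lemma measurable_sin : measurable_fun setT (@sin R).
Proof. by apply: continuous_measurable_fun => x; exact: continuous_sin. Qed.

Lemma sin_atan (m : R) : sin (atan m) = cos (atan m) * m.
Proof.
rewrite -{3}(atanK m) /tan mulrCA divff ?mulr1//.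
by rewrite gt_eqF// cos_gt0_pihalf// atan_gtNpi2 atan_ltpi2.
Qed.

Lemma measurable_polar (d : measure_display) (T : measurableType d)
    (a b : T -> R) (f : R * R -> \bar R) : measurable_fun setT f ->
  measurable_fun setT a -> measurable_fun setT b ->
  measurable_fun setT (fun t => f (a t * cos (b t), a t * sin (b t))).
Proof.
move=> mf ma mb; apply: measurableT_comp mf _.
apply: measurable_fun_pair; apply: measurable_funM => //.
  exact: measurableT_comp measurable_cos _.
exact: measurableT_comp measurable_sin _.
Qed.

Lemma measurable_fun_integral_param (d : measure_display) (T : measurableType d)
    (D : set R) (f : T * R -> \bar R) :
  measurable D -> measurable_fun setT f -> (forall x, 0 <= f x)%E ->
  measurable_fun setT (fun x => \int[mu]_(a in D) f (x, a))%E.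
Proof.
move=> mD mf f0.
pose g (z : T * measurableTypeR R) := (f z * (\1_D z.2)%:E)%E.
have mg : measurable_fun setT g.
  apply: emeasurable_funM => //.
  by apply/measurable_EFinP; apply: measurableT_comp.
have g0 z : (0 <= g z)%E by rewrite mule_ge0// lee_fin.
have := measurable_fun_fubini_tonelli_F (m2 := mu) g mg g0.
congr (measurable_fun _ _); apply/funext => x; rewrite integral_mkcond.
apply: eq_integral => a _; rewrite patchE /g/= indicE.
by case: (a \in D); rewrite ?mule1 ?mule0.
Qed.

(** The plane is swept by the lines through the origin, with a signed radius [r]. Going through the
    slope [m = tan a] needs only one-dimensional substitutions and Tonelli, no Jacobian in the
    plane. *)
Lemma polar_lines (f : R * R -> \bar R) :
  measurable_fun setT f -> (forall x, 0 <= f x)%E ->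
  (\int[leb2 (R:=R)]_x f x =
   \int[mu]_(a in `](- (pi / 2))%R, (pi / 2)%R[%classic) \int[mu]_r
     (`|r|%:E * f (r * cos a, r * sin a)%R))%E.
Proof.
move=> mf f0; rewrite (leb2_tonelli mf f0).
pose F (z : measurableTypeR R * measurableTypeR R) :=
  (`|z.1|%:E * f (z.1, z.1 * z.2)%R)%E.
have mF : measurable_fun setT F.
  apply: emeasurable_funM.
    by apply/measurable_EFinP; apply: measurableT_comp.
  apply: measurableT_comp mf _; apply: measurable_fun_pair => //.
  exact: measurable_funM.
have F0 z : (0 <= F z)%E by rewrite mule_ge0// lee_fin.
(* Substitute [y = x m] on each vertical line; the line [x = 0], where this degenerates, is null. *)
transitivity (\int[mu]_x \int[mu]_m F (x, m))%E.
  apply: ge0_ae_eq_integral => //.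
  - apply: (measurable_fun_fubini_tonelli_F (m2 := mu) f) => //.
  - exact: (measurable_fun_fubini_tonelli_F (m2 := mu) F).
  - by move=> x _; exact: integral_ge0.
  - by move=> x _; exact: integral_ge0.
  exists [set 0]; split => //; first exact: lebesgue_measure_set1.
  move=> x /=; apply: contra_notP => /eqP x0 _.
  rewrite (ge0_integral_affine 0 x0)//; last first.
    exact: measurableT_comp mf (pair1_measurable x).
  rewrite -ge0_integralZl//; last first.
    apply: (measurableT_comp mf); apply: measurable_fun_pair => //.
    by apply: measurable_funD => //; exact: measurable_funM.
  by apply: eq_integral => m _; rewrite addr0.
rewrite (fubini_tonelli F mF F0).
pose G (z : measurableTypeR R * measurableTypeR R) :=
  (`|z.2|%:E * f (z.2 * cos z.1, z.2 * sin z.1)%R)%E.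
have mG : measurable_fun setT G.
  apply: emeasurable_funM.
    by apply/measurable_EFinP; apply: measurableT_comp.
  exact: measurable_polar.
have G0 z : (0 <= G z)%E by rewrite mule_ge0// lee_fin.
(* With [m = tan a] and [x = r cos a], the weight [|x| dx] becomes [cos^2 a |r| dr], and [cos^2 a]
   is exactly the density [1 / (1 + m^2)]. *)
rewrite (ge0_integral_atan (h := fun a => \int[mu]_r G (a, r))%E).
- apply: eq_integral => m _.
  have c0 : cos (atan m) != 0.
    by rewrite gt_eqF// cos_gt0_pihalf// atan_gtNpi2 atan_ltpi2.
  rewrite [LHS](ge0_integral_affine 0 c0)//; last first.
    exact: (measurableT_comp mF (pair2_measurable m)).
  rewrite muleC -ge0_integralZr//; last first.
    apply: (measurableT_comp mF); apply: measurable_fun_pair => //.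
    by apply: measurable_funD => //; exact: measurable_funM.
  rewrite -ge0_integralZr ?lee_fin ?invr_ge0 ?addr_ge0 ?sqr_ge0//; last first.
    exact: (measurableT_comp mG (pair1_measurable (atan m))).
  apply: eq_integral => r _; rewrite /F/G/= addr0 sin_atan.
  have -> : (1 + m ^+ 2)^-1 = `|cos (atan m)| * `|cos (atan m)|.
    rewrite -normrM -expr2 ger0_norm ?sqr_ge0// cos_atan exprVn sqr_sqrtr//.
    by rewrite addr_ge0// sqr_ge0.
  rewrite normrM !EFinM -!muleA muleCA; congr (_ * _)%E.
  rewrite muleC -muleA; congr (f (_, _) * _)%E; first by rewrite mulrC.
  by rewrite [in RHS]mulrA [cos _ * r]mulrC.
- exact: (measurable_fun_fubini_tonelli_F (m2 := mu) G).
- by move=> a; exact: integral_ge0.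
Qed.

(** A negative radius at angle [a] is a positive radius at angle [a + pi]; the two half-turns
    assemble into a full turn, whose starting angle is irrelevant by periodicity. *)
Lemma ge0_integral_polar (f : R * R -> \bar R) :
  measurable_fun setT f -> (forall x, 0 <= f x)%E ->
  (\int[leb2 (R:=R)]_x f x =
   \int[mu]_(r in `]0%R, +oo[%classic) (r%:E *
     \int[mu]_(a in `]0%R, (2 * pi)%R]%classic) f (r * cos a, r * sin a)%R))%E.
Proof.
move=> mf f0; rewrite polar_lines//.
set D := `](- (pi / 2))%R, (pi / 2)%R[%classic.
have pi0 : 0 < pi :> R by exact: pi_gt0.
have mD : measurable D by exact: measurable_itv.
pose G (z : measurableTypeR R * measurableTypeR R) :=
  (`|z.2|%:E * f (z.2 * cos z.1, z.2 * sin z.1)%R * (\1_D z.1)%:E)%E.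
have mG : measurable_fun setT G.
  apply: emeasurable_funM; last first.
    by apply/measurable_EFinP; apply: measurableT_comp.
  apply: emeasurable_funM.
    by apply/measurable_EFinP; apply: measurableT_comp.
  exact: measurable_polar.
have G0 z : (0 <= G z)%E by rewrite !mule_ge0// lee_fin.
have mfr (r : R) : measurable_fun setT (fun a => f (r * cos a, r * sin a)).
  exact: measurable_polar.
pose K r := (\int[mu]_(a in D) f (r * cos a, r * sin a)%R)%E.
transitivity (\int[mu]_r (`|r|%:E * K r))%E.
  transitivity (\int[mu]_a \int[mu]_r G (a, r))%E.
    rewrite integral_mkcond; apply: eq_integral => a _.
    rewrite patchE; case: ifPn => aD; last first.
      rewrite integral0_eq// => r _.
      by rewrite /G/= indicE (negbTE aD) mule0.
    by apply: eq_integral => r _; rewrite /G/= indicE aD mule1.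
  rewrite (fubini_tonelli G)//; apply: eq_integral => r _.
  rewrite -ge0_integralZl//; last exact: measurable_funTS (mfr r).
  rewrite [RHS]integral_mkcond; apply: eq_integral => a _.
  by rewrite /G/= patchE indicE; case: (a \in D); rewrite ?mule1 ?mule0.
have mK : measurable_fun setT K.
  apply: (@measurable_fun_integral_param _ _ D
    (fun z : R * R => f (z.1 * cos z.2, z.1 * sin z.2))) => //.
  exact: measurable_polar.
have mrK : measurable_fun setT (fun r : R => `|r|%:E * K r)%E.
  by apply: emeasurable_funM => //; apply/measurable_EFinP; exact: normr_measurable.
have K0 r : (0 <= K r)%E by exact: integral_ge0.
have rK0 r : (0 <= `|r|%:E * K r)%E by rewrite mule_ge0.
have -> : [set: R] = (`]0, +oo[ `|` `]-oo, 0])%classic.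
  by apply/seteqP; split => // x _ /=; rewrite !in_itv/= andbT; apply/orP; case: ltP.
rewrite ge0_integral_setU//=; last 2 first.
- exact: measurable_funTS.
- by apply/disj_setPLR => t /=; rewrite !in_itv/= andbT; case: ltP.
rewrite [X in (_ + X)%E](ge0_integral_opp)//.
have -> : (-%R @^-1` `]-oo, (0 : R)] = `[0, +oo[)%classic.
  by apply/seteqP; split => x /=; rewrite !in_itv/= andbT oppr_le0.
have mrKN : measurable_fun setT (fun r : R => `|- r|%:E * K (- r)%R)%E.
  exact: (measurableT_comp mrK).
rewrite -[X in (_ + X)%E]integral_itv_obnd_cbnd; last exact: measurable_funTS mrKN.
rewrite -ge0_integralD//=; first last.
- exact: measurable_funTS mrKN.
- exact: measurable_funTS.
apply: eq_integral => r; rewrite inE/= in_itv/= andbT => r0.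
rewrite normrN gtr0_norm// -ge0_muleDr//; congr (_ * _)%E.
pose h a := f (r * cos a, r * sin a).
have mh : measurable_fun setT h by exact: mfr.
have h0 a : (0 <= h a)%E by exact: f0.
have h2 a : h (a + 2 * pi) = h a.
  by rewrite /h mulr_natl cosD2pi sinD2pi.
have pi20 : 0 < 2 * pi :> R by rewrite mulr_gt0.
rewrite -(@ge0_integral_period _ (2 * pi) (- (pi / 2)) h)//.
have U : (`](- (pi / 2)), (- (pi / 2) + 2 * pi)] =
    `](- (pi / 2)), (pi / 2)] `|` `](pi / 2), (- (pi / 2) + 2 * pi)] :> set R)%classic.
  by rewrite -itv_bndbnd_setU ?bnd_simp//; lra.
rewrite U ge0_integral_setU//=; last 2 first.
- exact: measurable_funTS.
- by apply/disj_setPLR => t /=; rewrite !in_itv/=; lra.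
congr (_ + _)%E.
  by rewrite /K /D integral_itv_bndo_bndc//; exact: measurable_funTS.
rewrite (@ge0_integral_shift _ pi)//.
have -> : ((fun x => x + pi) @^-1` `](pi / 2), (- (pi / 2) + 2 * pi)] =
    `](- (pi / 2)), (pi / 2)] :> set R)%classic.
  by apply/seteqP; split => t /=; rewrite !in_itv/=; lra.
rewrite -[RHS]integral_itv_bndo_bndc; last first.
  by apply: measurable_funTS; apply: measurableT_comp mh _; exact: measurable_funD.
by apply: eq_integral => a _; rewrite /h cosDpi sinDpi !mulrN !mulNr.
Qed.

End polar_coordinates.

(** * Measurability in the plane, disks and translations *)

Section planar_measurability.
Variable R : realType.

(** An open set is the union of the rational squares it contains; in the triple union, squares not
    contained in [U] are replaced by the empty set. *)
Lemma open_measurable2 (U : set (R * R)%type) : open U -> measurable U.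
Proof.
move=> oU.
pose box (p q e : rat) : set (R * R)%type :=
  `](ratr p - ratr e), (ratr p + ratr e)[%classic `*`
  `](ratr q - ratr e), (ratr q + ratr e)[%classic.
suff -> : U = \bigcup_p \bigcup_q \bigcup_e
    (if `[< box p q e `<=` U >] then box p q e else set0).
  do 3! (apply: bigcupT_measurable_rat => ?).
  by case: ifP => _ //; apply: measurableX; exact: measurable_itv.
apply/seteqP; split; last first.
  by move=> z [p _ [q _ [e _]]]; case: ifPn => // /asboolP; apply.
move=> [x y] Uxy.
have /nbhs_ballP[d /= d0 dU] : nbhs (x, y) U by exact: open_nbhs_nbhs.
(* A half-side [e] between [d / 4] and [d / 2] and a centre within [d / 4] make the square contain
   the point and stay within distance [3 d / 4] of it. *)
have d40 : 0 < d / 4 by rewrite divr_gt0.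
have [e] := @rat_in_itvoo R (d / 4) (d / 2) ltac:(lra).
rewrite in_itv/= => /andP[e1 e2].
have [p] := @rat_in_itvoo R (x - d / 4) (x + d / 4) ltac:(lra).
rewrite in_itv/= => /andP[p1 p2].
have [q] := @rat_in_itvoo R (y - d / 4) (y + d / 4) ltac:(lra).
rewrite in_itv/= => /andP[q1 q2].
exists p => //; exists q => //; exists e => //.
case: asboolP => [_|].
  by split => /=; rewrite in_itv/=; lra.
case => -[u v] [/=]; rewrite !in_itv/= => /andP[u1 u2] /andP[v1 v2].
by apply: dU; split; rewrite /ball/= ltr_norml; lra.
Qed.

Lemma continuous_measurable_fun2 (f : R * R -> R) :
  continuous f -> measurable_fun setT f.
Proof.
move=> /continuousP cf; apply: (measurability _ (RGenOpens.measurableE R)).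
move=> _ [_ [a [b ->] <-]]; rewrite setTI; apply: open_measurable2.
exact/cf/interval_open.
Qed.

Lemma continuous_eucl : continuous (@eucl R).
Proof.
move=> x; apply: continuous_comp; last exact: sqrt_continuous.
apply: (@continuousD _ _ _ (fun z : R * R => z.1 ^+ 2) (fun z => z.2 ^+ 2)).
- apply: (@continuous_comp _ _ _ fst (fun t : R => t ^+ 2)).
    exact: cvg_fst.
  exact: exprn_continuous.
- apply: (@continuous_comp _ _ _ snd (fun t : R => t ^+ 2)).
    exact: cvg_snd.
  exact: exprn_continuous.
Qed.

Lemma measurable_eucl : measurable_fun setT (@eucl R).
Proof. by apply: continuous_measurable_fun2; exact: continuous_eucl. Qed.

Lemma measurable_disk (x : R * R) (r : R) : measurable (disk x r).
Proof.
have -> : disk x r = setT `&` (fun y : R * R => eucl (y.1 - x.1, y.2 - x.2)) @^-1` `]-oo, r[.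
  by apply/seteqP; split => y; rewrite /disk /= ?in_itv//= => -[].
have mf : measurable_fun setT (fun y : R * R => eucl (y.1 - x.1, y.2 - x.2)).
  apply: (measurableT_comp measurable_eucl).
  by apply: measurable_fun_pair; apply: measurable_funB.
by apply: mf => //; exact: measurable_itv.
Qed.

Lemma measurable_B1 : measurable (@B1 R).
Proof. exact: measurable_disk. Qed.

Lemma eucl_ge0 (x : R * R) : 0 <= eucl x.
Proof. exact: sqrtr_ge0. Qed.

Lemma sqr_eucl (x : R * R) : eucl x ^+ 2 = x.1 ^+ 2 + x.2 ^+ 2.
Proof. by rewrite sqr_sqrtr// addr_ge0 ?sqr_ge0. Qed.

Lemma B1E (x : R * R) : B1 x = (eucl x < 1) :> Prop.
Proof. by rewrite /B1 /disk/= !subr0; case: x. Qed.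

Lemma normr1_le_eucl (x : R * R) : `|x.1| <= eucl x.
Proof.
by rewrite -sqrtr_sqr ler_sqrt ?addr_ge0 ?sqr_ge0// lerDl sqr_ge0.
Qed.

Lemma normr2_le_eucl (x : R * R) : `|x.2| <= eucl x.
Proof.
by rewrite -sqrtr_sqr ler_sqrt ?addr_ge0 ?sqr_ge0// lerDr sqr_ge0.
Qed.

Lemma leb2_disk_lty (x : R * R) (r : R) : (leb2 (disk x r) < +oo)%E.
Proof.
pose Q := (`[(x.1 - r), (x.1 + r)] `*` `[(x.2 - r), (x.2 + r)])%classic.
have mQ : measurable Q by apply: measurableX; exact: measurable_itv.
apply: (@le_lt_trans _ _ (leb2 Q)).
  apply: le_measure; rewrite ?inE//; first exact: measurable_disk.
  move=> y; rewrite /disk/= => yr; split => /=; rewrite in_itv/=.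
  - have := le_lt_trans (normr1_le_eucl _) yr; rewrite ltr_norml/=; lra.
  - have := le_lt_trans (normr2_le_eucl _) yr; rewrite ltr_norml/=; lra.
rewrite leb2_rectangle; [|exact: measurable_itv..].
rewrite !lebesgue_measure_itv/=.
by do 2 case: ifP => _; rewrite ?mul0e ?mule0 -?EFinB -?EFinM ltry.
Qed.

Lemma leb2_B1_lty : (leb2 (@B1 R) < +oo)%E.
Proof. exact: leb2_disk_lty. Qed.

Lemma ge0_leb2_translation (v : R * R) (f : R * R -> \bar R) :
  measurable_fun setT f -> (forall x, 0 <= f x)%E ->
  (\int[leb2 (R:=R)]_x f (x.1 + v.1, x.2 + v.2)%R = \int[leb2 (R:=R)]_x f x)%E.
Proof.
move=> mf f0.
have mg : measurable_fun setT (fun x : R * R => f (x.1 + v.1, x.2 + v.2)).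
  by apply: measurableT_comp mf _; apply: measurable_fun_pair; apply: measurable_funD.
rewrite (leb2_tonelli mf f0) (leb2_tonelli mg (fun x => f0 _)).
have mF := measurable_fun_fubini_tonelli_F (m2 := @lebesgue_measure R) f mf f0.
rewrite [RHS](@ge0_integral_affine _ 1 v.1) ?oner_neq0//; last first.
  by move=> x; exact: integral_ge0.
rewrite normr1 mul1e; apply: eq_integral => x _.
rewrite [RHS](@ge0_integral_affine _ 1 v.2) ?oner_neq0//; last first.
  exact: (measurableT_comp mf (pair1_measurable _)).
by rewrite normr1 mul1e; apply: eq_integral => y _; rewrite !mul1r.
Qed.

End planar_measurability.

(** * The spin maps and their invariance properties *)

Section spin.
Variable R : realType.
Local Notation mu := (@lebesgue_measure R).
Local Notation rot := (@Defs.rot R).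

Definition spin (s tau : R) (x : R * R) : R * R := rot (s + tau * eucl x) x.

Lemma sol_spin (rho0 : R * R -> R) (t : R) :
  sol rho0 t = rho0 \o spin 0 (2 * pi * t).
Proof. by apply/funext => x; rewrite /sol /spin/= add0r. Qed.

Lemma eucl_rot (phi : R) (x : R * R) : eucl (rot phi x) = eucl x.
Proof.
rewrite /eucl /rot/=; congr Num.sqrt; have := cos2Dsin2 phi; nra.
Qed.

Lemma eucl_spin (s tau : R) (x : R * R) : eucl (spin s tau x) = eucl x.
Proof. exact: eucl_rot. Qed.

Lemma B1_spin (s tau : R) (x : R * R) : B1 (spin s tau x) = B1 x.
Proof. by rewrite !B1E eucl_spin. Qed.

Lemma rot_comp (phi psi : R) (x : R * R) : rot phi (rot psi x) = rot (phi + psi) x.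
Proof. by rewrite /rot/= cosD sinD; congr pair; ring. Qed.

Lemma rot_spin (b s tau : R) (x : R * R) : rot b (spin s tau x) = spin (b + s) tau x.
Proof. by rewrite /spin rot_comp addrA. Qed.

Lemma spinD2pi (s tau : R) (x : R * R) : spin (s + 2 * pi) tau x = spin s tau x.
Proof.
by rewrite /spin /rot mulr_natl addrAC cosD2pi sinD2pi.
Qed.

Lemma eucl_polar (r a : R) : 0 <= r -> eucl (r * cos a, r * sin a) = r.
Proof.
move=> r0; rewrite /eucl/= !exprMn -mulrDr cos2Dsin2 mulr1 sqrtr_sqr.
by rewrite ger0_norm.
Qed.

Lemma rot_polar (r a phi : R) :
  rot phi (r * cos a, r * sin a) = (r * cos (a + phi), r * sin (a + phi)).
Proof. by rewrite /rot/= cosD sinD; congr pair; ring. Qed.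

Lemma measurable_spin_param (d : measure_display) (T : measurableType d)
    (s tau : T -> R) (p : T -> R * R) :
  measurable_fun setT s -> measurable_fun setT tau -> measurable_fun setT p ->
  measurable_fun setT (fun t => spin (s t) (tau t) (p t)).
Proof.
move=> ms mt mp.
have mp1 : measurable_fun setT (fun t => (p t).1) by exact: measurableT_comp.
have mp2 : measurable_fun setT (fun t => (p t).2) by exact: measurableT_comp.
have ma : measurable_fun setT (fun t => s t + tau t * eucl (p t)).
  apply: measurable_funD => //; apply: measurable_funM => //.
  exact: measurableT_comp (@measurable_eucl R) mp.
have mc := measurableT_comp (@measurable_cos R) ma.
have ms' := measurableT_comp (@measurable_sin R) ma.
by apply: measurable_fun_pair => /=;
  [apply: measurable_funB|apply: measurable_funD]; exact: measurable_funM.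
Qed.

Lemma measurable_spin (s tau : R) : measurable_fun setT (spin s tau).
Proof. exact: (@measurable_spin_param _ _ (cst s) (cst tau) id). Qed.

(** In polar coordinates the map translates the angle on the circle of radius [r] by the constant
    [s + tau * r], which an integral over a period does not see. *)
Lemma ge0_integral_spin (s tau : R) (f : R * R -> \bar R) :
  measurable_fun setT f -> (forall x, 0 <= f x)%E ->
  (\int[leb2 (R:=R)]_x f (spin s tau x) = \int[leb2 (R:=R)]_x f x)%E.
Proof.
move=> mf f0.
have mfs : measurable_fun setT (f \o spin s tau).
  exact: measurableT_comp mf (measurable_spin s tau).
rewrite (ge0_integral_polar mfs (fun x => f0 _)) (ge0_integral_polar mf f0).
apply: eq_integral => r; rewrite inE/= in_itv/= andbT => r0; congr (_ * _)%E.
pose h a := f (r * cos a, r * sin a).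
have mh : measurable_fun setT h by exact: measurable_polar.
have h0 a : (0 <= h a)%E by exact: f0.
have h2 a : h (a + 2 * pi) = h a.
  by rewrite /h mulr_natl cosD2pi sinD2pi.
have pi20 : 0 < 2 * pi :> R by rewrite mulr_gt0// pi_gt0.
set c := s + tau * r.
rewrite -[RHS](@ge0_integral_period _ (2 * pi) c h)//.
rewrite [RHS](@ge0_integral_shift _ c)//.
have -> : ((fun x => x + c) @^-1` `]c, (c + 2 * pi)] = `]0, (2 * pi)] :> set R)%classic.
  by apply/seteqP; split => t /=; rewrite !in_itv/=; lra.
by apply: eq_integral => a _; rewrite /= /h -rot_polar /spin eucl_polar// ltW.
Qed.

Lemma leb2_spin (s tau : R) (A : set (R * R)%type) : measurable A ->
  leb2 (spin s tau @^-1` A) = leb2 A.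
Proof.
move=> mA.
have mA' : measurable (spin s tau @^-1` A).
  by rewrite -(setTI (_ @^-1` _)); exact: measurable_spin.
have := integral_indic (@leb2 R) measurableT mA'; rewrite setIT => <-.
have := integral_indic (@leb2 R) measurableT mA; rewrite setIT => <-.
rewrite -(@ge0_integral_spin s tau (fun x => (\1_A x)%:E))//.
exact/measurable_EFinP.
Qed.

Lemma ae_spin (s tau : R) (P : set (R * R)%type) :
  {ae @leb2 R, forall x, P x} -> {ae @leb2 R, forall x, P (spin s tau x)}.
Proof.
move=> [N [mN N0 PN]]; exists (spin s tau @^-1` N); split.
- by rewrite -(setTI (_ @^-1` _)); exact: measurable_spin.
- by rewrite leb2_spin.
- by move=> x /= Px; exact: PN.
Qed.

Lemma ge0_integral_spin_B1 (s tau : R) (f : R * R -> \bar R) :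
  measurable_fun setT f -> (forall x, 0 <= f x)%E ->
  (\int[leb2 (R:=R)]_(x in @B1 R) f (spin s tau x) = \int[leb2 (R:=R)]_(x in @B1 R) f x)%E.
Proof.
move=> mf f0; rewrite integral_mkcond [RHS]integral_mkcond.
rewrite -[RHS](@ge0_integral_spin s tau).
- apply: eq_integral => x _; rewrite !patchE.
  by have -> : (spin s tau x \in @B1 R) = (x \in @B1 R) by
    apply/idP/idP; rewrite !inE B1_spin.
- have := measurable_restrictT f (@measurable_B1 R).
  by move=> [H _]; apply: H; exact: measurable_funTS.
- by move=> x; rewrite patchE; case: ifP.
Qed.

(** In polar coordinates, the measure of the points whose radius lies in a null set [N] is the
    integral of [2 pi r] over [N]. *)
Lemma ae_radial (P : set R) : {ae mu, forall r, P r} ->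
  {ae @leb2 R, forall x, P (eucl x)}.
Proof.
move=> [N [mN N0 PN]].
have mN' : measurable (@eucl R @^-1` N).
  by rewrite -(setTI (_ @^-1` _)); exact: measurable_eucl.
exists (@eucl R @^-1` N); split => //.
- have mi : measurable_fun setT (fun x : R * R => (\1_(@eucl R @^-1` N) x : R)%:E).
    exact/measurable_EFinP.
  have := integral_indic (@leb2 R) measurableT mN'; rewrite setIT => <-.
  rewrite ge0_integral_polar//.
  transitivity (\int[mu]_(r in `]0%R, +oo[%classic)
      (r%:E * (\1_N r)%:E * (2 * pi)%:E))%E.
    apply: eq_integral.
    move=> r; rewrite inE/= in_itv/= andbT => r0; rewrite -muleA; congr (_ * _)%E.
    transitivity (\int[mu]_(a in `]0%R, (2 * pi)%R]%classic) (cst (\1_N r)%:E) a)%E.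
      apply: eq_integral => a _; rewrite /= !indicE; congr ((nat_of_bool _)%:R)%:E.
      by apply/idP/idP; rewrite !inE/= eucl_polar// ltW.
    rewrite integral_cst//=; congr (_ * _)%E.
    by rewrite lebesgue_measure_itv/= lte_fin mulr_gt0 ?pi_gt0// sube0.
  rewrite (@ge0_ae_eq_integral _ _ _ mu _ _ (cst 0%E)) ?integral0//.
  + apply: measurable_funTS; apply: emeasurable_funM => //.
    by apply: emeasurable_funM; apply/measurable_EFinP.
  + move=> r; rewrite /= in_itv/= andbT => r0.
    by rewrite !mule_ge0// ?lee_fin ?mulr_ge0 ?pi_ge0// ltW.
  + exists N; split => // r /=; apply: contra_notP => Nr r0.
    by rewrite indicE memNset// mule0 mul0e.
- by move=> x /= nP; exact: PN.
Qed.

End spin.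

(** * Functions of class C^k on open sets *)

Section differential_calculus.
Variable R : realType.
Implicit Types V : normedModType R.

Lemma near_eq_differentiable V (f g : V -> R) (x : V) :
  (\near x, f x = g x) -> differentiable f x -> differentiable g x.
Proof.
move=> fg df.
have fgx : f x = g x by exact: nbhs_singleton fg.
have [cdf fE] := (diff_locallyP _ _).1 df.
have gE : g \o shift x = cst (g x) + 'd f x +o_ (0 : V) id.
  apply/eqaddoP => e e0.
  have := (eqaddoP _ _ _ _).1 fE e e0.
  have : \forall y \near (0 : V), f (y + x) = g (y + x).
    by move: fg; rewrite (near_shift 0 x) subr0.
  by apply: filterS2 => y fgy; rewrite !fctE/= fgy fgx.
by apply/diff_locallyP; rewrite (diff_unique cdf gE); split.
Qed.

Lemma derive_comp1 V (phi : R -> R) (u : V -> R) (x v : V) :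
  differentiable u x -> differentiable phi (u x) ->
  'D_v (phi \o u) x = 'D_1 phi (u x) * 'D_v u x.
Proof.
move=> du dphi; rewrite !deriveE//; last exact: differentiable_comp.
rewrite diff_comp//= -[in LHS](mulr1 ('d u x v)) -[_ * 1]/(_ *: 1) linearZ/=.
by rewrite mulrC.
Qed.

Lemma derive_comp2 V (phi : R * R -> R) (u w : V -> R) (x v : V) :
  differentiable u x -> differentiable w x -> differentiable phi (u x, w x) ->
  'D_v (fun y => phi (u y, w y)) x =
  'D_(1, 0) phi (u x, w x) * 'D_v u x + 'D_(0, 1) phi (u x, w x) * 'D_v w x.
Proof.
move=> du dw dphi.
have duw : differentiable (fun y => (u y, w y)) x by exact: differentiable_pair.
rewrite !deriveE//; last exact: (differentiable_comp duw dphi).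
rewrite (diff_comp duw dphi)/= diff_pair//=.
have -> : ('d u x v, 'd w x v) = 'd u x v *: ((1, 0) : R * R) + 'd w x v *: ((0, 1) : R * R).
  by apply: injective_projections => /=; rewrite /GRing.scale/= mulr1 mulr0 ?addr0 ?add0r.
by rewrite linearD !linearZ/= /GRing.scale/= mulrC [in X in _ + X]mulrC.
Qed.

Lemma differentiable_comp2 V (phi : R * R -> R) (u w : V -> R) (x : V) :
  differentiable u x -> differentiable w x -> differentiable phi (u x, w x) ->
  differentiable (fun y => phi (u y, w y)) x.
Proof.
move=> du dw dphi.
have duw : differentiable (fun y => (u y, w y)) x by exact: differentiable_pair.
exact: (differentiable_comp duw dphi).
Qed.

(* [Ck k U f]: all iterated directional derivatives of [f] of order at most [k]
   are differentiable at every point of [U]. *)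
Fixpoint Ck V (k : nat) (U : set V) (f : V -> R) : Prop :=
  (forall x, U x -> differentiable f x) /\
  if k is k'.+1 then forall v, Ck k' U (fun x => 'D_v f x) else True.

Lemma Ck_diff V k (U : set V) f : Ck k U f -> forall x, U x -> differentiable f x.
Proof. by case: k => [|k] []. Qed.

Lemma CkW V k (U : set V) f : Ck k.+1 U f -> Ck k U f.
Proof.
elim: k f => [|k IH] f [df H]; first by [].
by split => // v; apply: IH; exact: H.
Qed.

Lemma CkS V k (U : set V) f :
  (forall x, U x -> differentiable f x) -> (forall v, Ck k U (fun x => 'D_v f x)) ->
  Ck k.+1 U f.
Proof. by move=> df Dk; split. Qed.

Lemma Ck_eq V k (U : set V) f g : open U ->
  (forall x, U x -> f x = g x) -> Ck k U f -> Ck k U g.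
Proof.
move=> oU; elim: k f g => [|k IH] f g fg [df Df].
  split => // x Ux; apply: near_eq_differentiable (df x Ux).
  by apply: filterS fg _; exact: open_nbhs_nbhs.
split.
  move=> x Ux; apply: near_eq_differentiable (df x Ux).
  by apply: filterS fg _; exact: open_nbhs_nbhs.
move=> v; apply: IH (Df v) => x Ux; apply: near_eq_derive.
by apply: filterS fg _; exact: open_nbhs_nbhs.
Qed.

Lemma Ck_setU V k (U W : set V) f : Ck k U f -> Ck k W f -> Ck k (U `|` W) f.
Proof.
elim: k f => [|k IH] f [df Df] [df' Df'].
  by split => // x [/df|/df'].
by split => [x [/df|/df']//|v]; apply: IH; [exact: Df|exact: Df'].
Qed.

Lemma Ck_sub V k (U W : set V) f : W `<=` U -> Ck k U f -> Ck k W f.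
Proof.
move=> WU; elim: k f => [|k IH] f [df Df]; split => //; try by move=> x /WU/df.
by move=> v; apply: IH; exact: Df.
Qed.

Lemma Ck_cst V k (U : set V) (c : R) : open U -> Ck k U (fun=> c).
Proof.
move=> oU; elim: k c => [|k IH] c; split => //.
move=> v; apply: (Ck_eq oU _ (IH 0)) => x Ux.
by rewrite (_ : (fun=> c) = cst c)// derive_cst.
Qed.

Lemma Ck_lin V k (U : set V) (f : V -> R) : open U ->
  (forall x, differentiable f x) -> (forall v x y, 'D_v f x = 'D_v f y) -> Ck k U f.
Proof.
move=> oU df Df; case: k => [|k]; split => // v.
by apply: (Ck_eq oU _ (Ck_cst k ('D_v f 0) oU)) => x _.
Qed.

Lemma CkD V k (U : set V) f g : open U -> Ck k U f -> Ck k U g ->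
  Ck k U (fun x => f x + g x).
Proof.
move=> oU; elim: k f g => [|k IH] f g [df Df] [dg Dg]; split => //;
  try by move=> x Ux; apply: differentiableD; [exact: df|exact: dg].
move=> v; apply: (Ck_eq oU _ (IH _ _ (Df v) (Dg v))) => x Ux.
by rewrite -(deriveD (diff_derivable (v := v) (df x Ux)) (diff_derivable (v := v) (dg x Ux))).
Qed.

Lemma CkM V k (U : set V) f g : open U -> Ck k U f -> Ck k U g ->
  Ck k U (fun x => f x * g x).
Proof.
move=> oU; elim: k f g => [|k IH] f g Cf Cg; split => //;
  try by move=> x Ux; apply: differentiableM; [exact: (Ck_diff Cf)|exact: (Ck_diff Cg)].
move=> v; have [[df Df] [dg Dg]] := (Cf, Cg).
have := CkD oU (IH _ _ (CkW Cf) (Dg v)) (IH _ _ (CkW Cg) (Df v)).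
apply: (Ck_eq oU) => x Ux.
by rewrite -(deriveM (diff_derivable (v := v) (df x Ux)) (diff_derivable (v := v) (dg x Ux))).
Qed.

Lemma CkN V k (U : set V) f : open U -> Ck k U f -> Ck k U (fun x => - f x).
Proof.
move=> oU Cf; apply: (Ck_eq oU _ (CkM oU (Ck_cst k (-1) oU) Cf)) => x _.
by rewrite mulN1r.
Qed.

Lemma CkB V k (U : set V) f g : open U -> Ck k U f -> Ck k U g ->
  Ck k U (fun x => f x - g x).
Proof. by move=> oU Cf Cg; apply: CkD => //; exact: CkN. Qed.

Lemma Ck_comp1 V k (U : set V) (W : set R) (phi : R -> R) (u : V -> R) :
  open U -> (forall x, U x -> W (u x)) -> Ck k W phi -> Ck k U u ->
  Ck k U (fun x => phi (u x)).
Proof.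
move=> oU UW; elim: k phi u UW => [|k IH] phi u UW Cp Cu; split => //;
  try by move=> x Ux; apply: (@differentiable_comp _ _ _ _ u phi);
    [exact: (Ck_diff Cu)|apply: (Ck_diff Cp); exact: UW].
move=> v; have [[dp Dp] [du Du]] := (Cp, Cu).
have := CkM oU (IH _ _ UW (Dp 1) (CkW Cu)) (Du v).
apply: (Ck_eq oU) => x Ux.
by rewrite -(derive_comp1 v (du x Ux) (dp _ (UW _ Ux))).
Qed.

Lemma Ck_comp2 V k (U : set V) (W : set (R * R)%type) (phi : R * R -> R) (u w : V -> R) :
  open U -> (forall x, U x -> W (u x, w x)) -> Ck k W phi -> Ck k U u -> Ck k U w ->
  Ck k U (fun x => phi (u x, w x)).
Proof.
move=> oU UW; elim: k phi u w UW => [|k IH] phi u w UW Cp Cu Cw; split => //;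
  try by move=> x Ux; apply: differentiable_comp2;
    [exact: (Ck_diff Cu)|exact: (Ck_diff Cw)|apply: (Ck_diff Cp); exact: UW].
move=> v; have [[dp Dp] [du Du] [dw Dw]] := And3 Cp Cu Cw.
have C1 := CkM oU (IH _ _ _ UW (Dp (1, 0)) (CkW Cu) (CkW Cw)) (Du v).
have C2 := CkM oU (IH _ _ _ UW (Dp (0, 1)) (CkW Cu) (CkW Cw)) (Dw v).
have := CkD oU C1 C2.
apply: (Ck_eq oU) => x Ux.
by rewrite -(derive_comp2 v (du x Ux) (dw x Ux) (dp _ (UW _ Ux))).
Qed.

Lemma differentiable_fst (x : R * R) : differentiable (fun y : R * R => y.1) x.
Proof. by apply: (@linear_differentiable _ _ _ fst x) => z; exact: cvg_fst. Qed.

Lemma differentiable_snd (x : R * R) : differentiable (fun y : R * R => y.2) x.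
Proof. by apply: (@linear_differentiable _ _ _ snd x) => z; exact: cvg_snd. Qed.

Lemma derive_fst (v x : R * R) : 'D_v (fun y : R * R => y.1) x = v.1.
Proof.
rewrite deriveE; last exact: differentiable_fst.
by rewrite (@diff_lin _ _ _ fst x)// => z; exact: cvg_fst.
Qed.

Lemma derive_snd (v x : R * R) : 'D_v (fun y : R * R => y.2) x = v.2.
Proof.
rewrite deriveE; last exact: differentiable_snd.
by rewrite (@diff_lin _ _ _ snd x)// => z; exact: cvg_snd.
Qed.

Lemma Ck_fst k (U : set (R * R)%type) : open U -> Ck k U (fun x => x.1).
Proof.
move=> oU; apply: Ck_lin => //; first exact: differentiable_fst.
by move=> v x y; rewrite !derive_fst.
Qed.

Lemma Ck_snd k (U : set (R * R)%type) : open U -> Ck k U (fun x => x.2).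
Proof.
move=> oU; apply: Ck_lin => //; first exact: differentiable_snd.
by move=> v x y; rewrite !derive_snd.
Qed.

Lemma Ck_smooth (f : R * R -> R) : (forall k, Ck k setT f) -> smooth f.
Proof.
move=> Cf vs x; have := Cf (size vs); clear Cf.
(* [iterD] applies the head of the list last, whereas [Ck] peels off the derivative taken first; the
   induction therefore removes the last direction. *)
elim/last_ind: vs f => [|vs v IH] f; first by move/Ck_diff; exact.
rewrite size_rcons => -[_ /(_ v)/IH].
by have -> : Defs.iterD (rcons vs v) f = Defs.iterD vs (fun y => 'D_v f y) by
  elim: vs {IH} => //= w vs ->.
Qed.

Lemma smooth_Ck (f : R * R -> R) : smooth f -> forall k, Ck k setT f.
Proof.
move=> sf k; elim: k f sf => [|k IH] f sf; split => //.
- by move=> x _; exact: (sf [::]).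
- by move=> x _; exact: (sf [::]).
move=> v; apply: IH => vs x; have := sf (rcons vs v) x.
by have -> : Defs.iterD (rcons vs v) f = Defs.iterD vs (fun y => 'D_v f y) by
  elim: vs => //= w vs ->.
Qed.

End differential_calculus.

(** * Smoothness of elementary functions and of the flat function *)

Section smooth_functions.
Variable R : realType.

(** On the line the derivative in direction [v] is [v] times [f'], so [Ck] in all directions reduces
    to [Ck] of [f']. *)
Lemma Ck_real (k : nat) (U : set R) (f f' : R -> R) : open U ->
  (forall x, U x -> is_derive x 1 f (f' x)) -> Ck k U f' -> Ck k.+1 U f.
Proof.
move=> oU df Cf'.
have dif x : U x -> differentiable f x.
  by move=> /df[/derivable1_diffP].
apply: CkS => // v; apply: (Ck_eq oU _ (CkM oU (Ck_cst k v oU) Cf')) => x Ux.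
rewrite deriveE; last exact: dif.
have [_ <-] := df x Ux; rewrite deriveE; last exact: dif.
by rewrite -[v in RHS]mulr1 -[v * 1]/(v *: 1) linearZ.
Qed.

Lemma Ck_real_diff (U : set R) (f f' : R -> R) :
  (forall x, U x -> is_derive x 1 f (f' x)) -> Ck 0 U f.
Proof. by move=> df; split => // x /df[/derivable1_diffP]. Qed.

Lemma Ck_cos_sin (k : nat) : Ck k setT (@cos R) /\ Ck k setT (@sin R).
Proof.
elim: k => [|k [IHc IHs]].
  split; [apply: (@Ck_real_diff _ _ (fun x => - sin x))|
          apply: (@Ck_real_diff _ _ (@cos R))] => x _.
split.
  apply: (@Ck_real _ _ _ (fun x => - sin x)); first exact: openT.
  by apply: CkN => //; exact: openT.
by apply: (@Ck_real _ _ _ (@cos R)) => //; exact: openT.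
Qed.

Lemma Ck_inv (k : nat) : Ck k [set x : R | x != 0] (fun x => x^-1).
Proof.
have oU : open [set x : R | x != 0] by exact: open_neq.
have dinv (x : R) : x != 0 -> is_derive x 1 (fun x => x^-1) (- (x^-1 * x^-1)).
  move=> x0; have -> : - (x^-1 * x^-1) = - (id x) ^- 2 *: 1 :> R.
    by rewrite /GRing.scale/= mulr1 expr2 invfM.
  exact: (@is_deriveV _ id x 1 1).
elim: k => [|k IH].
  by apply: (@Ck_real_diff _ _ (fun x => - (x^-1 * x^-1))).
apply: (@Ck_real _ _ _ (fun x => - (x^-1 * x^-1))) => //.
by apply: CkN => //; exact: CkM.
Qed.

Lemma Ck_sqrt (k : nat) : Ck k [set x : R | 0 < x] (fun x => Num.sqrt x).
Proof.
have oU : open [set x : R | 0 < x] by exact: open_gt.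
have oV : open [set x : R | x != 0] by exact: open_neq.
elim: k => [|k IH].
  by apply: (@Ck_real_diff _ _ (fun x => (2 * Num.sqrt x)^-1)) => x x0; exact: is_derive1_sqrt.
apply: (@Ck_real _ _ _ (fun x => (2 * Num.sqrt x)^-1)) => //.
apply: (@Ck_comp1 _ _ _ _ [set x : R | x != 0] (fun x => x^-1)) => //.
- by move=> x /= x0; rewrite mulf_neq0// gt_eqF// sqrtr_gt0.
- exact: Ck_inv.
- by apply: CkM => //; exact: Ck_cst.
Qed.

(** Allowing a polynomial in [1 / x] in front of [exp (- 1 / x)] gives a family closed under
    differentiation, on which [Ck_flatp] proceeds by induction. *)
Definition flatp (p : {poly R}) (x : R) : R :=
  if 0 < x then p.[x^-1] * expR (- x^-1) else 0.

(** With [u = 1 / h >= 1], the polynomial is at most [S u^n], and a single term of the exponential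
    series gives [exp (- u) <= (n + 2)! / u^(n + 2)]; the product is of order [u^-2 = h^2].
    Quadratic decay is what makes the derivative at [0] vanish. *)
Lemma flatp_bound (p : {poly R}) : exists2 C, 0 <= C &
  forall h, `|h| <= 1 -> `|flatp p h| <= C * h ^+ 2.
Proof.
pose S := \sum_(i < size p) `|p`_i|.
pose n := size p.
have S0 : 0 <= S by exact: sumr_ge0.
exists (S * (n.+2)`!%:R); first by rewrite mulr_ge0.
move=> h h1; rewrite /flatp; case: ifPn => h0; last first.
  by rewrite normr0 mulr_ge0 ?sqr_ge0// mulr_ge0.
move: h1; rewrite gtr0_norm// => h1.
set u := h^-1; have u0 : 0 < u by rewrite invr_gt0.
have u1 : 1 <= u by rewrite invf_ge1.
have pu : `|p.[u]| <= S * u ^+ n.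
  rewrite horner_coef (le_trans (ler_norm_sum _ _ _))// mulr_suml.
  apply: ler_sum => i _; rewrite normrM normrX (gtr0_norm u0) ler_wpM2l//.
  by rewrite ler_weXn2l// ltnW.
have eu : expR (- u) <= (n.+2)`!%:R / u ^+ n.+2.
  rewrite expRN -[leRHS]invrK lef_pV2 ?posrE ?expR_gt0//; last first.
    by rewrite invr_gt0 divr_gt0 ?exprn_gt0// ltr0n fact_gt0.
  rewrite invf_div (le_trans _ (@expR_ge1Dxn R u n.+1 (ltW u0)))//.
  by rewrite lerDr.
rewrite normrM [`|expR _|]gtr0_norm ?expR_gt0//.
apply: (@le_trans _ _ (S * u ^+ n * ((n.+2)`!%:R / u ^+ n.+2))).
  by rewrite ler_pM// expR_ge0.
rewrite le_eqVlt; apply/orP; left; apply/eqP.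
have -> : h ^+ 2 = u ^- 2 by rewrite /u exprVn invrK.
by rewrite -addn2 exprD; field; rewrite !expf_neq0 ?gt_eqF.
Qed.

Lemma is_derive_flatp (p : {poly R}) (x : R) :
  is_derive x 1 (flatp p) (flatp ('X^2 * (p - p^`())) x).
Proof.
have [x0|x0|x0] := ltgtP x 0.
- rewrite [X in is_derive _ _ _ X]/flatp ltNge (ltW x0)/=.
  apply: (@near_eq_is_derive _ _ _ (cst 0)) => //.
    near=> y; rewrite /flatp ifF//; apply/negbTE; rewrite -leNgt ltW//.
    by near: y; apply: open_nbhs_nbhs; split; [exact: open_lt|exact: x0].
- rewrite [X in is_derive _ _ _ X]/flatp x0.
  have di : is_derive x 1 (fun y : R => y^-1) (- x ^- 2).
    have := @is_deriveV R id x 1 1; rewrite /GRing.scale/= mulr1; apply.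
    by rewrite gt_eqF.
  have dp : is_derive x 1 (fun y : R => p.[y^-1]) (p^`().[x^-1] * - x ^- 2).
    exact: (@is_derive1_comp _ (horner p) (fun y : R => y^-1)).
  have de : is_derive x 1 (fun y : R => expR (- y^-1)) (expR (- x^-1) * - - x ^- 2).
    exact: (@is_derive1_comp _ expR (fun y : R => - y^-1)).
  have dF : is_derive x 1 (fun y : R => p.[y^-1] * expR (- y^-1))
      (('X^2 * (p - p^`())).[x^-1] * expR (- x^-1)).
    apply: (is_derive_eq (is_deriveM dp de)).
    by rewrite /GRing.scale/= hornerM hornerXn hornerD hornerN -exprVn; ring.
  apply: (near_eq_is_derive _ dF); near=> y; rewrite /flatp ifT//.
  by near: y; apply: open_nbhs_nbhs; split; [exact: open_gt|exact: x0].
- rewrite x0 [X in is_derive _ _ _ X]/flatp ltxx.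
  have [C C0 HC] := flatp_bound p.
  have lim0 : h^-1 *: ((flatp p \o shift 0) (h *: (1 : R)) - flatp p 0)
      @[h --> (0 : R)^'] --> (0 : R).
    apply/cvgrPdist_le => /= e e0; near=> h.
    have h1 : `|h| <= 1.
      by near: h; exact: dnbhs0_le.
    have h2 : `|h| <= e / (C + 1).
      by near: h; apply: dnbhs0_le; rewrite divr_gt0// ltr_wpDl.
    have h0 : h != 0 by near: h; exact: nbhs_dnbhs_neq.
    rewrite sub0r normrN {2}/flatp ltxx subr0 /GRing.scale/= mulr1 addr0.
    rewrite normrM normfV ler_pdivrMl ?normr_gt0//.
    apply: (le_trans (HC h h1)).
    have -> : h ^+ 2 = `|h| * `|h| by rewrite -normrM -expr2 ger0_norm// sqr_ge0.
    rewrite mulrCA ler_wpM2l//.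
    apply: (@le_trans _ _ ((C + 1) * `|h|)); first by rewrite ler_wpM2r// lerDl.
    by rewrite mulrC -ler_pdivlMr// ltr_wpDl.
  by apply: DeriveDef; [apply/cvg_ex; exists 0|apply/cvg_lim].
Unshelve. all: by end_near. Qed.

Lemma Ck_flatp (k : nat) (p : {poly R}) : Ck k setT (flatp p).
Proof.
elim: k p => [|k IH] p.
  by apply: (@Ck_real_diff _ _ (flatp ('X^2 * (p - p^`())))) => x _; exact: is_derive_flatp.
apply: (Ck_real openT _ (IH ('X^2 * (p - p^`())))) => x _.
exact: is_derive_flatp.
Qed.

Definition flat : R -> R := flatp 1.

Lemma flatE (x : R) : flat x = if 0 < x then expR (- x^-1) else 0.
Proof. by rewrite /flat /flatp; case: ifP => // _; rewrite hornerC mul1r. Qed.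

Lemma Ck_flat (k : nat) : Ck k setT flat.
Proof. exact: Ck_flatp. Qed.

Lemma flat_le0 (x : R) : x <= 0 -> flat x = 0.
Proof. by move=> x0; rewrite flatE ltNge x0. Qed.

Lemma flat_ge0 (x : R) : 0 <= flat x.
Proof. by rewrite flatE; case: ifP => // _; exact: expR_ge0. Qed.

Lemma flat_le1 (x : R) : flat x <= 1.
Proof.
rewrite flatE; case: ifPn => // x0.
by rewrite -expR0 ler_expR oppr_le0 invr_ge0 ltW.
Qed.

(** The limit is the indicator of the positive half-line, so rescaled copies of [flat] provide
    smooth approximations of indicators, of boxes below and of disks in [cutoff]. *)
Lemma cvg_flat (x : R) : flat (n.+1%:R * x) @[n --> \oo] --> (if 0 < x then 1 else 0 : R).
Proof.
have [x0|x0] := ltP 0 x; last first.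
  rewrite (_ : (fun _ => _) = cst 0); first exact: cvg_cst.
  apply/funext => n; rewrite flat_le0//.
  by rewrite mulr_ge0_le0.
have : expR (- (n.+1%:R * x)^-1) @[n --> \oo] --> expR (- 0 : R).
  apply: (@cvg_comp _ _ _ (fun n : nat => - (n.+1%:R * x)^-1) expR); last first.
    exact: continuous_expR.
  apply: cvgN; rewrite -(mul0r x^-1).
  under eq_fun do rewrite invfM.
  by apply: cvgMl; exact: cvg_harmonic.
rewrite oppr0 expR0; apply: cvg_trans; apply: near_eq_cvg.
by near=> n; rewrite flatE ifT// mulr_gt0// ltr0n.
Unshelve. all: by end_near. Qed.

End smooth_functions.

(** * Smooth functions supported in an annulus *)

Section annular_functions.
Variable R : realType.

Local Notation punctured := [set x : R * R | 0 < eucl x].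

Definition annular (d : R * R -> R) : Prop :=
  (forall k, Ck k setT d) /\ exists a b : R, [/\ 0 < a, b < 1 &
    forall x, (eucl x <= a) || (b <= eucl x) -> d x = 0].

Lemma open_eucl_gt (a : R) : open [set x : R * R | a < eucl x].
Proof.
rewrite (_ : mkset _ = @eucl R @^-1` [set y | a < y])//.
by apply: open_comp; [move=> x _; exact: continuous_eucl|exact: open_gt].
Qed.

Lemma open_eucl_lt (a : R) : open [set x : R * R | eucl x < a].
Proof.
rewrite (_ : mkset _ = @eucl R @^-1` [set y | y < a])//.
by apply: open_comp; [move=> x _; exact: continuous_eucl|exact: open_lt].
Qed.

Lemma Ck_eucl (k : nat) : Ck k punctured (@eucl R).
Proof.
have oP := @open_eucl_gt 0.
apply: (@Ck_comp1 _ _ _ _ [set x : R | 0 < x] (fun x => Num.sqrt x)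
  (fun x : R * R => x.1 ^+ 2 + x.2 ^+ 2)) => //.
- by move=> x /= x0; rewrite -sqr_eucl exprn_gt0.
- exact: Ck_sqrt.
- by apply: CkD => //; apply: CkM => //; first [exact: Ck_fst|exact: Ck_snd].
Qed.

Lemma Ck_invr_eucl (k : nat) : Ck k punctured (fun x => (eucl x)^-1).
Proof.
apply: (@Ck_comp1 _ _ _ _ [set x : R | x != 0] (fun x => x^-1) (@eucl R)).
- exact: open_eucl_gt.
- by move=> x /= x0; rewrite gt_eqF.
- exact: Ck_inv.
- exact: Ck_eucl.
Qed.

Lemma Ck_spin (s tau : R) (k : nat) :
  Ck k punctured (fun x => (spin s tau x).1) /\
  Ck k punctured (fun x => (spin s tau x).2).
Proof.
have oP := @open_eucl_gt 0.
have Ca : Ck k punctured (fun x => s + tau * eucl x).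
  apply: CkD => //; first exact: Ck_cst.
  by apply: CkM => //; [exact: Ck_cst|exact: Ck_eucl].
have Cc : Ck k punctured (fun x => cos (s + tau * eucl x)).
  by apply: (@Ck_comp1 _ _ _ _ setT (@cos R)) => //; exact: (Ck_cos_sin R k).1.
have Cs : Ck k punctured (fun x => sin (s + tau * eucl x)).
  by apply: (@Ck_comp1 _ _ _ _ setT (@sin R)) => //; exact: (Ck_cos_sin R k).2.
split; rewrite /spin/=.
- by apply: CkB => //; apply: CkM => //; first [exact: Ck_fst|exact: Ck_snd].
- by apply: CkD => //; apply: CkM => //; first [exact: Ck_fst|exact: Ck_snd].
Qed.

(** Near the origin the function is locally zero, so smoothness needs checking only where [eucl] and
    the spin maps are smooth. *)
Lemma annular_punctured (d : R * R -> R) (a b : R) : 0 < a -> b < 1 ->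
  (forall x, (eucl x <= a) || (b <= eucl x) -> d x = 0) ->
  (forall k, Ck k punctured d) -> annular d.
Proof.
move=> a0 b1 d0 Cd; split; last by exists a, b.
move=> k.
have -> : setT = punctured `|` [set x : R * R | eucl x < a].
  apply/seteqP; split => // x _.
  by have [ax|xa] := ltP 0 (eucl x); [left|right => /=; exact: le_lt_trans a0].
apply: Ck_setU; first exact: Cd.
apply: (Ck_eq (@open_eucl_lt a) _ (Ck_cst k 0 (@open_eucl_lt a))) => x /= xa.
by rewrite d0// ltW.
Qed.

Lemma annular_mul (g d : R * R -> R) :
  (forall k, Ck k punctured g) -> annular d -> annular (fun x => g x * d x).
Proof.
move=> Cg [Cd [a [b [a0 b1 d0]]]]; apply: (annular_punctured a0 b1).
  by move=> x xab; rewrite d0 ?mulr0.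
move=> k; apply: CkM => //; first exact: open_eucl_gt.
by apply: Ck_sub (Cd k).
Qed.

Lemma annularD (d d' : R * R -> R) :
  annular d -> annular d' -> annular (fun x => d x + d' x).
Proof.
move=> [Cd [a [b [a0 b1 d0]]]] [Cd' [a' [b' [a'0 b'1 d'0]]]]; split.
  by move=> k; apply: CkD => //; exact: openT.
exists (Num.min a a'), (Num.max b b'); split.
- by rewrite lt_min a0.
- by rewrite gt_max b1.
- move=> x; rewrite le_min ge_max => /orP[/andP[xa xa']|/andP[xb xb']].
    by rewrite d0 ?d'0 ?addr0 ?xa ?xa'.
  by rewrite d0 ?d'0 ?addr0 ?xb ?xb' ?orbT.
Qed.

Lemma annularZ (c : R) (d : R * R -> R) : annular d -> annular (fun x => c * d x).
Proof.
by apply: (@annular_mul (fun=> c)) => k; apply: Ck_cst; exact: open_eucl_gt.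
Qed.

Lemma annular0 : annular (fun=> 0).
Proof.
split; first by move=> k; apply: Ck_cst; exact: openT.
by exists 1, 0; split.
Qed.

Lemma annular_spin (s tau : R) (d : R * R -> R) :
  annular d -> annular (d \o spin s tau).
Proof.
move=> [Cd [a [b [a0 b1 d0]]]]; apply: (annular_punctured a0 b1).
  by move=> x xab; rewrite /= d0// eucl_spin.
move=> k; have [C1 C2] := Ck_spin s tau k.
have -> : d \o spin s tau = fun x => d ((spin s tau x).1, (spin s tau x).2).
  by [].
by apply: (@Ck_comp2 _ _ _ _ setT) => //; exact: open_eucl_gt.
Qed.

Lemma annular_diff (d : R * R -> R) : annular d -> forall x, differentiable d x.
Proof. by move=> [/(_ 0%N)/Ck_diff dd _] x; exact: dd. Qed.

Lemma derive_eq0 (d : R * R -> R) (v x : R * R) (U : set (R * R)%type) :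
  open U -> U x -> (forall y, U y -> d y = 0) -> 'D_v d x = 0.
Proof.
move=> oU Ux d0; rewrite (@near_eq_derive _ _ _ d (cst 0)); first exact: derive_cst.
by apply: filterS d0 _; exact: open_nbhs_nbhs.
Qed.

Lemma annular_derive (v : R * R) (d : R * R -> R) :
  annular d -> annular (fun x => 'D_v d x).
Proof.
move=> [Cd [a [b [a0 b1 d0]]]]; split.
  by move=> k; have [_] := Cd k.+1; exact.
(* The derivative is known to vanish on the open sets [eucl x < a] and [b < eucl x]; the new radii
   bring the closed conditions inside them. *)
exists (a / 2), ((b + 1) / 2); split; [by lra|by lra|].
move=> x /orP[xa|xb].
- apply: (derive_eq0 v (@open_eucl_lt a)); first by rewrite /=; lra.
  by move=> y /= ya; rewrite d0// ltW.
- apply: (derive_eq0 v (@open_eucl_gt b)); first by rewrite /=; lra.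
  by move=> y /= ya; rewrite d0// (ltW ya) orbT.
Qed.

Lemma annular_test_fun (d : R * R -> R) : annular d -> test_fun d.
Proof.
move=> [Cd [a [b [a0 b1 d0]]]]; split; first exact: Ck_smooth.
by exists b; split => // x bx; rewrite d0// bx orbT.
Qed.

Lemma annular_continuous (d : R * R -> R) : annular d -> continuous d.
Proof. by move=> ad x; exact/differentiable_continuous/annular_diff. Qed.

Lemma annular_measurable (d : R * R -> R) : annular d -> measurable_fun setT d.
Proof. by move=> ad; apply: continuous_measurable_fun2; exact: annular_continuous. Qed.

Lemma compact_support_bounded (f : R * R -> R) (r : R) : continuous f ->
  (forall x, r <= eucl x -> f x = 0) -> exists2 M, 0 < M & forall x, `|f x| <= M.
Proof.
move=> cf f0; pose Q := (`[- r, r] `*` `[- r, r])%classic : set (R * R)%type.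
have cQ : compact Q by apply: compact_setX; exact: segment_compact.
have [Q0|/set0P Q0] := eqVneq Q set0.
  exists 1 => // x; rewrite f0 ?normr0//.
  have [//|xr] := leP r (eucl x).
  suff : Q x by rewrite Q0.
  have := le_lt_trans (normr1_le_eucl x) xr; have := le_lt_trans (normr2_le_eucl x) xr.
  by rewrite !ltr_norml => /andP[? ?] /andP[? ?]; split; rewrite /= in_itv/=; lra.
have cnf : {within Q, continuous (fun x => `|f x|)}.
  apply: continuous_subspaceT => x.
  by apply: cvg_norm; exact: cf.
have [c _ cmax] := compact_EVT_max Q0 cQ cnf.
exists (`|f c| + 1) => [|x]; first by rewrite ltr_wpDl.
have [xr|xr] := leP r (eucl x); first by rewrite f0// normr0 addr_ge0.
rewrite (le_trans (cmax x _)) ?lerDl//; rewrite inE.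
have := le_lt_trans (normr1_le_eucl x) xr; have := le_lt_trans (normr2_le_eucl x) xr.
by rewrite !ltr_norml => /andP[? ?] /andP[? ?]; split; rewrite /= in_itv/=; lra.
Qed.

Lemma annular_bounded (d : R * R -> R) : annular d ->
  exists2 M, 0 < M & forall x, `|d x| <= M.
Proof.
move=> ad; have [_ [a [b [_ _ d0]]]] := ad.
apply: (@compact_support_bounded _ b); first exact: annular_continuous.
by move=> x bx; rewrite d0// bx orbT.
Qed.

Lemma annular_origin (d : R * R -> R) (x : R * R) : annular d -> eucl x <= 0 -> d x = 0.
Proof.
by move=> [_ [a [b [a0 _ d0]]]] x1; rewrite d0// (le_trans x1 (ltW a0)).
Qed.

End annular_functions.

(** * Density of annular functions in L^2 of the disk *)

Section density_of_annular_functions.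
Variable R : realType.
Local Notation B1 := (@B1 R).

Definition sqnorm (f : R * R -> R) : \bar R :=
  (\int[leb2 (R:=R)]_(x in B1) ((f x) ^+ 2)%:E)%E.

Lemma sqnorm_ge0 (f : R * R -> R) : (0 <= sqnorm f)%E.
Proof. by apply: integral_ge0 => x _; rewrite lee_fin sqr_ge0. Qed.

Lemma measurable_sqr (f : R * R -> R) : measurable_fun setT f ->
  measurable_fun setT (fun x => ((f x) ^+ 2)%:E).
Proof. by move=> mf; apply/measurable_EFinP; exact: measurable_funX. Qed.

Lemma measurable_sqr_B1 (f : R * R -> R) : measurable_fun setT f ->
  measurable_fun B1 (fun x => ((f x) ^+ 2)%:E).
Proof. by move=> mf; apply: measurable_funTS; exact: measurable_sqr. Qed.

Lemma le_sqnorm (f g : R * R -> R) : measurable_fun setT f -> measurable_fun setT g ->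
  (forall x, `|f x| <= `|g x|) -> (sqnorm f <= sqnorm g)%E.
Proof.
move=> mf mg fg; apply: ge0_le_integral.
- exact: measurable_B1.
- by move=> x _; rewrite lee_fin sqr_ge0.
- exact: measurable_sqr_B1.
- exact: measurable_sqr_B1.
- move=> x _; rewrite lee_fin -(real_normK (num_real (f x))).
  by rewrite -(real_normK (num_real (g x))) lerXn2r// nnegrE.
Qed.

Lemma sqnorm_cst_lty (M : R) : (sqnorm (fun=> M) < +oo)%E.
Proof.
rewrite /sqnorm (integral_cst _ (@measurable_B1 R) (M ^+ 2)%:E).
by rewrite lte_mul_pinfty// ?lee_fin ?sqr_ge0// leb2_B1_lty.
Qed.

Lemma sqnormD (f g : R * R -> R) : measurable_fun setT f -> measurable_fun setT g ->
  (sqnorm (fun x => f x + g x)%R <= 2%:E * (sqnorm f + sqnorm g))%E.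
Proof.
move=> mf mg.
have mB := @measurable_B1 R.
have mf2 := measurable_funTS (D := B1) (measurable_sqr mf).
have mg2 := measurable_funTS (D := B1) (measurable_sqr mg).
have f0 x : B1 x -> (0 <= ((f x) ^+ 2)%:E)%E by rewrite lee_fin sqr_ge0.
have g0 x : B1 x -> (0 <= ((g x) ^+ 2)%:E)%E by rewrite lee_fin sqr_ge0.
rewrite /sqnorm -ge0_integralD// -ge0_integralZl//; last 2 first.
- exact: emeasurable_funD.
- by move=> x Bx; rewrite adde_ge0// ?f0 ?g0.
apply: ge0_le_integral => //.
- by move=> x _; rewrite lee_fin sqr_ge0.
- by apply: measurable_sqr_B1; exact: measurable_funD.
- by apply: measurable_funeM; exact: emeasurable_funD.
- move=> x _; rewrite -EFinD -EFinM lee_fin.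
  by have := sqr_ge0 (f x - g x); nra.
Qed.

Lemma sqnormZ (c : R) (f : R * R -> R) : measurable_fun setT f ->
  sqnorm (fun x => c * f x) = ((c ^+ 2)%:E * sqnorm f)%E.
Proof.
move=> mf; rewrite /sqnorm -ge0_integralZl.
- by apply: eq_integral => x _; rewrite -EFinM exprMn.
- exact: measurable_B1.
- exact: measurable_sqr_B1.
- by move=> x _; rewrite lee_fin sqr_ge0.
- by rewrite lee_fin sqr_ge0.
Qed.

Lemma sqnorm_spin (s tau : R) (f : R * R -> R) : measurable_fun setT f ->
  sqnorm (f \o spin s tau) = sqnorm f.
Proof.
move=> mf; rewrite /sqnorm.
rewrite -[RHS](@ge0_integral_spin_B1 _ s tau)//; first exact: measurable_sqr.
by move=> x; rewrite lee_fin sqr_ge0.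
Qed.

Lemma ae_eq_sqnorm (f g : R * R -> R) : measurable_fun setT f -> measurable_fun setT g ->
  {ae @leb2 R, forall x, f x = g x} -> sqnorm f = sqnorm g.
Proof.
move=> mf mg [N [mN N0 fgN]]; apply: ge0_ae_eq_integral.
- exact: measurable_B1.
- exact: measurable_sqr_B1.
- exact: measurable_sqr_B1.
- by move=> x _; rewrite lee_fin sqr_ge0.
- by move=> x _; rewrite lee_fin sqr_ge0.
- exists N; split => // x /=; apply: contra_notP => Nx _.
  by congr ((_ ^+ 2)%:E); apply: contrapT => fg; exact/Nx/fgN.
Qed.

Definition approximable (f : R * R -> R) : Prop := measurable_fun setT f /\
  forall e : R, 0 < e -> exists2 d, annular d & (sqnorm (fun x => f x - d x)%R <= e%:E)%E.

Lemma annular_approximable (d : R * R -> R) : annular d -> approximable d.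
Proof.
move=> ad; split; first exact: annular_measurable.
move=> e e0; exists d => //.
rewrite /sqnorm integral0_eq ?lee_fin ?ltW// => x _.
by rewrite subrr expr0n.
Qed.

Lemma approximableD (f g : R * R -> R) : approximable f -> approximable g ->
  approximable (fun x => f x + g x).
Proof.
move=> [mf af] [mg ag]; split; first exact: measurable_funD.
move=> e e0; have e4 : 0 < e / 4 by rewrite divr_gt0.
have [d ad fd] := af _ e4; have [d' ad' gd] := ag _ e4.
exists (fun x => d x + d' x); first exact: annularD.
have md := annular_measurable ad; have md' := annular_measurable ad'.
have -> : (fun x => f x + g x - (d x + d' x)) =
    (fun x => (f x - d x) + (g x - d' x)).
  by apply/funext => x; ring.
apply: (le_trans (sqnormD _ _)); [exact: measurable_funB..|].
apply: (@le_trans _ _ (2%:E * ((e / 4)%:E + (e / 4)%:E))%E).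
  by rewrite lee_wpmul2l ?lee_fin// leeD.
by rewrite -EFinD -EFinM lee_fin; lra.
Qed.

Lemma approximableZ (c : R) (f : R * R -> R) : approximable f ->
  approximable (fun x => c * f x).
Proof.
move=> [mf af]; split; first exact: measurable_funM.
move=> e e0; have c0 : 0 < c ^+ 2 + 1 by rewrite ltr_wpDl ?sqr_ge0.
have [d ad fd] := af (e / (c ^+ 2 + 1)) (divr_gt0 e0 c0).
exists (fun x => c * d x); first exact: annularZ.
have md := annular_measurable ad.
under eq_fun do rewrite -mulrBr.
rewrite sqnormZ; last exact: measurable_funB.
apply: (@le_trans _ _ ((c ^+ 2)%:E * (e / (c ^+ 2 + 1))%:E)%E).
  by rewrite lee_wpmul2l// lee_fin sqr_ge0.
rewrite -EFinM lee_fin mulrCA ger_pMr// ler_pdivrMr// mul1r lerDl//.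
Qed.

Lemma approximable_sum (I : Type) (s : seq I) (F : I -> R * R -> R) :
  (forall i, approximable (F i)) -> approximable (fun x => \sum_(i <- s) F i x).
Proof.
move=> aF; elim: s => [|i s IH].
  under eq_fun do rewrite big_nil.
  exact/annular_approximable/annular0.
under eq_fun do rewrite big_cons.
exact: approximableD.
Qed.

(** Dominated convergence: [(f - g n)^2] is almost everywhere at most [(2 C)^2] on a set of finite
    measure. Convergence is asked only off the origin, a null set at which all annular functions
    vanish. *)
Lemma approximable_cvg (g : nat -> R * R -> R) (f : R * R -> R) (C : R) :
  (forall n, approximable (g n)) -> (forall n x, `|g n x| <= C) ->
  (forall x, 0 < eucl x < 1 -> g n x @[n --> \oo] --> f x) ->
  measurable_fun setT f -> approximable f.
Proof.
move=> ag gC gf mf; split => // e e0.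
have C0 : 0 <= C by apply: le_trans (gC 0%N (0, 0)).
have fC x : 0 < eucl x < 1 -> `|f x| <= C.
  move=> /gf cvgx.
  by apply: (cvgr_to_le (cvg_norm cvgx)); apply: nearW => n; exact: gC.
have mg n : measurable_fun setT (g n) by case: (ag n).
have ae0 : {ae @leb2 R, forall x, eucl x != 0}.
  apply: (@ae_radial _ (fun r => r != 0)).
  exists [set 0]; split => //; first exact: lebesgue_measure_set1.
  by move=> r /= /negP; rewrite negbK => /eqP.
have [N [mN N0 hN]] := ae0.
have hN' x : ~ N x -> B1 x -> 0 < eucl x < 1.
  move=> Nx; rewrite B1E => ->; rewrite andbT lt_neqAle eucl_ge0 andbT eq_sym.
  by apply/eqP => x0; apply: Nx; apply: hN => /=; rewrite x0 eqxx.
pose h n x := ((f x - g n x) ^+ 2)%:E.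
have mh n : measurable_fun B1 (h n).
  by apply: measurable_sqr_B1; exact: measurable_funB.
have [||||_ _ cvg0] := @dominated_convergence _ _ _ (@leb2 R) B1 (@measurable_B1 R) h
    (cst 0%E) (cst ((2 * C) ^+ 2)%:E) mh.
- exact: measurable_cst.
- exists N; split => // x /=; apply: contra_notP => Nx Bx.
  have cvgx := gf x (hN' x Nx Bx).
  apply: cvg_EFin; first exact: nearW.
  have -> : 0 = (f x - f x) ^+ 2 :> R by rewrite subrr expr0n.
  by apply: cvgM; apply: cvgB => //; exact: cvg_cst.
- apply: measurable_bounded_integrable => //.
  + exact: measurable_B1.
  + exact: leb2_B1_lty.
  + exact: bounded_cst.
- exists N; split => // x /=; apply: contra_notP => Nx n Bx.
  rewrite /h/= lee_fin ger0_norm ?sqr_ge0//.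
  rewrite -(real_normK (num_real (f x - g n x))) lerXn2r ?nnegrE ?mulr_ge0//.
  rewrite (le_trans (ler_normB _ _))// mulr_natl mulr2n lerD//.
  exact: fC (hN' x Nx Bx).
have e40 : 0 < e / 4 by rewrite divr_gt0.
move: cvg0; rewrite integral0 => /fine_cvgP[finh /cvgr_lt/(_ _ e40) smallh].
near \oo => n.
have fgn : (sqnorm (fun x => f x - g n x)%R <= (e / 4)%:E)%E.
  have fin : (\int[leb2 (R:=R)]_(x in B1) h n x)%E \is a fin_num by near: n.
  rewrite /sqnorm -/(h n) -[leLHS](fineK fin) lee_fin ltW//.
  by near: n.
have [d ad gd] := (ag n).2 _ e40.
exists d => //; have md := annular_measurable ad.
have -> : (fun x => f x - d x) = (fun x => (f x - g n x) + (g n x - d x)).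
  by apply/funext => x; ring.
apply: (le_trans (sqnormD _ _)); [exact: measurable_funB..|].
apply: (@le_trans _ _ (2%:E * ((e / 4)%:E + (e / 4)%:E))%E).
  by rewrite lee_wpmul2l ?lee_fin// leeD.
by rewrite -EFinD -EFinM lee_fin; lra.
Unshelve. all: by end_near. Qed.

(** A pi-system generating the measurable sets of the plane, for the Dynkin argument in
    [approximable_indic]. *)
Definition boxes : set (set (R * R)%type) :=
  [set A | exists a b c d : R, A = (`]a, b[ `*` `]c, d[)%classic].

Lemma measurable_boxes : @measurable _ (R * R)%type = <<s boxes >>.
Proof.
apply/seteqP; split; last first.
  apply: smallest_sub; first exact: sigma_algebra_measurable.
  by move=> _ [a [b [c [d ->]]]]; apply: measurableX; exact: measurable_itv.
pose T := g_sigma_algebraType boxes.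
have cov (x : R) : exists n : nat, - n%:R < x < n%:R.
  exists (Num.truncn `|x|).+1; rewrite -ltr_norml; exact: truncnS_gt.
have m1 : measurable_fun setT (fun z : T => (z : R * R).1).
  apply: (measurability _ (RGenOpens.measurableE R)).
  move=> _ [_ [a [b ->] <-]]; rewrite setTI.
  rewrite (_ : _ @^-1` _ = \bigcup_n (`]a, b[ `*` `](- n%:R), n%:R[)%classic).
    by apply: bigcupT_measurable => n; apply: sub_sigma_algebra; do 4 eexists.
  apply/seteqP; split => [[x y] /= xab|[x y] [n _ []]//].
  by have [n hn] := cov y; exists n => //; split => //=; rewrite in_itv.
have m2 : measurable_fun setT (fun z : T => (z : R * R).2).
  apply: (measurability _ (RGenOpens.measurableE R)).
  move=> _ [_ [a [b ->] <-]]; rewrite setTI.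
  rewrite (_ : _ @^-1` _ = \bigcup_n (`](- n%:R), n%:R[ `*` `]a, b[)%classic).
    by apply: bigcupT_measurable => n; apply: sub_sigma_algebra; do 4 eexists.
  apply/seteqP; split => [[x y] /= xab|[x y] [n _ []]//].
  by have [n hn] := cov x; exists n => //; split => //=; rewrite in_itv.
have mid : measurable_fun setT (fun z : T => ((z : R * R).1, (z : R * R).2)).
  exact: measurable_fun_pair.
move=> A mA; have := mid measurableT A mA; rewrite setTI.
by congr (<<s boxes >> _); apply/seteqP; split => -[].
Qed.

Lemma boxes_setI : setI_closed boxes.
Proof.
move=> _ _ [a [b [c [d ->]]]] [a' [b' [c' [d' ->]]]].
exists (Num.max a a'), (Num.min b b'), (Num.max c c'), (Num.min d d').
apply/seteqP; split => -[x y] /=; rewrite !in_itv/= !gt_max !lt_min.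
  by move=> [[/andP[-> ->] /andP[-> ->]] [/andP[-> ->] /andP[-> ->]]].
by move=> [/andP[/andP[-> ->] /andP[-> ->]] /andP[/andP[-> ->] /andP[-> ->]]].
Qed.

Definition step (x : R) : R := if 0 < x then 1 else 0.

Lemma normr_step (x : R) : `|step x| <= 1.
Proof. by rewrite /step; case: ifP => _; rewrite ?normr1 ?normr0. Qed.

Lemma normr_flat (x : R) : `|flat x| <= 1.
Proof. by rewrite ger0_norm ?flat_ge0// flat_le1. Qed.

Lemma normrM_le1 (x y : R) : `|x| <= 1 -> `|y| <= 1 -> `|x * y| <= 1.
Proof. by move=> x1 y1; rewrite normrM mulr_ile1. Qed.

(** With [h = step] this is the indicator of the box cut down to the annulus where [|x|^2] lies
    strictly between [1 / (m + 1)] and [1 - 1 / (m + 1)]; with [h] a rescaled [flat] it is an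
    annular function. Using [|x|^2] keeps it smooth at the origin. *)
Definition box_profile (h : R -> R) (a b c d : R) (m : nat) (x : R * R) : R :=
  h (eucl x ^+ 2 - m.+1%:R^-1) * h (1 - m.+1%:R^-1 - eucl x ^+ 2) *
  (h (x.1 - a) * h (b - x.1) * (h (x.2 - c) * h (d - x.2))).

Lemma annular_box_profile (a b c d : R) (m n : nat) :
  annular (box_profile (fun t => flat (n.+1%:R * t)) a b c d m).
Proof.
have m0 : 0 < m.+1%:R^-1 :> R by rewrite invr_gt0.
have m1 : m.+1%:R^-1 <= 1 :> R by rewrite invf_le1// ler1n.
split.
  move=> k; have oT : open [set: R * R] by exact: openT.
  have Cs : Ck k [set: R * R] (fun x => eucl x ^+ 2).
    apply: (@Ck_eq _ _ _ _ (fun x : R * R => x.1 * x.1 + x.2 * x.2)) => //.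
      by move=> x _; rewrite sqr_eucl !expr2.
    by apply: CkD => //; apply: CkM => //; first [exact: Ck_fst|exact: Ck_snd].
  have Cf (u : R * R -> R) : Ck k [set: R * R] u ->
      Ck k [set: R * R] (fun x => flat (n.+1%:R * u x)).
    move=> Cu; apply: (@Ck_comp1 _ _ _ _ setT (@flat R)) => //; first exact: Ck_flat.
    by apply: CkM => //; exact: Ck_cst.
  rewrite /box_profile.
  apply: (CkM oT (CkM oT _ _) (CkM oT (CkM oT _ _) (CkM oT _ _))); apply: Cf;
    (apply: CkB => //); try by first [exact: Ck_cst|exact: Ck_fst|exact: Ck_snd].
exists (Num.sqrt m.+1%:R^-1), (Num.sqrt (1 - m.+1%:R^-1)); split.
- by rewrite sqrtr_gt0.
- by rewrite -[ltRHS]sqrtr1 ltr_sqrt// ltrBlDr ltrDl.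
move=> x /orP[xa|xb]; rewrite /box_profile.
- rewrite [X in X * _ * _]flat_le0 ?mul0r// pmulr_rle0// subr_le0.
  by rewrite -[leRHS]sqr_sqrtr ?(ltW m0)// lerXn2r// nnegrE ?eucl_ge0.
- rewrite [X in _ * X * _]flat_le0 ?mulr0 ?mul0r// pmulr_rle0// subr_le0.
  rewrite -[leLHS]sqr_sqrtr ?subr_ge0// lerXn2r// nnegrE ?eucl_ge0//.
Qed.

(** Two successive limits: the sharpening of [flat] to [step] at fixed [m], then the exhaustion of
    the punctured disk as [m] grows. *)
Lemma approximable_box (a b c d : R) :
  approximable (\1_(`]a, b[ `*` `]c, d[)%classic : R * R -> R).
Proof.
have mbox : measurable (`]a, b[ `*` `]c, d[ : set (R * R)%type)%classic.
  by apply: measurableX; exact: measurable_itv.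
have meu2 : measurable_fun setT (fun x : R * R => eucl x ^+ 2).
  by apply: measurable_funX; exact: measurable_eucl.
have mstep (u : R * R -> R) : measurable_fun setT u ->
    measurable_fun setT (fun x => step (u x)).
  move=> mu; apply: measurable_fun_ifT => //.
  exact: measurable_fun_ltr.
apply: (@approximable_cvg (box_profile step a b c d) _ 1).
- move=> m; apply: (@approximable_cvg
    (fun n => box_profile (fun t => flat (n.+1%:R * t)) a b c d m) _ 1).
  + by move=> n; exact/annular_approximable/annular_box_profile.
  + by move=> n x; rewrite /box_profile; do ?[apply: normrM_le1]; exact: normr_flat.
  + by move=> x _; rewrite /box_profile; do ?[apply: cvgM]; exact: cvg_flat.
  + rewrite /box_profile; do ?[apply: measurable_funM]; apply: mstep;
    by apply: measurable_funB.
- by move=> n x; rewrite /box_profile; do ?[apply: normrM_le1]; exact: normr_step.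
- move=> x /andP[x0 x1].
  have x20 : 0 < eucl x ^+ 2 by rewrite exprn_gt0.
  have x21 : 0 < 1 - eucl x ^+ 2.
    by rewrite subr_gt0 expr_lt1// ltW.
  have : \forall m \near \oo, box_profile step a b c d m x = \1_(`]a, b[ `*` `]c, d[)%classic x.
    near=> m.
    have m1 : m.+1%:R^-1 < eucl x ^+ 2.
      by near: m; exact: (near_infty_natSinv_lt (PosNum x20)).
    have m2 : m.+1%:R^-1 < 1 - eucl x ^+ 2.
      by near: m; exact: (near_infty_natSinv_lt (PosNum x21)).
    rewrite /box_profile /step !subr_gt0 m1 ltrBrDr addrC -ltrBrDr m2 !mul1r indicE.
    have -> : (x \in (`]a, b[ `*` `]c, d[)%classic) =
        (a < x.1) && (x.1 < b) && ((x.2 < d) && (c < x.2)).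
      apply/idP/idP; first by rewrite inE/= !in_itv/= => -[-> /andP[-> ->]].
      by move=> /andP[ab /andP[xd xc]]; rewrite inE/= !in_itv/= ab xd xc.
    by do 2 case: ltP => _ //=; rewrite ?mul0r ?mulr0 ?mul1r ?mulr1//;
      do 2 case: ltP => _ //=; rewrite ?mul0r ?mulr0 ?mul1r ?mulr1.
  exact: cvg_near_cst.
- exact: measurable_indic.
Unshelve. all: by end_near. Qed.

Lemma approximable_indic (A : set (R * R)%type) : measurable A ->
  approximable (\1_A : R * R -> R).
Proof.
rewrite measurable_boxes => mA.
have aT : approximable (fun=> 1).
  (* The box contains the unit disk, so its indicator, as a constant sequence, converges to [1] at
     every point that counts. *)
  apply: (@approximable_cvg (fun=> \1_(`](-2), 2[ `*` `](-2), 2[)%classic) _ 1).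
  - by move=> n; exact: approximable_box.
  - by move=> n x; rewrite indicE; case: (x \in _); rewrite ?normr1 ?normr0.
  - move=> x /andP[_ x1]; rewrite indicE mem_set; first exact: cvg_cst.
    have := le_lt_trans (normr1_le_eucl x) x1; have := le_lt_trans (normr2_le_eucl x) x1.
    by rewrite !ltr_norml => /andP[? ?] /andP[? ?]; split; rewrite /= in_itv/=; lra.
  - exact: measurable_cst.
apply: (@dynkin_induction _ (R * R)%type boxes (fun A => approximable (\1_A : R * R -> R))
  measurable_boxes boxes_setI) mA.
- have -> // : \1_[set: R * R] = (fun=> 1) :> (R * R -> R).
  by apply/funext => x; rewrite indicE in_setT.
- by move=> _ [a [b [c [d ->]]]]; exact: approximable_box.
- move=> S mS aS.
  have -> : \1_(~` S) = (fun x => 1 + -1 * \1_S x) :> (R * R -> R).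
    apply/funext => x; rewrite !indicE in_setC.
    by case: (x \in S); rewrite ?mulr1 ?mulr0 ?subrr ?addr0.
  by apply: approximableD => //; exact: approximableZ.
- move=> F mF tF aF.
  (* By disjointness the partial sums are again indicators, which supplies the uniform bound [1] for
     [approximable_cvg]. *)
  have gE n x : \sum_(k < n) \1_(F k) x = \1_(\bigcup_(k < n) F k) x :> R.
    rewrite [RHS]indicE; case: (boolP (x \in _)) => [|xF].
      rewrite inE => -[k /= kn Fkx].
      rewrite (bigD1 (Ordinal kn))//= indicE mem_set// big1 ?addr0// => i ik.
      rewrite indicE memNset// => Fix; move/eqP: ik; apply; apply/val_inj => /=.
      by apply: tF => //; exists x.
    rewrite big1// => i _; rewrite indicE memNset// => Fix; move/negP: xF; apply.
    by rewrite inE; exists i => //=.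
  apply: (@approximable_cvg (fun n x => \sum_(k < n) \1_(F k) x) _ 1).
  - by move=> n; apply: approximable_sum.
  - by move=> n x; rewrite gE indicE; case: (x \in _); rewrite ?normr1 ?normr0.
  - move=> x _; under eq_fun do rewrite gE.
    have [|xF] := boolP (x \in \bigcup_k F k).
      rewrite inE => -[k _ Fkx]; apply: cvg_near_cst; near=> n.
      rewrite !indicE !mem_set//; first by exists k.
      by exists k => //=; near: n; exact: nbhs_infty_gt.
    apply: cvg_near_cst; near=> n.
    rewrite !indicE (negbTE xF) memNset// => -[k _ Fkx].
    by move/negP: xF; apply; rewrite inE; exists k.
  - by apply: measurable_indic; exact: bigcupT_measurable.
Unshelve. all: by end_near. Qed.

Import HBNNSimple.

Lemma approximable_bounded_ge0 (f : R * R -> R) (C : R) : measurable_fun setT f ->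
  (forall x, 0 <= f x <= C) -> approximable f.
Proof.
move=> mf fC.
have mEf : measurable_fun setT (EFin \o f) by exact/measurable_EFinP.
have f0 x : [set: R * R] x -> (0 <= (EFin \o f) x)%E.
  by move=> _; rewrite lee_fin; case/andP: (fC x).
pose g := nnsfun_approx measurableT mEf.
have cvg_g x : g n x @[n --> \oo] --> f x.
  have := cvg_nnsfun_approx measurableT mEf f0 (I : [set: R * R] x).
  by move=> /fine_cvgP[].
apply: (@approximable_cvg (fun n => g n) _ C).
- move=> n.
  have -> : (g n : R * R -> R) = fun x => \sum_(y <- finmap.enum_fset (fset_set (range (g n))))
      y * \1_(g n @^-1` [set y]) x.
    by apply/funext => x; rewrite [LHS]fimfunE fsbig_finite//; exact: fimfunP.
  apply: approximable_sum => y; apply: approximableZ; apply: approximable_indic.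
  exact: measurable_sfunP.
- move=> n x; rewrite ger0_norm//.
  have nd : nondecreasing_seq (fun n => g n x).
    by move=> i j ij; exact/lefP/nd_nnsfun_approx.
  have := nondecreasing_cvgn_le nd (cvgP _ (cvg_g x)) n.
  by rewrite (cvg_lim _ (cvg_g x))// => /le_trans; apply; case/andP: (fC x).
- by move=> x _; exact: cvg_g.
- by [].
Qed.

Lemma approximable_ae_bounded (f : R * R -> R) (M : R) : measurable_fun setT f ->
  {ae @leb2 R, forall x, `|f x| <= M} -> approximable f.
Proof.
move=> mf fM.
wlog M0 : M fM / 0 <= M.
  move=> H; apply: (H `|M|) => //; case: fM => N [mN N0 hN].
  exists N; split => // x /= fx; apply: hN => /= fM; apply: fx.
  exact: le_trans (ler_norm M).
pose f' x := if `|f x| <= M then f x else 0.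
have mf' : measurable_fun setT f'.
  apply: measurable_fun_ifT => //; apply: measurable_fun_ler => //.
  exact: measurableT_comp.
have af' : approximable f'.
  (* Adding [M] makes the truncation nonnegative and at most [M + M], so the nonnegative case
     applies to both terms. *)
  have -> : f' = fun x => (f' x + M) + -1 * ((fun=> M) x).
    by apply/funext => x; rewrite /=; ring.
  have f'M x : `|f' x| <= M by rewrite /f'; case: ifP => //; rewrite normr0.
  apply: approximableD; last apply: approximableZ.
    apply: (@approximable_bounded_ge0 _ (M + M)); first exact: measurable_funD.
    by move=> x; have := f'M x; rewrite ler_norml; lra.
  apply: (@approximable_bounded_ge0 _ M); first exact: measurable_cst.
  by move=> x; rewrite M0 lexx.
split => // e e0; have [d ad fd] := af'.2 e e0; exists d => //.
have md := annular_measurable ad.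
rewrite (@ae_eq_sqnorm _ (fun x => f' x - d x)) //; [exact: measurable_funB..|].
case: fM => N [mN N0 hN]; exists N; split => // x /= H; apply: hN => /= fx.
by apply: H; rewrite /f' fx.
Qed.


End density_of_annular_functions.

(** * The inner product and norm of L^2 of the disk *)

Section square_integrable.
Variable R : realType.
Local Notation B1 := (@B1 R).
Local Notation leb2 := (@leb2 R).
Implicit Types u v w : R * R -> R.

Definition L2 u : Prop := measurable_fun setT u /\ (sqnorm u < +oo)%E.

Definition ip u v : R := \int[leb2]_(x in B1) (u x * v x).

Definition nrm u : R := Num.sqrt (fine (sqnorm u)).

Lemma L2_fin u : L2 u -> sqnorm u \is a fin_num.
Proof. by move=> [_ ?]; rewrite ge0_fin_numE// sqnorm_ge0. Qed.

Lemma nrm_ge0 u : 0 <= nrm u.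
Proof. exact: sqrtr_ge0. Qed.

Lemma sqr_nrm u : nrm u ^+ 2 = fine (sqnorm u).
Proof. by rewrite sqr_sqrtr// fine_ge0// sqnorm_ge0. Qed.

Lemma nrm_le u (c : R) : 0 <= c -> (sqnorm u <= (c ^+ 2)%:E)%E -> nrm u <= c.
Proof.
move=> c0 uc; rewrite -(ler_pXn2r (n := 2))// ?nnegrE ?nrm_ge0// sqr_nrm.
rewrite -lee_fin fineK// ge0_fin_numE ?sqnorm_ge0//.
exact: le_lt_trans uc (ltry _).
Qed.

Lemma L2_bounded u (M : R) : measurable_fun setT u ->
  {ae leb2, forall x, `|u x| <= M} -> L2 u.
Proof.
move=> mu uM; split => //.
pose u' x := if `|u x| <= M then u x else 0.
have mu' : measurable_fun setT u'.
  apply: measurable_fun_ifT => //; apply: measurable_fun_ler => //.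
  exact: measurableT_comp.
rewrite (@ae_eq_sqnorm _ u u')//; last first.
  case: uM => N [mN N0 hN]; exists N; split => // x /= H; apply: hN => /= fx.
  by apply: H; rewrite /u' fx.
apply: le_lt_trans (sqnorm_cst_lty M); apply: le_sqnorm => // x.
rewrite /u'; case: ifPn => [|_]; last by rewrite normr0.
by move=> /le_trans; apply; exact: ler_norm.
Qed.

Lemma L2_annular u : annular u -> L2 u.
Proof.
move=> au; have [M _ uM] := annular_bounded au.
by apply: (@L2_bounded _ M); [exact: annular_measurable|exact: aeW].
Qed.

Lemma L2D u v : L2 u -> L2 v -> L2 (fun x => u x + v x).
Proof.
move=> [mu u2] [mv v2]; split; first exact: measurable_funD.
apply: le_lt_trans (sqnormD mu mv) _.
by rewrite lte_mul_pinfty// lte_add_pinfty.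
Qed.

Lemma L2Z (c : R) u : L2 u -> L2 (fun x => c * u x).
Proof.
move=> [mu u2]; split; first exact: measurable_funM.
by rewrite sqnormZ// lte_mul_pinfty// lee_fin sqr_ge0.
Qed.

Lemma L2B u v : L2 u -> L2 v -> L2 (fun x => u x - v x).
Proof.
move=> Lu Lv; have := L2D Lu (L2Z (-1) Lv).
by under eq_fun do rewrite mulN1r.
Qed.

Lemma L2_spin (s tau : R) u : L2 u -> L2 (u \o spin s tau).
Proof.
move=> [mu u2]; split; first exact: measurableT_comp mu (measurable_spin s tau).
by rewrite sqnorm_spin.
Qed.

Lemma nrm_spin (s tau : R) u : L2 u -> nrm (u \o spin s tau) = nrm u.
Proof. by move=> [mu _]; rewrite /nrm sqnorm_spin. Qed.

Lemma integrable_sqr u : L2 u -> leb2.-integrable B1 (fun x => ((u x) ^+ 2)%:E).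
Proof.
move=> [mu u2]; apply/integrableP; split; first exact: measurable_sqr_B1.
apply: le_lt_trans u2; rewrite /sqnorm le_eqVlt; apply/orP; left; apply/eqP.
by apply: eq_integral => x _; rewrite gee0_abs// lee_fin sqr_ge0.
Qed.

Lemma integrable_mul u v : L2 u -> L2 v ->
  leb2.-integrable B1 (EFin \o (fun x => u x * v x)).
Proof.
move=> Lu Lv; have [mu _] := Lu; have [mv _] := Lv.
apply: (le_integrable (@measurable_B1 R) _ _
  (integrableD (@measurable_B1 R) (integrable_sqr Lu) (integrable_sqr Lv))).
  by apply/measurable_EFinP; apply: measurable_funTS; exact: measurable_funM.
move=> x _ /=; rewrite lee_fin normrM [leRHS]ger0_norm ?addr_ge0 ?sqr_ge0//.
rewrite -(real_normK (num_real (u x))) -(real_normK (num_real (v x))).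
by have := normr_ge0 (u x); have := normr_ge0 (v x); nra.
Qed.

Lemma ipC u v : ip u v = ip v u.
Proof. by apply: eq_Rintegral => x _; rewrite mulrC. Qed.

Lemma ipDr u v w : L2 u -> L2 v -> L2 w ->
  ip u (fun x => v x + w x) = ip u v + ip u w.
Proof.
move=> Lu Lv Lw; rewrite /ip -RintegralD.
- by apply: eq_Rintegral => x _; rewrite mulrDr.
- exact: measurable_B1.
- exact: integrable_mul.
- exact: integrable_mul.
Qed.

Lemma ipZr (c : R) u v : L2 u -> L2 v -> ip u (fun x => c * v x) = c * ip u v.
Proof.
move=> Lu Lv; rewrite /ip -RintegralZl.
- by apply: eq_Rintegral => x _; rewrite mulrCA.
- exact: measurable_B1.
- exact: integrable_mul.
Qed.

Lemma ipBr u v w : L2 u -> L2 v -> L2 w ->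
  ip u (fun x => v x - w x) = ip u v - ip u w.
Proof.
move=> Lu Lv Lw; rewrite -mulN1r -(ipZr _ Lu Lw) -ipDr//; last exact: L2Z.
by congr ip; apply/funext => x; rewrite mulN1r.
Qed.

Lemma ipDl u v w : L2 u -> L2 v -> L2 w ->
  ip (fun x => v x + w x) u = ip v u + ip w u.
Proof. by move=> Lu Lv Lw; rewrite ipC ipDr// !(ipC u). Qed.

Lemma ip_sqr u : ip u u = nrm u ^+ 2.
Proof.
by rewrite sqr_nrm /ip /Rintegral /sqnorm; congr fine.
Qed.

Lemma ip_le u v : L2 u -> L2 v -> `|ip u v| <= nrm u * nrm v.
Proof.
move=> Lu Lv.
have H t : 0 <= nrm u ^+ 2 + 2 * t * ip u v + t ^+ 2 * nrm v ^+ 2.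
  have Ltv := L2Z t Lv.
  have : 0 <= ip (fun x => u x + t * v x) (fun x => u x + t * v x).
    by rewrite ip_sqr sqr_ge0.
  have Luv := L2D Lu Ltv.
  rewrite ipDr// !ipDl// ipZr// ipZr// (ipC (fun x => t * v x)) ipZr//.
  rewrite (ipC (fun x => t * v x)) ipZr// !ip_sqr; lra.
have u0 := nrm_ge0 u; have v0 := nrm_ge0 v.
rewrite -(ler_pXn2r (n := 2))// ?nnegrE ?mulr_ge0// real_normK ?num_real// exprMn.
set A := nrm u ^+ 2 in H *; set B := nrm v ^+ 2 in H *; set C := ip u v in H *.
(* If [nrm v] vanishes, the quadratic [H] is affine in [t], and choosing [2 t C = - (A + 1)] makes
   it negative unless [C = 0]. Otherwise it is evaluated at its minimiser [- C / B]. *)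
have [B0|B0] := eqVneq B 0.
  suff -> : C = 0 by rewrite B0 expr0n mulr0.
  apply/eqP; apply: contraT => C0.
  have := H (- (A + 1) / (2 * C)).
  have -> : 2 * (- (A + 1) / (2 * C)) * C = - (A + 1) by field.
  by rewrite B0 mulr0; lra.
have {}B0 : 0 < B by rewrite lt_neqAle eq_sym B0 sqr_ge0.
have := H (- C / B).
have -> : A + 2 * (- C / B) * C + (- C / B) ^+ 2 * B = A - C ^+ 2 / B.
  by field; rewrite gt_eqF.
by rewrite subr_ge0 ler_pdivrMr.
Qed.

End square_integrable.

(** * Angular and radial derivatives of spun functions *)

Section angular_radial_derivatives.
Variable R : realType.
Local Notation rot := (@Defs.rot R).
Local Notation e1 := (@e1 R).
Local Notation e2 := (@e2 R).
Implicit Types d : R * R -> R.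

(** The derivative with respect to the polar angle. *)
Definition dang d (x : R * R) : R := - x.2 * 'D_e1 d x + x.1 * 'D_e2 d x.

(** The Euler field [r d/dr]; the factor [r] makes its coefficients polynomial. *)
Definition drad d (x : R * R) : R := x.1 * 'D_e1 d x + x.2 * 'D_e2 d x.

Lemma annular_fst_mul d : annular d -> annular (fun x => x.1 * d x).
Proof.
by move=> ad; apply: annular_mul => // k; apply: Ck_fst; exact: open_eucl_gt.
Qed.

Lemma annular_snd_mul d : annular d -> annular (fun x => x.2 * d x).
Proof.
by move=> ad; apply: annular_mul => // k; apply: Ck_snd; exact: open_eucl_gt.
Qed.

Lemma annular_dang d : annular d -> annular (dang d).
Proof.
move=> ad; have := annularD (annularZ (-1) (annular_snd_mul (annular_derive e1 ad)))
  (annular_fst_mul (annular_derive e2 ad)).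
by under eq_fun do rewrite mulN1r -mulNr.
Qed.

Lemma annular_drad d : annular d -> annular (drad d).
Proof.
by move=> ad; exact: (annularD (annular_fst_mul (annular_derive e1 ad))
  (annular_snd_mul (annular_derive e2 ad))).
Qed.

Lemma derive_coord d (x v : R * R) : differentiable d x ->
  'D_v d x = v.1 * 'D_e1 d x + v.2 * 'D_e2 d x.
Proof.
move=> dd; have dd' : differentiable d (x.1, x.2) by rewrite -surjective_pairing.
have -> : d = (fun y => d (y.1, y.2)) by apply/funext => y; rewrite -surjective_pairing.
rewrite derive_comp2//; [|exact: differentiable_fst|exact: differentiable_snd].
rewrite derive_fst derive_snd mulrC [X in _ + X]mulrC /e1 /e2.
by under [in RHS]eq_fun do rewrite -surjective_pairing; rewrite -surjective_pairing.
Qed.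

Lemma derive_rot (V : normedModType R) (p q a : V -> R) (x v : V) :
  differentiable p x -> differentiable q x -> differentiable a x ->
  'D_v (fun y => (rot (a y) (p y, q y)).1) x =
    (rot (a x) ('D_v p x, 'D_v q x)).1 - 'D_v a x * (rot (a x) (p x, q x)).2 /\
  'D_v (fun y => (rot (a y) (p y, q y)).2) x =
    (rot (a x) ('D_v p x, 'D_v q x)).2 + 'D_v a x * (rot (a x) (p x, q x)).1.
Proof.
move=> dp dq da; rewrite /Defs.rot /=.
have dc : differentiable (cos \o a) x.
  by apply: differentiable_comp => //; apply/derivable1_diffP; exact: derivable_cos.
have ds : differentiable (sin \o a) x.
  by apply: differentiable_comp => //; apply/derivable1_diffP; exact: derivable_sin.
have Dc : 'D_v (cos \o a) x = - sin (a x) * 'D_v a x.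
  rewrite derive_comp1//; last by apply/derivable1_diffP; exact: derivable_cos.
  by rewrite derive_val.
have Ds : 'D_v (sin \o a) x = cos (a x) * 'D_v a x.
  rewrite derive_comp1//; last by apply/derivable1_diffP; exact: derivable_sin.
  by rewrite derive_val.
have dM (f g : V -> R) : differentiable f x -> differentiable g x ->
    derivable (fun y => f y * g y) x v.
  by move=> df dg; apply: diff_derivable; exact: differentiableM.
have DM (f g : V -> R) : differentiable f x -> differentiable g x ->
    'D_v (fun y => f y * g y) x = f x * 'D_v g x + g x * 'D_v f x.
  by move=> df dg; rewrite deriveM//; exact: diff_derivable.
split.
- rewrite deriveB; [|exact: (dM _ _ dp dc)|exact: (dM _ _ dq ds)].
  by rewrite (DM _ _ dp dc) (DM _ _ dq ds) Dc Ds /=; ring.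
- rewrite deriveD; [|exact: (dM _ _ dp ds)|exact: (dM _ _ dq dc)].
  by rewrite (DM _ _ dp ds) (DM _ _ dq dc) Dc Ds /=; ring.
Qed.

Lemma differentiable_rot (V : normedModType R) (p q a : V -> R) (x : V) :
  differentiable p x -> differentiable q x -> differentiable a x ->
  differentiable (fun y => (rot (a y) (p y, q y)).1) x /\
  differentiable (fun y => (rot (a y) (p y, q y)).2) x.
Proof.
move=> dp dq da; rewrite /Defs.rot /=.
have dc : differentiable (cos \o a) x.
  by apply: differentiable_comp => //; apply/derivable1_diffP; exact: derivable_cos.
have ds : differentiable (sin \o a) x.
  by apply: differentiable_comp => //; apply/derivable1_diffP; exact: derivable_sin.
by split; [apply: differentiableB|apply: differentiableD]; exact: differentiableM.
Qed.

(** Moving the point contributes the derivative of [d] in the rotated direction; varying the angle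
    moves the image along its circle and contributes the angular derivative. *)
Lemma derive_comp_rot (V : normedModType R) d (p q a : V -> R) (x v : V) :
  differentiable p x -> differentiable q x -> differentiable a x ->
  (forall y, differentiable d y) ->
  'D_v (fun y => d (rot (a y) (p y, q y))) x =
    'D_(rot (a x) ('D_v p x, 'D_v q x)) d (rot (a x) (p x, q x)) +
    'D_v a x * dang d (rot (a x) (p x, q x)).
Proof.
move=> dp dq da dd.
have [d1 d2] := differentiable_rot dp dq da.
have [D1 D2] := derive_rot v dp dq da.
have -> : (fun y => d (rot (a y) (p y, q y))) =
  (fun y => d ((rot (a y) (p y, q y)).1, (rot (a y) (p y, q y)).2)).
  by apply/funext => y; rewrite -surjective_pairing.
rewrite derive_comp2// D1 D2 [in RHS]derive_coord// /dang /e1 /e2.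
by rewrite -!surjective_pairing; ring.
Qed.

Lemma differentiable_comp_rot (V : normedModType R) d (p q a : V -> R) (x : V) :
  differentiable p x -> differentiable q x -> differentiable a x ->
  (forall y, differentiable d y) ->
  differentiable (fun y => d (rot (a y) (p y, q y))) x.
Proof.
move=> dp dq da dd; have [d1 d2] := differentiable_rot dp dq da.
have -> : (fun y => d (rot (a y) (p y, q y))) =
  (fun y => d ((rot (a y) (p y, q y)).1, (rot (a y) (p y, q y)).2)).
  by apply/funext => y; rewrite -surjective_pairing.
exact: differentiable_comp2.
Qed.

Lemma is_derive_spin d (s tau : R) (x : R * R) : annular d ->
  is_derive s 1 (fun s => d (spin s tau x)) (dang d (spin s tau x)).
Proof.
move=> ad; have dd := annular_diff ad.
have da : differentiable (fun s : R => s + tau * eucl x) s by [].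
have dp : differentiable (fun _ : R => x.1) s by [].
have dq : differentiable (fun _ : R => x.2) s by [].
have -> : (fun s => d (spin s tau x)) =
  (fun s => d (rot (s + tau * eucl x) (x.1, x.2))).
  by apply/funext => y; rewrite -surjective_pairing.
apply: DeriveDef; first by apply: diff_derivable; exact: differentiable_comp_rot.
rewrite (derive_comp_rot _ dp dq da)// !derive_cst.
rewrite deriveD// derive_cst addr0 derive_id mul1r -surjective_pairing [X in X + _](_ : _ = 0) ?add0r//.
by rewrite derive_coord//= !mul0r subrr addr0 !mul0r addr0.
Qed.

Lemma derive_eucl (v x : R * R) : 0 < eucl x ->
  eucl x * 'D_v (@eucl R) x = x.1 * v.1 + x.2 * v.2.
Proof.
move=> x0; have de := Ck_diff (Ck_eucl R 0) x0.
(* Differentiating this identity yields the derivative of [eucl] already multiplied by [eucl x],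
   without formulas for the square root. *)
have E : (fun y => eucl y * eucl y) = (fun y : R * R => y.1 * y.1 + y.2 * y.2).
  by apply/funext => y; rewrite -expr2 sqr_eucl.
have df := differentiable_fst x; have ds := differentiable_snd x.
have := congr1 (fun f => 'D_v f x) E.
rewrite deriveM; [|exact: diff_derivable|exact: diff_derivable].
rewrite deriveD; [|apply: diff_derivable; exact: differentiableM
  |apply: diff_derivable; exact: differentiableM].
rewrite deriveM; [|exact: diff_derivable|exact: diff_derivable].
rewrite deriveM; [|exact: diff_derivable|exact: diff_derivable].
by rewrite derive_fst derive_snd /GRing.scale/=; lra.
Qed.

Lemma derive_spin d (s tau : R) (x v : R * R) : annular d -> 0 < eucl x ->
  'D_v (d \o spin s tau) x = 'D_(rot (s + tau * eucl x) v) d (spin s tau x) +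
    tau * 'D_v (@eucl R) x * dang d (spin s tau x).
Proof.
move=> ad x0; have dd := annular_diff ad.
have de := Ck_diff (Ck_eucl R 0) x0.
have da : differentiable (fun x => s + tau * eucl x) x.
  by apply: differentiableD => //; exact: differentiableM.
have -> : d \o spin s tau = (fun x => d (rot (s + tau * eucl x) (x.1, x.2))).
  by apply/funext => y; rewrite -surjective_pairing.
rewrite (derive_comp_rot _ (differentiable_fst x) (differentiable_snd x) da)//.
rewrite derive_fst derive_snd -!surjective_pairing; congr (_ + _ * _).
rewrite deriveD; [|exact: diff_derivable|].
  by rewrite derive_cst add0r (@deriveZ _ _ _ (@eucl R))//; exact: diff_derivable.
by apply: diff_derivable; exact: differentiableM.
Qed.

Lemma annular_derive_origin d (v x : R * R) : annular d -> eucl x <= 0 -> 'D_v d x = 0.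
Proof. by move=> ad x0; rewrite (annular_origin (annular_derive v ad)). Qed.

(** The direction [(- x.2, x.1)] is tangent to the circle, so [eucl] does not vary along it, and
    rotations commute with the quarter-turn. At the origin both sides are zero because [d] is
    annular. *)
Lemma dang_spin d (s tau : R) (x : R * R) : annular d ->
  dang (d \o spin s tau) x = dang d (spin s tau x).
Proof.
move=> ad; have ads := annular_spin s tau ad.
have [x0|x0] := leP (eucl x) 0.
  by rewrite /dang !annular_derive_origin ?eucl_spin// !mulr0.
transitivity ('D_(- x.2, x.1) (d \o spin s tau) x).
  by rewrite derive_coord//; exact: annular_diff.
rewrite derive_spin// (_ : 'D_(_, _) (@eucl R) x = 0) ?mulr0 ?mul0r ?addr0.
  rewrite derive_coord; last exact: annular_diff.
  by rewrite /dang /spin /Defs.rot /=; ring.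
apply/eqP; rewrite -(inj_eq (mulfI (lt0r_neq0 x0))) derive_eucl//= mulr0.
by apply/eqP; ring.
Qed.

(** The Euler field is the derivative in the direction [x] itself, along which [eucl] has derivative
    [eucl x]; the shear of the angle [s + tau * r] then produces the second term. *)
Lemma drad_spin d (s tau : R) (x : R * R) : annular d ->
  drad (d \o spin s tau) x =
  drad d (spin s tau x) + tau * eucl x * dang d (spin s tau x).
Proof.
move=> ad; have ads := annular_spin s tau ad.
have [x0|x0] := leP (eucl x) 0.
  by rewrite /drad /dang !annular_derive_origin ?eucl_spin// !(mulr0, addr0).
transitivity ('D_x (d \o spin s tau) x).
  by rewrite derive_coord//; exact: annular_diff.
rewrite derive_spin// -/(spin s tau x) derive_coord; last exact: annular_diff.
congr (_ + tau * _ * _).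
apply/eqP; rewrite -(inj_eq (mulfI (lt0r_neq0 x0))) derive_eucl//= -!expr2.
by rewrite sqr_eucl.
Qed.

Lemma dang_eucl_mul d (x : R * R) : annular d ->
  dang (fun y => eucl y * d y) x = eucl x * dang d x.
Proof.
move=> ad; have ae : annular (fun y => eucl y * d y).
  by apply: annular_mul => // k; exact: Ck_eucl.
have [x0|x0] := leP (eucl x) 0.
  by rewrite /dang !annular_derive_origin// !mulr0 addr0 mulr0.
have dd := annular_diff ad x; have de := Ck_diff (Ck_eucl R 0) x0.
have D v : 'D_v (fun y => eucl y * d y) x = eucl x * 'D_v d x + d x * 'D_v (@eucl R) x.
  by rewrite deriveM//; exact: diff_derivable.
rewrite /dang !D; have := derive_eucl e1 x0; have := derive_eucl e2 x0.
rewrite /= !mulr0 !mulr1 addr0 add0r => E2 E1.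
have alg (r d1 d2 a1 a2 x1 x2 c : R) : r * a1 = x1 -> r * a2 = x2 ->
    r * (- x2 * (r * d1 + c * a1) + x1 * (r * d2 + c * a2)) =
    r * (r * (- x2 * d1 + x1 * d2)) by move=> <- <-; ring.
by apply: (mulfI (lt0r_neq0 x0)); exact: alg.
Qed.

End angular_radial_derivatives.

(** * Oscillation bounds uniform in the test function *)

Section weak_oscillation.
Variable R : realType.
Local Notation B1 := (@B1 R).
Local Notation leb2 := (@leb2 R).
Local Notation e1 := (@e1 R).
Local Notation e2 := (@e2 R).
Implicit Types d f u v X : R * R -> R.

Lemma nrmD u v : L2 u -> L2 v -> nrm (fun x => u x + v x) <= nrm u + nrm v.
Proof.
move=> Lu Lv; have Luv := L2D Lu Lv.
rewrite -(ler_pXn2r (n := 2))// ?nnegrE ?addr_ge0 ?nrm_ge0//.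
rewrite -ip_sqr ipDr// !ipDl// !ip_sqr (ipC v).
have := le_trans (ler_norm _) (ip_le Lu Lv); lra.
Qed.

Lemma nrmZ (c : R) u : L2 u -> nrm (fun x => c * u x) = `|c| * nrm u.
Proof.
move=> Lu; rewrite /nrm sqnormZ ?fineM ?L2_fin//; last by case: Lu.
by rewrite sqrtrM ?sqr_ge0// sqrtr_sqr.
Qed.

Lemma derivative_bound_lipschitz (f df : R -> R) (C : R) (s s' : R) :
  (forall t : R, is_derive t 1 f (df t)) ->
  (forall t, t \in `[Num.min s s', Num.max s s'] -> `|df t| <= C) ->
  `|f s - f s'| <= C * `|s - s'|.
Proof.
move=> fdf; wlog ss' : s s' / s' <= s.
  move=> W; have /orP[|ss'] := le_total s' s; first exact: W.
  by rewrite distrC (distrC s) minC maxC; exact: W.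
rewrite minC maxC min_l// max_r// => dfC.
have [|c cs ->] := @MVT_segment R f df s' s ss' (fun t _ => fdf t).
  apply: continuous_subspaceT => t; apply: differentiable_continuous.
  by apply/derivable1_diffP; exact: ex_derive.
by rewrite normrM ler_wpM2r// dfC.
Qed.

(** The content of [Hm1_admissible] for functions measurable on the whole plane;
    [Hm1_admissible_unit] passes to this form by extension by zero. *)
Definition H1_unit X (G1 G2 : R * R -> R) : Prop :=
  [/\ L2 X, L2 G1, L2 G2, weak_grad X G1 G2 &
    (\int[leb2]_(x in B1) (G1 x ^+ 2 + G2 x ^+ 2)%:E <= 1)%E].

(** Division by [r] matches the factor [r] in [drad_spin]: the angular derivative of [d = r d1] is
    [r] times that of [d1]. The bracket bounds [tau] times the derivative in [s], and the outer
    [2 * pi] is the length of the period over which this derivative acts. *)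
Definition osc_bound d : R :=
  let d1 := fun x : R * R => (eucl x)^-1 * d x in
  2 * pi * (2 * nrm d1 + 2 * pi * nrm (fun x => 2 * d1 x + drad d1 x)).

Section fixed_test_function.
Variables X G1 G2 : R * R -> R.
Hypothesis XG : H1_unit X G1 G2.
Let LX : L2 X. Proof. by case: XG. Qed.

(** Pointwise Cauchy-Schwarz: [(a G1 + b G2)^2 <= (a^2 + b^2) (G1^2 + G2^2)]. *)
Lemma L2_grad_comb (a b : R * R -> R) :
  measurable_fun setT a -> measurable_fun setT b ->
  (forall x, B1 x -> a x ^+ 2 + b x ^+ 2 <= 1) ->
  L2 (fun x => a x * G1 x + b x * G2 x) /\ nrm (fun x => a x * G1 x + b x * G2 x) <= 1.
Proof.
move=> ma mb ab; case: XG => _ [mG1 _] [mG2 _] _ GG.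
have mG : measurable_fun setT (fun x => a x * G1 x + b x * G2 x).
  by apply: measurable_funD; exact: measurable_funM.
have sq : (sqnorm (fun x => a x * G1 x + b x * G2 x)%R <= 1)%E.
  apply: le_trans GG; apply: ge0_le_integral => //.
  - exact: measurable_B1.
  - by move=> x _; rewrite lee_fin sqr_ge0.
  - exact: measurable_sqr_B1.
  - by apply: measurable_funTS; apply/measurable_EFinP; apply: measurable_funD;
      exact: measurable_funX.
  - move=> x /ab abx; rewrite lee_fin.
    have := sqr_ge0 (a x * G2 x - b x * G1 x).
    have : 0 <= (1 - (a x ^+ 2 + b x ^+ 2)) * (G1 x ^+ 2 + G2 x ^+ 2).
      by rewrite mulr_ge0 ?subr_ge0// addr_ge0 ?sqr_ge0.
    lra.
split; first by split => //; exact: le_lt_trans sq (ltry _).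
by apply: nrm_le => //; rewrite expr1n.
Qed.

(** The weak analogues of [dang X] and [drad X]. In both cases the squared coefficients add up to
    [r^2 <= 1], so the norm is at most [1]. *)
Let Ga x := - x.2 * G1 x + x.1 * G2 x.
Let Gr x := x.1 * G1 x + x.2 * G2 x.

Let LGa : L2 Ga /\ nrm Ga <= 1.
Proof.
apply: L2_grad_comb => //.
  by apply: measurableT_comp => //; exact: measurable_snd.
by move=> x; rewrite B1E => /ltW x1; rewrite sqrrN addrC -sqr_eucl exprn_ile1 ?eucl_ge0.
Qed.

Let LGr : L2 Gr /\ nrm Gr <= 1.
Proof.
apply: L2_grad_comb => //.
by move=> x; rewrite B1E => /ltW x1; rewrite -sqr_eucl exprn_ile1 ?eucl_ge0.
Qed.

Lemma weak_grad_ip (phi : R * R -> R) : test_fun phi ->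
  ip X (fun x => 'D_e1 phi x) = - ip G1 phi /\ ip X (fun x => 'D_e2 phi x) = - ip G2 phi.
Proof.
move=> tphi; case: XG => _ _ _ /(_ _ tphi)[H1 H2] _.
by rewrite /ip /Rintegral H1 H2 !fineN.
Qed.

(** The rotation field is divergence free, so [dang d] is the divergence of [(- x.2 d, x.1 d)]. *)
Lemma weak_dang d : annular d -> ip X (dang d) = - ip Ga d.
Proof.
move=> ad; case: XG => _ L1 L2' _ _.
have a1 := annular_fst_mul ad; have a2 := annularZ (-1) (annular_snd_mul ad).
have [E1 _] := weak_grad_ip (annular_test_fun a2).
have [_ E2] := weak_grad_ip (annular_test_fun a1).
have dd x := annular_diff ad x.
have -> : dang d = (fun x => 'D_e1 (fun x : R * R => -1 * (x.2 * d x)) x +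
    'D_e2 (fun x : R * R => x.1 * d x) x).
  apply/funext => x.
  have d2 : derivable (fun x : R * R => x.2 * d x) x e1.
    by apply: diff_derivable; apply: differentiableM => //; exact: differentiable_snd.
  rewrite (@deriveZ _ _ _ (fun x : R * R => x.2 * d x))//.
  rewrite deriveM; [|apply: diff_derivable; exact: differentiable_snd|exact: diff_derivable].
  rewrite deriveM; [|apply: diff_derivable; exact: differentiable_fst|exact: diff_derivable].
  by rewrite derive_snd derive_fst /dang /GRing.scale/=; ring.
rewrite ipDr//; [|exact: (L2_annular (annular_derive e1 a2))
  |exact: (L2_annular (annular_derive e2 a1))].
rewrite E1 E2 -opprD; congr (- _).
rewrite /ip -RintegralD; last 3 first.
- exact: measurable_B1.
- exact: integrable_mul L1 (L2_annular a2).
- exact: integrable_mul L2' (L2_annular a1).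
by apply: eq_Rintegral => x _; rewrite /Ga; ring.
Qed.

(** The Euler field has divergence [2], so [2 d + drad d] is the divergence of [(x.1 d, x.2 d)]. *)
Lemma weak_drad d : annular d -> ip X (fun x => 2 * d x + drad d x) = - ip Gr d.
Proof.
move=> ad; case: XG => _ L1 L2' _ _.
have a1 := annular_fst_mul ad; have a2 := annular_snd_mul ad.
have [E1 _] := weak_grad_ip (annular_test_fun a1).
have [_ E2] := weak_grad_ip (annular_test_fun a2).
have dd x := annular_diff ad x.
have -> : (fun x => 2 * d x + drad d x) =
    (fun x => 'D_e1 (fun x : R * R => x.1 * d x) x +
    'D_e2 (fun x : R * R => x.2 * d x) x).
  apply/funext => x.
  rewrite deriveM; [|apply: diff_derivable; exact: differentiable_fst|exact: diff_derivable].
  rewrite deriveM; [|apply: diff_derivable; exact: differentiable_snd|exact: diff_derivable].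
  by rewrite derive_snd derive_fst /drad /GRing.scale/=; ring.
rewrite ipDr//; [|exact: (L2_annular (annular_derive e1 a1))
  |exact: (L2_annular (annular_derive e2 a2))].
rewrite E1 E2 -opprD; congr (- _).
rewrite /ip -RintegralD; last 3 first.
- exact: measurable_B1.
- exact: integrable_mul L1 (L2_annular a1).
- exact: integrable_mul L2' (L2_annular a2).
by apply: eq_Rintegral => x _; rewrite /Gr; ring.
Qed.

(** Differentiation under the integral sign, the derivatives being dominated by [M] times [|X|],
    where [M] bounds [dang d]. *)
Lemma is_derive_ip_spin d (tau s : R) : annular d ->
  is_derive s 1 (fun s => ip X (d \o spin s tau)) (ip X (dang d \o spin s tau)).
Proof.
move=> ad; have [M M0 dM] := annular_bounded (annular_dang ad).
pose f s x := X x * d (spin s tau x).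
have fd (t : R) x : is_derive t 1 (fun s => f s x) (X x * dang d (spin t tau x)).
  by rewrite /f; have := is_derive_spin t tau x ad => ?; exact: is_deriveZ.
have Hs : (`]s - 1, s + 1[%classic : set R) s by rewrite /= in_itv/=; lra.
have intf t : (`]s - 1, s + 1[%classic : set R) t -> leb2.-integrable B1 (EFin \o f t).
  by move=> _; exact: integrable_mul LX (L2_spin _ _ (L2_annular ad)).
have df t x : (`]s - 1, s + 1[%classic : set R) t -> B1 x -> derivable (f ^~ x) t 1.
  by move=> _ _; exact: ex_derive.
have G0 x : 0 <= `|X x * M| by [].
have intG : leb2.-integrable B1 (EFin \o (fun x => `|X x * M|)).
  have : leb2.-integrable B1 (EFin \o (fun x => X x * M)).
    apply: integrable_mul LX _; apply: (@L2_bounded _ _ M) => //.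
    by apply: aeW => x; rewrite ger0_norm// ltW.
  exact: integrable_norm.
have Gub t x : (`]s - 1, s + 1[%classic : set R) t -> B1 x -> `|partial1of2 f t x| <= `|X x * M|.
  move=> _ _; rewrite partial1of2E derive_val !normrM ler_wpM2l// (gtr0_norm M0).
  exact: dM.
apply: DeriveDef.
  exact: (derivable_under_integral (@measurable_B1 R) Hs intf df G0 intG Gub).
rewrite -derive1E.
rewrite (differentiation_under_integral (@measurable_B1 R) Hs intf df G0 intG Gub).
by apply: eq_Rintegral => x _; rewrite partial1of2E derive_val.
Qed.

(** Since the angular derivative commutes with the spin, it can be moved onto [X], where
    [nrm Ga <= 1]; the bound involves no derivative of [d] and no [nrm X]. *)
Lemma ip_dang_spin_le d (tau s : R) : annular d -> `|ip X (dang d \o spin s tau)| <= nrm d.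
Proof.
move=> ad; have as' := annular_spin s tau ad.
have -> : dang d \o spin s tau = dang (d \o spin s tau).
  by apply/funext => x; rewrite dang_spin.
rewrite weak_dang// normrN; apply: le_trans (ip_le LGa.1 (L2_annular as')) _.
by rewrite nrm_spin ?ler_piMl ?nrm_ge0 ?LGa.2//; exact: L2_annular.
Qed.

Lemma ip_spin_lipschitz d (tau s s' : R) : annular d ->
  `|ip X (d \o spin s tau) - ip X (d \o spin s' tau)| <= nrm d * `|s - s'|.
Proof.
move=> ad; apply: (@derivative_bound_lipschitz (fun s => ip X (d \o spin s tau))).
  by move=> t; exact: is_derive_ip_spin.
by move=> t _; exact: ip_dang_spin_le.
Qed.

(* The derivative of [s |-> ip X (d \o spin s tau)] vanishes somewhere by periodicity, and
   [tau] times this derivative has oscillation bounded independently of [tau]. *)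
Lemma ip_spin_oscillation d (tau s : R) : annular d -> 0 < tau -> 0 <= s <= 2 * pi ->
  `|ip X (d \o spin s tau) - ip X (d \o spin 0 tau)| <= osc_bound d / tau.
Proof.
move=> ad tau0 /andP[s0 s2]; rewrite /osc_bound.
set d1 := fun x => _; set K := fun x => _ + _.
have ad1 : annular d1 by apply: annular_mul => // k; exact: Ck_invr_eucl.
have aK : annular K by apply: annularD; [exact: annularZ|exact: annular_drad].
have dE : d = (fun x => eucl x * d1 x).
  apply/funext => x; have [x0|x0] := leP (eucl x) 0.
    by rewrite /d1 (annular_origin ad)// !mulr0.
  by rewrite /d1 mulrA divff ?mul1r// gt_eqF.
have ang x : dang d x = eucl x * dang d1 x by rewrite dE dang_eucl_mul.
have pi0 := pi_gt0 R.
(* By [drad_spin], [tau] times the spun [dang d] is [drad (d1 \o spin t tau)] minus the spun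
   [drad d1]. Adding and subtracting the spun [2 d1] completes the first term to the divergence of
   [weak_drad] and the second to [K]. *)
have key t : tau * ip X (dang d \o spin t tau) =
    - ip Gr (d1 \o spin t tau) - ip X (K \o spin t tau).
  have a1 := annular_spin t tau ad1.
  have LK := L2_spin t tau (L2_annular aK).
  have Ld := L2_spin t tau (L2_annular (annular_dang ad)).
  have L1 := L2D (L2Z 2 (L2_annular a1)) (L2_annular (annular_drad a1)).
  rewrite -(weak_drad a1) -(ipBr LX L1 LK) -(ipZr tau LX Ld).
  congr ip; apply/funext => x.
  by rewrite drad_spin// /K/= ang /d1/= !eucl_spin; ring.
have [s0' s0'I /@derive_val D0] : exists2 c, c \in `]0%R, (2 * pi)%R[ &
    is_derive c 1 (fun s => ip X (d \o spin s tau)) 0.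
  apply: Rolle; first by rewrite mulr_gt0.
  - by move=> t _; have := is_derive_ip_spin tau t ad => ?; exact: ex_derive.
  - apply: continuous_subspaceT => t; apply: differentiable_continuous.
    apply/derivable1_diffP; have := is_derive_ip_spin tau t ad => ?.
    exact: ex_derive.
  - congr ip; apply/funext => x /=.
    by rewrite -[in RHS](add0r (2 * pi)) spinD2pi.
have {}D0 : ip X (dang d \o spin s0' tau) = 0.
  by have := is_derive_ip_spin tau s0' ad => H; rewrite -[LHS](@derive_val _ _ _ _ _ _ _ H).
have Hd t : `|ip Gr (d1 \o spin t tau)| <= nrm d1.
  have Ld1 := L2_annular ad1.
  apply: le_trans (ip_le LGr.1 (L2_spin _ _ Ld1)) _.
  by rewrite nrm_spin// ler_piMl ?nrm_ge0 ?LGr.2.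
(* Subtracting [key] at the critical point [s0'] leaves two differences: the first is at most
   [2 * nrm d1], the second is a Lipschitz increment of [K] over a distance at most [2 * pi]. No
   [nrm X] appears. *)
have bound t : t \in `[0, 2 * pi] -> tau * `|ip X (dang d \o spin t tau)| <=
    2 * nrm d1 + 2 * pi * nrm K.
  rewrite in_itv/= => /andP[t0 t2].
  rewrite -{1}(gtr0_norm tau0) -normrM key.
  have := key s0'; rewrite D0 mulr0 => E0.
  have split_diff (a a0 b b0 : R) : 0 = - a0 - b0 -> - a - b = - a + a0 - (b - b0) by lra.
  rewrite (split_diff _ _ _ _ E0).
  apply: le_trans (ler_normB _ _) _; apply: lerD.
    by apply: le_trans (ler_normD _ _) _; rewrite normrN mulr_natl lerD.
  apply: le_trans (ip_spin_lipschitz tau t s0' aK) _.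
  rewrite mulrC ler_wpM2r ?nrm_ge0//.
  by move: s0'I; rewrite in_itv/= ler_norml => /andP[? ?]; apply/andP; split; lra.
have := @derivative_bound_lipschitz (fun s => ip X (d \o spin s tau))
  (fun s => ip X (dang d \o spin s tau)) ((2 * nrm d1 + 2 * pi * nrm K) / tau) s 0
  (fun t => is_derive_ip_spin tau t ad).
rewrite (min_r s0) (max_l s0) subr0 => /(_ _)/le_trans; apply.
  move=> t; rewrite in_itv/= => /andP[t0 ts].
  rewrite ler_pdivlMr// mulrC bound// in_itv/= t0/=; exact: le_trans ts s2.
rewrite (ger0_norm s0) mulrC mulrA ler_pM2r ?invr_gt0//.
by rewrite ler_wpM2r// addr_ge0 ?mulr_ge0 ?nrm_ge0 ?(ltW pi0).
Qed.

Lemma approximable_nrm f (e : R) : approximable f -> 0 < e ->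
  exists2 d, annular d & nrm (fun x => f x - d x) <= e.
Proof.
move=> [mf af] e0; have [|d ad de] := af (e ^+ 2); first by rewrite exprn_gt0.
by exists d => //; apply: nrm_le de; exact: ltW.
Qed.

Lemma ip_spinB u v (s tau : R) : L2 u -> L2 v ->
  ip X ((fun x => u x - v x) \o spin s tau) =
  ip X (u \o spin s tau) - ip X (v \o spin s tau).
Proof.
by move=> Lu Lv; rewrite -ipBr//; exact: L2_spin.
Qed.

Lemma ip_spin_le u (s tau : R) : L2 u -> `|ip X (u \o spin s tau)| <= nrm X * nrm u.
Proof.
by move=> Lu; rewrite -(nrm_spin s tau Lu); apply: ip_le => //; exact: L2_spin.
Qed.

(** The Lipschitz bound passes to the limit along annular approximations. These may be chosen
    depending on [X], because the limiting constant [nrm f] does not. *)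
Lemma approximable_ip_spin_lipschitz f (tau s s' : R) : L2 f -> approximable f ->
  `|ip X (f \o spin s tau) - ip X (f \o spin s' tau)| <= nrm f * `|s - s'|.
Proof.
move=> Lf af; apply/ler_addgt0Pr => e e0.
(* With [nrm h <= e / c], the constant [nrm d] exceeds [nrm f] by at most [e / c], which is paid
   [|s - s'|] times, and the two values at [h] cost [2 * nrm X] more; the final [1] keeps [c]
   positive. *)
pose c := `|s - s'| + 2 * nrm X + 1.
have c0 : 0 < c by rewrite ltr_wpDl// addr_ge0// mulr_ge0// nrm_ge0.
have [|d ad de] := approximable_nrm af (e := e / c); first by rewrite divr_gt0.
have Ld := L2_annular ad; have Lh := L2B Lf Ld.
set h := fun x => _ in de Lh.
have E t : ip X (f \o spin t tau) = ip X (d \o spin t tau) + ip X (h \o spin t tau).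
  by rewrite ip_spinB//; lra.
have nd : nrm d <= nrm f + e / c.
  have -> : d = (fun x => f x + -1 * h x) by apply/funext => x; rewrite /h; ring.
  apply: le_trans (nrmD Lf (L2Z _ Lh)) _.
  by rewrite nrmZ// normrN1 mul1r lerD2l.
rewrite !E.
have -> : ip X (d \o spin s tau) + ip X (h \o spin s tau) -
  (ip X (d \o spin s' tau) + ip X (h \o spin s' tau)) =
  (ip X (d \o spin s tau) - ip X (d \o spin s' tau)) +
  (ip X (h \o spin s tau) - ip X (h \o spin s' tau)) by ring.
apply: le_trans (ler_normD _ _) _.
have H1 := ip_spin_lipschitz tau s s' ad.
have H2 := ler_normB (ip X (h \o spin s tau)) (ip X (h \o spin s' tau)).
have H3 := ip_spin_le s tau Lh; have H4 := ip_spin_le s' tau Lh.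
have X0 := nrm_ge0 X.
have H5 : nrm X * nrm h <= nrm X * (e / c) by rewrite ler_wpM2l.
have H6 : nrm d * `|s - s'| <= (nrm f + e / c) * `|s - s'| by rewrite ler_wpM2r.
have H7 : c * (e / c) = e by rewrite mulrC divfK// gt_eqF.
have H8 : 0 < e / c by rewrite divr_gt0.
rewrite /c in H7; nra.
Qed.

End fixed_test_function.

(** The annular [d] is fixed before [X] and [tau]. The remainder [f - d] is estimated by its
    Lipschitz constant over a period, which is why it is taken of norm at most [e / (2 * pi)]. *)
Lemma ip_spin_oscillation_ae_bounded f (M e : R) : measurable_fun setT f ->
  {ae leb2, forall x, `|f x| <= M} -> 0 < e ->
  exists C : R, forall X G1 G2 (tau s : R), H1_unit X G1 G2 -> 0 < tau ->
    0 <= s <= 2 * pi ->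
    `|ip X (f \o spin s tau) - ip X (f \o spin 0 tau)| <= C / tau + e.
Proof.
move=> mf fM e0; have af := approximable_ae_bounded mf fM.
have Lf := L2_bounded mf fM; have pi0 := pi_gt0 R.
have [|d ad de] := approximable_nrm af (e := e / (2 * pi)).
  by rewrite divr_gt0// mulr_gt0.
exists (osc_bound d) => X G1 G2 tau s XG tau0 s02; have [LX _ _ _ _] := XG.
have Ld := L2_annular ad; have Lh := L2B Lf Ld.
set h := fun x => _ in de Lh.
have ah : approximable h.
  have := approximableD af (approximableZ (-1) (annular_approximable ad)).
  by under eq_fun do rewrite mulN1r.
have E t : ip X (f \o spin t tau) = ip X (d \o spin t tau) + ip X (h \o spin t tau).
  by rewrite (ip_spinB XG)//; lra.
rewrite !E.
have -> : ip X (d \o spin s tau) + ip X (h \o spin s tau) -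
  (ip X (d \o spin 0 tau) + ip X (h \o spin 0 tau)) =
  (ip X (d \o spin s tau) - ip X (d \o spin 0 tau)) +
  (ip X (h \o spin s tau) - ip X (h \o spin 0 tau)) by ring.
apply: le_trans (ler_normD _ _) _; apply: lerD; first exact: (ip_spin_oscillation XG ad tau0 s02).
apply: le_trans (approximable_ip_spin_lipschitz XG tau s 0 Lh ah) _.
have /andP[s0 s2] := s02; rewrite subr0 ger0_norm//.
have : nrm h * s <= e / (2 * pi) * (2 * pi).
  by apply: ler_pM => //; exact: nrm_ge0.
by rewrite divfK// gt_eqF// mulr_gt0.
Qed.

End weak_oscillation.

(** * Vanishing circle means and averages over rotations *)

Section circle_means.
Variable R : realType.
Local Notation mu := (@lebesgue_measure R).
Implicit Types f X : R * R -> R.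

Lemma polar_angle (x : R * R) : exists a : R, x = (eucl x * cos a, eucl x * sin a).
Proof.
have [x0|x0] := leP (eucl x) 0.
  exists 0; have e0 : eucl x = 0 by apply/eqP; rewrite eq_le x0 eucl_ge0.
  rewrite e0 !mul0r [LHS]surjective_pairing.
  have := normr1_le_eucl x; have := normr2_le_eucl x; rewrite e0 !normr_le0.
  by move=> /eqP-> /eqP->.
have y1 : -1 <= x.1 / eucl x <= 1.
  by rewrite -ler_norml normrM normfV (gtr0_norm x0) ler_pdivrMr// mul1r normr1_le_eucl.
have c1 : eucl x * (x.1 / eucl x) = x.1 by rewrite mulrC divfK// gt_eqF.
have s1 : eucl x * Num.sqrt (1 - (x.1 / eucl x) ^+ 2) = `|x.2|.
  rewrite -{1}(gtr0_norm x0) -sqrtr_sqr -sqrtrM ?sqr_ge0//.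
  rewrite mulrBr mulr1 -exprMn c1 sqr_eucl -sqrtr_sqr; congr Num.sqrt; ring.
have [x2|x2] := leP 0 x.2.
  exists (acos (x.1 / eucl x)); rewrite acosK ?in_itv//= sin_acos// c1 s1 ger0_norm//.
  exact: surjective_pairing.
exists (- acos (x.1 / eucl x)).
rewrite cosN sinN acosK ?in_itv//= sin_acos// c1 mulrN s1 ltr0_norm// opprK.
exact: surjective_pairing.
Qed.

(** A finite integral forces finite positive and negative parts. Through this, the equation
    [circle_integral f r = 0] alone yields integrability on the circle. *)
Lemma fin_num_integrable (D : set R) (g : R -> \bar R) : measurable D ->
  measurable_fun D g -> (\int[mu]_(x in D) g x)%E \is a fin_num -> mu.-integrable D g.
Proof.
move=> mD mg; rewrite integralE => fg.
have p0 : (0 <= \int[mu]_(x in D) g^\+ x)%E by exact: integral_ge0.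
have n0 : (0 <= \int[mu]_(x in D) g^\- x)%E by exact: integral_ge0.
apply/integrableP; split => //.
under eq_integral do rewrite -/((abse \o g) _) fune_abse.
rewrite ge0_integralD//; [|exact: measurable_funepos|exact: measurable_funeneg].
move: fg p0 n0; case: (integral _ _ _) => [a| |]; case: (integral _ _ _) => [b| |]//= _ _ _.
by rewrite -EFinD ltry.
Qed.

Lemma integral_periodZ (g : R -> R) (c k : R) : measurable_fun setT g ->
  (forall th, g (th + 2 * pi) = g th) ->
  (\int[mu]_(th in `[0%R, (2 * pi)%R]) (g th)%:E = 0)%E ->
  (\int[mu]_(th in `[0%R, (2 * pi)%R]) (k * g (th + c))%:E = 0)%E.
Proof.
move=> mg gT g0.
have pi2 : 0 < 2 * pi :> R by rewrite mulr_gt0// pi_gt0.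
have mS (h : R -> \bar R) : measurable_fun setT h -> measurable_fun setT (fun x : R => h (x + c)).
  by move=> mh; apply: measurableT_comp => //; exact: measurable_funD.
have P (h : R -> \bar R) : measurable_fun setT h -> (forall x, 0 <= h x)%E ->
    (forall th, h (th + 2 * pi) = h th) ->
    (\int[mu]_(th in `[0%R, (2 * pi)%R]) h (th + c)%R = \int[mu]_(th in `[0%R, (2 * pi)%R]) h th)%E.
  move=> mh h0 hT.
  rewrite -integral_itv_obnd_cbnd; last by apply: measurable_funTS; exact: mS.
  rewrite -[RHS]integral_itv_obnd_cbnd; last exact: measurable_funTS.
  rewrite -(ge0_integral_period c pi2 mh h0 hT) [RHS](ge0_integral_shift c)//.
  congr (integral _ _ _); apply/seteqP; split => x /=; rewrite !in_itv/=; lra.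
have mg' : measurable_fun setT (EFin \o g) by apply/measurable_EFinP.
have E : (\int[mu]_(th in `[0%R, (2 * pi)%R]) (g (th + c))%:E = 0)%E.
  rewrite -g0 integralE [RHS]integralE; congr (_ - _)%E.
  - have gp th : ((EFin \o g)^\+ (th + 2 * pi)%R = (EFin \o g)^\+ th)%E.
      by rewrite funepos.unlock /= gT.
    rewrite -(P _ (measurable_funepos mg') (fun x => funepos_ge0 (EFin \o g) x) gp).
    by apply: eq_integral => th _; rewrite funepos.unlock.
  - have gn th : ((EFin \o g)^\- (th + 2 * pi)%R = (EFin \o g)^\- th)%E.
      by rewrite funeneg.unlock /= gT.
    rewrite -(P _ (measurable_funeneg mg') (fun x => funeneg_ge0 (EFin \o g) x) gn).
    by apply: eq_integral => th _; rewrite funeneg.unlock.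
have ig : mu.-integrable `[0%R, (2 * pi)%R] (fun th => (g (th + c))%:E).
  apply: fin_num_integrable => //; last by rewrite E.
  by apply: measurable_funTS; exact: (mS _ mg').
under eq_integral do rewrite EFinM.
by rewrite integralZl// E mule0.
Qed.

(** As [s] runs through a period, [spin s tau x] runs once around the circle through [x], from a
    shifted starting angle; the factor [k / r] compensates the arc-length weight [r] in
    [circle_integral]. *)
Lemma circle_integral_spin f (tau k : R) (x : R * R) : measurable_fun setT f ->
  0 < eucl x -> circle_integral f (eucl x) = 0%E ->
  (\int[mu]_(s in `[0%R, (2 * pi)%R]) (k * f (spin s tau x))%:E = 0)%E.
Proof.
move=> mf x0 f0; have [a xa] := polar_angle x; set r := eucl x in f0 x0 xa *.
pose g th := f (r * cos th, r * sin th) * r.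
have mg : measurable_fun setT g.
  apply: measurable_funM => //; apply: measurableT_comp => //.
  by apply: measurable_fun_pair; apply: measurable_funM => //;
    [exact: measurable_cos|exact: measurable_sin].
have gT th : g (th + 2 * pi) = g th.
  by rewrite /g mulr_natl cosD2pi sinD2pi.
rewrite -(integral_periodZ (a + tau * r) (k / r) mg gT f0).
apply: eq_integral => s _; congr EFin; rewrite /g /spin -/r {1}xa rot_polar.
rewrite (_ : a + (s + tau * r) = s + (a + tau * r)); last ring.
by field; rewrite gt_eqF.
Qed.

End circle_means.

(** * Decay of the H^-1 norm *)

Section functional_mixing.
Variable R : realType.
Local Notation mu := (@lebesgue_measure R).
Local Notation B1 := (@B1 R).
Local Notation leb2 := (@leb2 R).
Implicit Types f X : R * R -> R.

Section mean_over_rotations.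
Variables (X f : R * R -> R) (tau : R).
Hypotheses (LX : L2 X) (Lf : L2 f).
Hypothesis f0 : {ae mu, forall r : R, 0 < r -> circle_integral f r = 0%E}.

(** Indicators encode the domains of [s] and [x], so that Fubini's theorem applies on the whole
    product space. *)
Let I : R -> R := \1_(`[0%R, (2 * pi)%R]%classic : set R).
Let F (z : measurableTypeR R * (R * R)) : \bar R :=
  (I z.1 * (\1_B1 z.2 * (X z.2 * f (spin z.1 tau z.2))))%:E.

Let mI : measurable_fun setT I.
Proof. by apply: measurable_indic; exact: measurable_itv. Qed.

Let I_ge0 (s : R) : 0 <= I s.
Proof. by rewrite /I indicE. Qed.

Let integralI : (\int[mu]_s (I s)%:E = (2 * pi)%:E)%E.
Proof.
have pi2 : 0 < 2 * pi :> R by rewrite mulr_gt0// pi_gt0.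
rewrite /I (integral_indic mu measurableT (measurable_itv _)) setIT.
have := @lebesgue_measure_itv R `[0%R, (2 * pi)%R]%R.
by rewrite /= lte_fin pi2 -EFinB subr0 => <-.
Qed.

Let mF : measurable_fun setT F.
Proof.
have [mX _] := LX; have [mf _] := Lf.
have m1 : measurable_fun setT (fun z : measurableTypeR R * (R * R) => z.1 : R).
  exact: measurable_fst.
apply/measurable_EFinP; apply: measurable_funM.
  exact: (measurableT_comp mI m1).
have m2 : measurable_fun setT (fun z : measurableTypeR R * (R * R) => z.2).
  exact: measurable_snd.
apply: measurable_funM.
  apply: (@measurableT_comp _ _ _ _ _ _ (\1_B1 : R * R -> R) _ snd) => //.
  by apply: measurable_indic; exact: measurable_B1.
apply: measurable_funM; first exact: measurableT_comp mX m2.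
apply: measurableT_comp mf _; exact: measurable_spin_param.
Qed.

Let inner (s : R) : (\int[leb2]_x F (s, x) = (I s * ip X (f \o spin s tau))%:E)%E.
Proof.
have iX := integrable_mul LX (L2_spin s tau Lf).
have -> : ip X (f \o spin s tau) =
    fine (\int[leb2]_(x in B1) (X x * (f \o spin s tau) x)%:E)%E by [].
rewrite EFinM fineK; last by apply: integrable_fin_num => //; exact: measurable_B1.
rewrite -integralZl//; last exact: measurable_B1.
rewrite [RHS]integral_mkcond; apply: eq_integral => x _.
rewrite patchE /F /= indicE; case: ifPn => _; rewrite ?mul1r ?mul0r ?mulr0//.
Qed.

(** At fixed [s], the product is at most [X^2] plus the square of the spun [f], whose integral over
    the disk does not depend on [s]. *)
Let integrableF : (mu \x leb2)%E.-integrable setT F.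
Proof.
have [mX X2] := LX; have [mf f2] := Lf.
apply/(integrable12ltyP _ _ mF).
pose K := (sqnorm X + sqnorm f)%E.
have Kfin : K \is a fin_num by rewrite fin_numD !L2_fin.
apply: (@le_lt_trans _ _ (\int[mu]_s ((fine K)%:E * (I s)%:E))%E).
  apply: ge0_le_integral => //.
  - by move=> s _; exact: integral_ge0.
  - apply: (@measurable_fun_fubini_tonelli_F _ _ _ _ R leb2 (abse \o F)) => //.
      exact: measurableT_comp.
    by move=> z; exact: abse_ge0.
  - apply/measurable_EFinP; exact: measurable_funM.
  - move=> s _; rewrite fineK// /K -(sqnorm_spin s tau mf) muleC.
    have mfs : measurable_fun setT (f \o spin s tau).
      exact: measurableT_comp mf (measurable_spin s tau).
    have m1 := measurable_sqr_B1 mX; have m2 := measurable_sqr_B1 mfs.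
    have p1 x : B1 x -> (0 <= ((X x) ^+ 2)%:E)%E by rewrite lee_fin sqr_ge0.
    have p2 x : B1 x -> (0 <= (((f \o spin s tau) x) ^+ 2)%:E)%E by rewrite lee_fin sqr_ge0.
    have p12 x : B1 x -> (0 <= ((X x) ^+ 2)%:E + (((f \o spin s tau) x) ^+ 2)%:E)%E.
      by move=> _; rewrite adde_ge0// lee_fin sqr_ge0.
    rewrite /sqnorm -(ge0_integralD leb2 (@measurable_B1 R) p1 m1 p2 m2).
    rewrite -(ge0_integralZl leb2 (@measurable_B1 R) (emeasurable_funD m1 m2) p12); last first.
      by rewrite lee_fin I_ge0.
    have mFs : measurable_fun setT (fun x => `|F (s, x)|%E).
      by apply: measurableT_comp => //; exact: (measurableT_comp mF (pair1_measurable s)).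
    rewrite [leRHS]integral_mkcond; apply: ge0_le_integral => //.
    + apply/(measurable_restrictT _ _).1; first exact: measurable_B1.
      apply: measurable_funeM; apply: emeasurable_funD; exact: measurable_sqr_B1.
    + move=> x _; rewrite patchE /F /= indicE; case: ifPn => _; last first.
        by rewrite mul0r mulr0 normr0.
      rewrite mul1r -EFinD -EFinM lee_fin normrM ger0_norm ?I_ge0// ler_wpM2l ?I_ge0//.
      rewrite normrM -(real_normK (num_real (X x))).
      rewrite -(real_normK (num_real (f (spin s tau x)))).
      have := normr_ge0 (X x); have := normr_ge0 (f (spin s tau x)); nra.
rewrite ge0_integralZl//; last 3 first.
- exact/measurable_EFinP.
- by move=> s _; rewrite lee_fin I_ge0.
- by rewrite lee_fin fine_ge0// adde_ge0// sqnorm_ge0.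
by rewrite integralI -EFinM ltry.
Qed.

(** At almost every [x] the inner integral is a multiple of a vanishing circle integral. The radius
    [0] is added to the exceptional radii, and [ae_radial] turns them into exceptional points. *)
Let outer : (\int[leb2]_x \int[mu]_s F (s, x) = 0)%E.
Proof.
have [mf _] := Lf.
rewrite -[RHS](integral0 leb2 setT); apply: ae_eq_integral => //.
  exact: (measurable_fubini_G integrableF).
have f0' : {ae mu, forall r : R, r != 0 /\ (0 < r -> circle_integral f r = 0%E)}.
  case: f0 => N [mN N0 hN]; exists (N `|` [set 0]); split.
  - by apply: measurableU => //; exact: measurable_set1.
  - by rewrite measureU0//; exact: lebesgue_measure_set1.
  - move=> r /= H; have [->|r0] := eqVneq r 0; first by right.
    by left; apply: hN => /= fr; apply: H.
have := ae_radial f0'; case=> N [mN N0 hN]; exists N; split => // x /= H.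
apply: hN => /= -[x0 fx]; apply: H => _.
have {}x0 : 0 < eucl x by rewrite lt_neqAle eq_sym x0 eucl_ge0.
rewrite -[RHS](circle_integral_spin tau (\1_B1 x * X x) mf x0 (fx x0)).
rewrite [RHS]integral_mkcond; apply: eq_integral => s _.
rewrite patchE /F /I /= indicE; case: ifPn => _; last by rewrite mul0r.
by rewrite mul1r !mulrA.
Qed.

Lemma integral_ip_spin : mu.-integrable setT (fun s => (I s * ip X (f \o spin s tau))%:E) /\
  (\int[mu]_s (I s * ip X (f \o spin s tau))%:E = 0)%E.
Proof.
have -> : (fun s => (I s * ip X (f \o spin s tau))%:E) = fubini_F leb2 F.
  by apply/funext => s; rewrite -inner.
split; first exact: (integrable_fubini_F integrableF).
exact: etrans (Fubini integrableF) outer.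
Qed.

Lemma ip_spin_mean_bound (B : R) :
  (forall s, 0 <= s <= 2 * pi ->
    `|ip X (f \o spin s tau) - ip X (f \o spin 0 tau)| <= B) ->
  `|ip X (f \o spin 0 tau)| <= B.
Proof.
move=> HB; have [iE E0] := integral_ip_spin.
set E := fun s => _ in iE; set e0 := ip X (f \o spin 0 tau).
have pi2 : 0 < 2 * pi :> R by rewrite mulr_gt0// pi_gt0.
have iI (c : R) : mu.-integrable setT (EFin \o (fun s => I s * c)).
  have -> : EFin \o (fun s => I s * c) = (fun s => c%:E * (I s)%:E)%E.
    by apply/funext => s; rewrite /= mulrC EFinM.
  apply: integrableZl => //; exact: integrable_indic_itv.
have II (c : R) : Rintegral mu setT (fun s => I s * c) = 2 * pi * c.
  rewrite RintegralZr//; last first.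
    by have := iI 1; under eq_fun do rewrite mulr1.
  by rewrite /Rintegral integralI.
have E0' : Rintegral mu setT (fun s => I s * ip X (f \o spin s tau)) = 0.
  by rewrite /Rintegral E0.
(* Since the integral over a period is zero, [2 * pi * e0] is the integral of [e0] minus the spun
   values, each difference being at most [B]. *)
have : 2 * pi * `|e0| <= 2 * pi * B.
  rewrite -{1}(gtr0_norm pi2) -normrM -(II e0).
  rewrite -[X in `|X|]subr0 -{1}E0' -RintegralB//.
  have iD : mu.-integrable setT (EFin \o (fun s => I s * e0 - I s * ip X (f \o spin s tau))).
    exact (integrableB measurableT (iI e0) iE).
  apply: le_trans (le_normr_Rintegral measurableT iD) _.
  rewrite -II; apply: le_Rintegral => //; first exact: (integrable_norm iD).
  move=> s _; rewrite -mulrBr normrM /I indicE.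
  case: (boolP (s \in _)) => [|_]; last by rewrite normr0 !mul0r.
  by rewrite normr1 !mul1r distrC inE/= in_itv/=; exact: HB.
by rewrite ler_pM2l.
Qed.

End mean_over_rotations.

Lemma Hm1_admissible_unit xi : Hm1_admissible xi ->
  exists X G1 G2, H1_unit X G1 G2 /\ forall x, B1 x -> X x = xi x.
Proof.
move=> [g1 [g2 [[[mxi xi2] [[mg1 g12] [[mg2 g22] wg]]] gg]]].
have patchB1 (h : R * R -> R) x : B1 x -> (h \_ B1) x = h x.
  by move=> /mem_set Bx; rewrite patchE Bx.
have eqI (h k : R * R -> R) : (forall x, B1 x -> h x = k x) ->
    (\int[leb2]_(x in B1) (h x)%:E = \int[leb2]_(x in B1) (k x)%:E)%E.
  by move=> hk; apply: eq_integral => x; rewrite inE => /hk ->.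
have L2p (h : R * R -> R) : measurable_fun B1 h ->
    (\int[leb2]_(x in B1) ((h x) ^+ 2)%:E < +oo)%E -> L2 (h \_ B1).
  move=> mh h2; split.
    exact: ((measurable_restrictT h (@measurable_B1 R)).1 mh).
  rewrite /sqnorm (eqI _ (fun x => h x ^+ 2))// => x Bx.
  by rewrite patchB1.
exists (xi \_ B1), (g1 \_ B1), (g2 \_ B1); split; last by move=> x /patchB1.
split; [exact: L2p|exact: L2p|exact: L2p| |].
- move=> phi /wg[w1 w2]; split.
    rewrite (eqI _ (fun x => xi x * 'D_(@e1 R) phi x)); last by move=> x /patchB1 ->.
    by rewrite w1; congr (- _)%E; apply: eqI => x /patchB1 ->.
  rewrite (eqI _ (fun x => xi x * 'D_(@e2 R) phi x)); last by move=> x /patchB1 ->.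
  by rewrite w2; congr (- _)%E; apply: eqI => x /patchB1 ->.
- by rewrite (eqI _ (fun x => g1 x ^+ 2 + g2 x ^+ 2))// => x Bx; rewrite !patchB1.
Qed.

Lemma Hm1_norm_le f (c : R) : L2 f ->
  (forall X G1 G2, H1_unit X G1 G2 -> ip X f <= c) -> (Hm1_norm f <= c%:E)%E.
Proof.
move=> Lf H; apply: ge_ereal_sup => _ [xi /Hm1_admissible_unit[X [G1 [G2 [XG Xxi]]]] <-].
have [LX _ _ _ _] := XG.
have -> : (\int[leb2]_(x in B1) (f x * xi x)%:E = (ip X f)%:E)%E.
  have iX := integrable_mul LX Lf.
  rewrite /ip /Rintegral fineK; last by apply: integrable_fin_num => //; exact: measurable_B1.
  by apply: eq_integral => x; rewrite inE => /Xxi ->; rewrite mulrC.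
by rewrite lee_fin; exact: H XG.
Qed.

Lemma Hm1_norm_ge0 f : (0 <= Hm1_norm f)%E.
Proof.
apply: ereal_sup_ubound; exists (fun=> 0); last first.
  by apply: integral0_eq => x _; rewrite mulr0.
exists (fun=> 0), (fun=> 0).
have int0 (h : R * R -> R) : (forall x, h x = 0) -> (\int[leb2]_(x in B1) (h x)%:E = 0)%E.
  by move=> h0; apply: integral0_eq => x _; rewrite h0.
have L0 : L2B1 (fun=> 0 : R).
  by split => //; rewrite int0// => x; rewrite expr0n.
split; last by rewrite int0// => x; rewrite expr0n addr0.
split; [exact: L0|split; [exact: L0|split; [exact: L0|]]].
by move=> phi _; split; rewrite !int0 ?oppe0// => x; rewrite mul0r.
Qed.

Lemma Hm1_norm_sol_small f (M e : R) : measurable_fun setT f ->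
  {ae leb2, forall x, `|f x| <= M} ->
  {ae mu, forall r : R, 0 < r -> circle_integral f r = 0%E} -> 0 < e ->
  exists T : R, forall t, T < t -> (Hm1_norm (sol f t) <= e%:E)%E.
Proof.
move=> mf fM f0 e0; have Lf := L2_bounded mf fM; have pi0 := pi_gt0 R.
have [|C HC] := @ip_spin_oscillation_ae_bounded R f M (e / 2) mf fM.
  by rewrite divr_gt0.
(* Beyond this time [C / tau], with [tau = 2 * pi * t], is at most [e / 2]; the other half of [e] is
   the approximation error. *)
exists (`|C| / (pi * e)) => t Ct.
have t0 : 0 < t by apply: le_lt_trans Ct; rewrite divr_ge0// mulr_ge0// ltW.
have tau0 : 0 < 2 * pi * t by rewrite !mulr_gt0.
rewrite sol_spin; apply: Hm1_norm_le; first exact: L2_spin.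
move=> X G1 G2 XG; have [LX _ _ _ _] := XG; apply: le_trans (ler_norm _) _.
apply: (ip_spin_mean_bound LX Lf f0) => s s02.
apply: le_trans (HC _ _ _ _ _ XG tau0 s02) _.
suff : C / (2 * pi * t) <= e / 2 by lra.
apply: le_trans (ler_norm _) _; rewrite normrM normfV (gtr0_norm tau0).
rewrite ler_pdivrMr//; move: Ct; rewrite ltr_pdivrMr ?mulr_gt0// => /ltW.
have -> : e / 2 * (2 * pi * t) = t * (pi * e) by field.
by [].
Qed.

End functional_mixing.

(** * Classical integration by parts and smooth test functions *)

Section integration_by_parts.
Variable R : realType.
Local Notation B1 := (@B1 R).
Local Notation leb2 := (@leb2 R).
Local Notation e1 := (@e1 R).
Local Notation e2 := (@e2 R).
Implicit Types psi phi xi f : R * R -> R.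

Lemma leb2_translation (v : R * R) (f : R * R -> \bar R) : measurable_fun setT f ->
  (\int[leb2]_x f (x.1 + v.1, x.2 + v.2)%R = \int[leb2]_x f x)%E.
Proof.
move=> mf; rewrite integralE [RHS]integralE; congr (_ - _)%E.
- rewrite -(ge0_leb2_translation v (measurable_funepos mf))//.
  by apply: eq_integral => x _; rewrite !funeposE.
- rewrite -(ge0_leb2_translation v (measurable_funeneg mf))//.
  by apply: eq_integral => x _; rewrite !funenegE.
Qed.

Lemma Ck1_derive_continuous psi (v : R * R) : Ck 1 setT psi ->
  continuous (fun x => 'D_v psi x).
Proof.
by move=> [_ /(_ v)[d _]] x; apply: differentiable_continuous; exact: d.
Qed.

Lemma derive_outside_support psi (v x : R * R) (r : R) :
  (forall x, r <= eucl x -> psi x = 0) -> r < eucl x -> 'D_v psi x = 0.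
Proof.
move=> psi0 rx; apply: (@derive_eq0 _ _ _ _ [set y | r < eucl y]) => //.
  exact: open_eucl_gt.
by move=> y /ltW; exact: psi0.
Qed.

Lemma compact_support_derive_bounded psi (v : R * R) (r : R) : Ck 1 setT psi ->
  (forall x, r <= eucl x -> psi x = 0) ->
  exists2 M, 0 < M & forall x, `|'D_v psi x| <= M.
Proof.
move=> C1 psi0; apply: (@compact_support_bounded _ _ (r + 1)).
  exact: Ck1_derive_continuous.
by move=> x rx; apply: (derive_outside_support _ psi0); lra.
Qed.

Lemma is_derive_line psi (x v : R * R) (h : R) : (forall y, differentiable psi y) ->
  is_derive h 1 (fun h => psi (x.1 + h * v.1, x.2 + h * v.2))
    ('D_v psi (x.1 + h * v.1, x.2 + h * v.2)).
Proof.
move=> dpsi.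
have d1 : differentiable (fun h : R => x.1 + h * v.1) h by [].
have d2 : differentiable (fun h : R => x.2 + h * v.2) h by [].
have D (a b : R) : 'D_1 (fun h : R => a + h * b) h = b.
  rewrite deriveD// derive_cst add0r (_ : (fun h => h * b) = (fun h => b *: h)).
    by rewrite deriveZ//= derive_id /GRing.scale/= mulr1.
  by apply/funext => y; rewrite /GRing.scale/= mulrC.
apply: DeriveDef; first by apply: diff_derivable; exact: differentiable_comp2.
by rewrite derive_comp2// !D [in RHS]derive_coord// mulrC [X in _ + X]mulrC.
Qed.

(* The integral of [psi (x + h v)] does not depend on [h]: differentiate at [h = 0]. *)
Lemma Rintegral_derive0 psi (v : R * R) (r : R) : Ck 1 setT psi ->
  (forall x, r <= eucl x -> psi x = 0) ->
  \int[leb2]_x 'D_v psi x = 0.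
Proof.
move=> C1 psi0; have dpsi x : differentiable psi x by exact: Ck_diff C1 x I.
have cpsi : continuous psi by move=> x; exact: differentiable_continuous.
have mpsi := continuous_measurable_fun2 cpsi.
have [M0 M00 psiM0] := compact_support_bounded cpsi psi0.
have [M M_gt0 psiM] := compact_support_derive_bounded v C1 psi0.
(* [Q] contains the supports of all translates with [|h| < 1], so multiples of its indicator
   dominate these translates and their derivatives. *)
pose Q := (`[- (r + `|v.1|), r + `|v.1|] `*` `[- (r + `|v.2|), r + `|v.2|])%classic
  : set (R * R)%type.
have mQ : measurable Q by apply: measurableX; exact: measurable_itv.
have Qfin : (leb2 Q < +oo)%E.
  rewrite leb2_rectangle ?lebesgue_measure_itv//=.
  by do 2!case: ifP => _; rewrite ?mul0e ?mule0 -?EFinB -?EFinM ?ltry.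
pose f h (x : R * R) := psi (x.1 + h * v.1, x.2 + h * v.2).
have fd (h : R) x : is_derive h 1 (f ^~ x) ('D_v psi (x.1 + h * v.1, x.2 + h * v.2)).
  exact: is_derive_line.
have inQ h (x : R * R) : (`]-1, 1[%classic : set R) h ->
    eucl (x.1 + h * v.1, x.2 + h * v.2) <= r -> Q x.
  rewrite /= in_itv/= -ltr_norml => h1 xr; rewrite /Q.
  have B (a b : R) : `|a + h * b| <= r -> - (r + `|b|) <= a <= r + `|b|.
    rewrite -ler_norml => H.
    have -> : a = (a + h * b) - h * b by ring.
    apply: le_trans (ler_normB _ _) _; rewrite lerD// normrM ler_piMl// ltW//.
  split; rewrite /= in_itv/=.
  - by apply: B; apply: le_trans xr; exact: (normr1_le_eucl (_, _)).
  - by apply: B; apply: le_trans xr; exact: (normr2_le_eucl (_, _)).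
have iQ (c : R) : leb2.-integrable setT (EFin \o (fun x => c * \1_Q x)).
  have -> : EFin \o (fun x => c * \1_Q x) = (fun x => c%:E * (\1_Q x)%:E)%E by [].
  apply: integrableZl => //; apply/integrableP; split.
    by apply/measurable_EFinP; exact: measurable_indic.
  under eq_integral do rewrite gee0_abs ?lee_fin ?indicE// -indicE.
  by rewrite integral_indic// setIT.
have mf h : measurable_fun setT (f h).
  apply: measurableT_comp mpsi _.
  by apply: measurable_fun_pair; exact: measurable_funD.
have intf h : (`]-1, 1[%classic : set R) h -> leb2.-integrable setT (EFin \o f h).
  move=> h1; apply: (le_integrable _ _ _ (iQ M0)) => //; first exact/measurable_EFinP.
  move=> x _ /=; rewrite lee_fin; have [xr|xr] := leP (eucl (x.1 + h * v.1, x.2 + h * v.2)) r.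
    by rewrite indicE mem_set ?mulr1; [rewrite (gtr0_norm M00); exact: psiM0|exact: inQ xr].
  by rewrite /f psi0 ?normr0// ltW.
have h0 : (`]-1, 1[%classic : set R) 0 by rewrite /= in_itv/=; lra.
have df h x : (`]-1, 1[%classic : set R) h -> [set: R * R] x -> derivable (f ^~ x) h 1.
  by move=> _ _; exact: ex_derive.
have G0 x : 0 <= M * \1_Q x by rewrite mulr_ge0 ?(ltW M_gt0)// indicE.
have Gub h x : (`]-1, 1[%classic : set R) h -> [set: R * R] x ->
    `|partial1of2 f h x| <= M * \1_Q x.
  move=> h1 _; rewrite partial1of2E derive_val.
  have [xr|xr] := leP (eucl (x.1 + h * v.1, x.2 + h * v.2)) r.
    by rewrite indicE mem_set ?mulr1; [exact: psiM|exact: inQ xr].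
  by rewrite (derive_outside_support _ psi0 xr) normr0.
have := differentiation_under_integral (mu := leb2) measurableT h0 intf df G0 (iQ M) Gub.
have -> : (fun h => \int[leb2]_x f h x) = cst (\int[leb2]_x psi x).
  apply/funext => h; rewrite /Rintegral; congr fine.
  rewrite -[RHS](leb2_translation (h * v.1, h * v.2))//.
  exact/measurable_EFinP.
rewrite derive1_cst => ->; apply: eq_Rintegral => x _.
by rewrite partial1of2E derive_val !mul0r !addr0 -surjective_pairing.
Qed.

Lemma L2_bounded_everywhere f (M : R) : measurable_fun setT f ->
  (forall x, `|f x| <= M) -> L2 f.
Proof. by move=> mf fM; apply: (@L2_bounded _ _ M) => //; exact: aeW. Qed.

(** The derivative of [xi phi], which is compactly supported inside the disk, has integral zero. *)
Lemma ip_by_parts xi phi (v : R * R) (M K : R) : (forall k, Ck k setT xi) ->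
  (forall x, `|xi x| <= M) -> (forall x, `|'D_v xi x| <= K) -> test_fun phi ->
  [/\ L2 xi, L2 (fun x => 'D_v xi x), L2 phi, L2 (fun x => 'D_v phi x) &
      ip xi (fun x => 'D_v phi x) = - ip (fun x => 'D_v xi x) phi].
Proof.
move=> Cxi xiM dxiK [sphi [r [r1 phi0]]]; have Cphi := smooth_Ck sphi.
have mC psi : (forall k, Ck k setT psi) -> measurable_fun setT psi.
  move=> Cpsi; apply: continuous_measurable_fun2 => x.
  by apply: differentiable_continuous; exact: (Ck_diff (Cpsi 0) I).
have mD psi : (forall k, Ck k setT psi) -> measurable_fun setT (fun x => 'D_v psi x).
  by move=> Cpsi; apply: continuous_measurable_fun2; exact: Ck1_derive_continuous (Cpsi 1).
have cphi : continuous phi.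
  by move=> x; apply: differentiable_continuous; exact: (Ck_diff (Cphi 0) I).
have [Mp _ phiM] := compact_support_bounded cphi phi0.
have [Md _ dphiM] := compact_support_derive_bounded v (Cphi 1) phi0.
have L1 := L2_bounded_everywhere (mC _ Cxi) xiM.
have L2' := L2_bounded_everywhere (mD _ Cxi) dxiK.
have L3 := L2_bounded_everywhere (mC _ Cphi) phiM.
have L4 := L2_bounded_everywhere (mD _ Cphi) dphiM.
split; [exact: L1|exact: L2'|exact: L3|exact: L4|].
apply/eqP; rewrite -addr_eq0; apply/eqP.
rewrite /ip -RintegralD; last 3 first.
- exact: measurable_B1.
- exact: integrable_mul L1 L4.
- exact: integrable_mul L2' L3.
have Cxp : Ck 1 setT (fun x => xi x * phi x) by apply: CkM => //; exact: openT.
have xp0 x : r <= eucl x -> xi x * phi x = 0 by move=> /phi0 ->; rewrite mulr0.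
rewrite -[RHS](Rintegral_derive0 v Cxp xp0) /Rintegral integral_mkcond.
congr fine; apply: eq_integral => x _; rewrite patchE.
have D : 'D_v (fun x => xi x * phi x) x = xi x * 'D_v phi x + 'D_v xi x * phi x.
  rewrite deriveM; [|apply: diff_derivable; exact: (Ck_diff (Cxi 0) I)
    |apply: diff_derivable; exact: (Ck_diff (Cphi 0) I)].
  by rewrite /GRing.scale/= [X in _ + X]mulrC.
case: ifPn => [_|]; first by rewrite D.
rewrite notin_setE B1E => /negP; rewrite -leNgt => x1.
by rewrite (derive_outside_support v xp0)//; exact: lt_le_trans x1.
Qed.

(** With [c = 1 + 2 K^2 |B1|], the gradient of [xi / c] has squared norm at most
    [(c - 1) / c^2 <= 1], so [xi / c] and its opposite are admissible. The constant depends on [xi]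
    only through [K], hence is uniform over translates. *)
Lemma Hm1_norm_ip f xi (M K e : R) : L2 f -> (forall k, Ck k setT xi) ->
  (forall x, `|xi x| <= M) ->
  (forall x, `|'D_e1 xi x| <= K) -> (forall x, `|'D_e2 xi x| <= K) ->
  (Hm1_norm f <= e%:E)%E ->
  `|ip xi f| <= (1 + 2 * K ^+ 2 * fine (leb2 B1)) * e.
Proof.
move=> Lf Cxi xiM K1 K2 fe; set c := 1 + _.
have B1fin : leb2 B1 \is a fin_num by rewrite ge0_fin_numE// leb2_B1_lty.
have A0 : 0 <= fine (leb2 B1) by rewrite fine_ge0.
have c1 : 1 <= c by rewrite lerDl mulr_ge0// mulr_ge0// sqr_ge0.
have c0 : 0 < c by exact: lt_le_trans c1.
(* The zero test function serves to extract from [ip_by_parts] the square integrability of [xi] and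
   its derivatives. *)
have t0 : test_fun (fun=> 0 : R) by apply: annular_test_fun; exact: annular0.
have [Lxi L1 _ _ _] := ip_by_parts Cxi xiM K1 t0.
have [_ L2' _ _ _] := ip_by_parts Cxi xiM K2 t0.
have adm (a : R) : `|a| <= c^-1 -> Hm1_admissible (fun x => a * xi x).
  move=> ac; exists (fun x => a * 'D_e1 xi x), (fun x => a * 'D_e2 xi x).
  have LB (h : R * R -> R) : L2 h -> L2B1 (fun x => a * h x).
    by move=> Lh; have [mh h2] := L2Z a Lh; split => //; exact: measurable_funTS.
  have wg v (D : R) : (forall x, `|'D_v xi x| <= D) -> L2 (fun x => 'D_v xi x) ->
      forall phi, test_fun phi ->
      (\int[leb2]_(x in B1) (a * xi x * 'D_v phi x)%:E =
       - \int[leb2]_(x in B1) (a * 'D_v xi x * phi x)%:E)%E.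
    move=> vD Lv phi tphi; have [_ _ L3 L4 E] := ip_by_parts Cxi xiM vD tphi.
    have i1 := integrable_mul (L2Z a Lxi) L4; have i2 := integrable_mul (L2Z a Lv) L3.
    have mB := @measurable_B1 R.
    rewrite -(fineK (integrable_fin_num mB i1)) -(fineK (integrable_fin_num mB i2)).
    rewrite -EFinN; congr EFin.
    transitivity (a * ip xi (fun x => 'D_v phi x)).
      by rewrite ipC -ipZr// ipC.
    by rewrite E mulrN; congr (- _); rewrite ipC -ipZr// ipC.
  split; first by do 3!(split; first exact: LB); split; [exact: (wg _ K)|exact: (wg _ K)].
  have i1 : c^-1 <= 1 by rewrite invf_le1.
  have i0 : 0 < c^-1 by rewrite invr_gt0.
  apply: (@le_trans _ _ (\int[leb2]_(x in B1) (cst (2 * K ^+ 2 * (c^-1 * c^-1))%:E x)))%E;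
      last first.
    rewrite integral_cst; last exact: measurable_B1.
    rewrite -[X in (_ * X)%E](fineK B1fin) -EFinM lee_fin.
    have -> : 2 * K ^+ 2 * (c^-1 * c^-1) * fine (leb2 B1) = c * c^-1 * c^-1 - c^-1 * c^-1.
      by rewrite /c; ring.
    by rewrite divff ?gt_eqF// mul1r; nra.
  apply: ge0_le_integral => //.
  - exact: measurable_B1.
  - by move=> x _; rewrite lee_fin addr_ge0 ?sqr_ge0.
  - have [m1 _] := L2Z a L1; have [m2 _] := L2Z a L2'.
    apply: measurable_funTS; apply/measurable_EFinP.
    exact: measurable_funD (measurable_funX 2 m1) (measurable_funX 2 m2).
  - move=> x _; rewrite lee_fin.
    have sq (u : R) : `|u| <= K -> (a * u) ^+ 2 <= K ^+ 2 * (c^-1 * c^-1).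
      move=> uK; rewrite exprMn -(real_normK (num_real u)) -(real_normK (num_real a)).
      by rewrite mulrC !expr2; apply: ler_pM; rewrite ?mulr_ge0//; apply: ler_pM.
    have := sq _ (K1 x); have := sq _ (K2 x); lra.
have bound (a : R) : `|a| <= c^-1 -> a * ip xi f <= e.
  move=> ac; rewrite -lee_fin; apply: le_trans fe; apply: ereal_sup_ubound.
  exists (fun x => a * xi x); first exact: adm.
  rewrite ipC -ipZr// /ip /Rintegral fineK//.
  by apply: integrable_fin_num; [exact: measurable_B1|exact: integrable_mul Lf (L2Z a Lxi)].
have ci : `|c^-1| <= c^-1 by rewrite normfV gtr0_norm.
have b1 := bound _ ci; have := bound (- c^-1); rewrite normrN => /(_ ci) b2.
have i0 : 0 < c^-1 by rewrite invr_gt0.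
rewrite -ler_pdivrMl// -[X in X * _](gtr0_norm i0) -normrM ler_norml b1 andbT.
by rewrite lerNl -mulNr.
Qed.

End integration_by_parts.

(** * Averages over disks through smooth cutoffs *)

Section geometric_mixing.
Variable R : realType.
Local Notation mu := (@lebesgue_measure R).
Local Notation B1 := (@B1 R).
Local Notation leb2 := (@leb2 R).
Local Notation e1 := (@e1 R).
Local Notation e2 := (@e2 R).
Implicit Types f : R * R -> R.

(** A smooth approximation from below of the indicator of [disk x eps], sharper as [n] grows. *)
Definition cutoff (eps : R) (n : nat) (x y : R * R) : R :=
  flat (n.+1%:R * (eps ^+ 2 - ((y.1 - x.1) ^+ 2 + (y.2 - x.2) ^+ 2))).

Lemma cutoff_shift (eps : R) (n : nat) (x y : R * R) :
  cutoff eps n x y = cutoff eps n (0, 0) (y.1 - x.1, y.2 - x.2).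
Proof. by rewrite /cutoff /= !subr0. Qed.

Lemma Ck_cutoff (eps : R) (n : nat) (x : R * R) (k : nat) : Ck k setT (cutoff eps n x).
Proof.
apply: (@Ck_comp1 _ _ _ _ setT (@flat R)) => //; [exact: openT|exact: Ck_flat|].
have C1 : Ck k setT (fun y : R * R => y.1 - x.1).
  by apply: CkB; [exact: openT|apply: Ck_fst; exact: openT|apply: Ck_cst; exact: openT].
have C2 : Ck k setT (fun y : R * R => y.2 - x.2).
  by apply: CkB; [exact: openT|apply: Ck_snd; exact: openT|apply: Ck_cst; exact: openT].
apply: CkM; [exact: openT|apply: Ck_cst; exact: openT|].
apply: CkB; [exact: openT|apply: Ck_cst; exact: openT|].
by apply: CkD; [exact: openT|apply: CkM => //; exact: openT|apply: CkM => //; exact: openT].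
Qed.

Lemma normr_cutoff (eps : R) (n : nat) (x y : R * R) : `|cutoff eps n x y| <= 1.
Proof. by rewrite ger0_norm ?flat_ge0// flat_le1. Qed.

Lemma cutoff_outside (eps : R) (n : nat) (y : R * R) : 0 < eps -> eps <= eucl y ->
  cutoff eps n (0, 0) y = 0.
Proof.
move=> eps0 ey; apply: flat_le0; rewrite /= !subr0 pmulr_rle0// subr_le0 -sqr_eucl.
by rewrite lerXn2r ?nnegrE ?eucl_ge0// ltW.
Qed.

Lemma derive_cutoff (eps : R) (n : nat) (v x y : R * R) :
  'D_v (cutoff eps n x) y = 'D_v (cutoff eps n (0, 0)) (y.1 - x.1, y.2 - x.2).
Proof.
have -> : cutoff eps n x = (fun y => cutoff eps n (0, 0) (y.1 - x.1, y.2 - x.2)).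
  by apply/funext => z; rewrite cutoff_shift.
have dB (u : R * R -> R) (c : R) : differentiable u y ->
    differentiable (fun y => u y - c) y by move=> ?; exact: differentiableB.
have DB (u : R * R -> R) (c : R) : differentiable u y ->
    'D_v (fun y => u y - c) y = 'D_v u y.
  move=> du; rewrite deriveB ?derive_cst ?subr0//; exact: diff_derivable.
have df := differentiable_fst y; have ds := differentiable_snd y.
have dc := Ck_diff (Ck_cutoff eps n (0, 0) 0).
rewrite derive_comp2; [|exact: (dB _ _ df)|exact: (dB _ _ ds)|exact: dc].
rewrite (DB _ _ df) (DB _ _ ds) derive_fst derive_snd [in RHS]derive_coord; last exact: dc.
by rewrite /e1 /e2; congr (_ + _); rewrite mulrC.
Qed.

Lemma derive_cutoff_bounded (eps : R) (n : nat) : 0 < eps ->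
  exists K : R, forall x y, `|'D_e1 (cutoff eps n x) y| <= K /\ `|'D_e2 (cutoff eps n x) y| <= K.
Proof.
move=> eps0; have C1 := Ck_cutoff eps n (0, 0) 1.
have c0 y := @cutoff_outside eps n y eps0.
have [K1 _ H1] := compact_support_derive_bounded e1 C1 c0.
have [K2 _ H2] := compact_support_derive_bounded e2 C1 c0.
exists (Num.max K1 K2) => x y.
rewrite (derive_cutoff _ _ e1 x) (derive_cutoff _ _ e2 x).
split; rewrite le_max; apply/orP; first by left; exact: H1.
by right; exact: H2.
Qed.

Lemma diskE (x y : R * R) (eps : R) : 0 < eps ->
  disk x eps y = (0 < eps ^+ 2 - ((y.1 - x.1) ^+ 2 + (y.2 - x.2) ^+ 2)) :> Prop.
Proof.
move=> eps0; rewrite /disk /= subr_gt0.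
have := sqr_eucl (y.1 - x.1, y.2 - x.2) => /= <-.
by rewrite ltr_pXn2r// ?nnegrE ?eucl_ge0 ?(ltW eps0).
Qed.

Definition cutoff_error (eps : R) (n : nat) (x y : R * R) : R :=
  \1_(disk x eps) y - cutoff eps n x y.

Lemma measurable_cutoff_error (eps : R) (n : nat) (x : R * R) :
  measurable_fun setT (cutoff_error eps n x).
Proof.
apply: measurable_funB; first by apply: measurable_indic; exact: measurable_disk.
apply: continuous_measurable_fun2 => y; apply: differentiable_continuous.
exact: (Ck_diff (Ck_cutoff eps n x 0) I).
Qed.

Lemma normr_cutoff_error (eps : R) (n : nat) (x y : R * R) : `|cutoff_error eps n x y| <= 1.
Proof.
rewrite /cutoff_error /cutoff indicE; set z := n.+1%:R * _.
have := flat_ge0 z; have := flat_le1 z.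
by case: (_ \in _); rewrite ler_norml /=; lra.
Qed.

(** Enlarging the domain from the unit disk to the plane makes the error translation invariant,
    which removes the centre [x] from the bound. *)
Lemma sqnorm_cutoff_error (eps : R) (n : nat) (x : R * R) : 0 < eps ->
  (sqnorm (cutoff_error eps n x) <=
   \int[leb2]_(y in disk (0%R, 0%R) eps) ((cutoff_error eps n (0%R, 0%R) y) ^+ 2)%:E)%E.
Proof.
move=> eps0.
have m := measurable_sqr (@measurable_cutoff_error eps n (0, 0)).
have mx := measurable_sqr (@measurable_cutoff_error eps n x).
apply: (@le_trans _ _ (\int[leb2]_y ((cutoff_error eps n x y) ^+ 2)%:E)%E).
  apply: ge0_subset_integral => //; first exact: measurable_B1.
  by move=> y _; rewrite lee_fin sqr_ge0.
rewrite [leRHS]integral_mkcond le_eqVlt; apply/orP; left; apply/eqP.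
transitivity (\int[leb2]_y ((cutoff_error eps n (0%R, 0%R) y) ^+ 2)%:E)%E.
  rewrite -(ge0_leb2_translation (- x.1, - x.2) m); last first.
    by move=> y; rewrite lee_fin sqr_ge0.
  apply: eq_integral => y _; congr ((_ ^+ 2)%:E); rewrite /cutoff_error cutoff_shift.
  by rewrite !indicE; congr ((_ : bool)%:R - _); apply/idP/idP;
    rewrite !inE /disk /= !subr0.
apply: eq_integral => y _; rewrite patchE; case: ifPn => // /negP.
rewrite inE /cutoff_error => yd; rewrite indicE memNset// cutoff_outside ?subrr ?expr0n//.
rewrite leNgt; apply/negP => ye; apply: yd.
by rewrite /disk /= !subr0 -surjective_pairing.
Qed.

Lemma cutoff_error_small (eps d : R) : 0 < eps -> 0 < d ->
  exists n, forall x, (sqnorm (cutoff_error eps n x) <= d%:E)%E.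
Proof.
move=> eps0 d0; pose h n y := ((cutoff_error eps n (0, 0) y) ^+ 2)%:E.
have mD := measurable_disk ((0, 0) : R * R) eps.
have mh n : measurable_fun (disk (0, 0) eps) (h n).
  by apply: measurable_funTS; apply: measurable_sqr; exact: measurable_cutoff_error.
have [||||_ _ cvg0] := @dominated_convergence _ _ _ leb2 (disk (0, 0) eps) mD h
    (cst 0%E) (cst 1%E) mh.
- exact: measurable_cst.
- apply: aeW => y; rewrite diskE// => yz.
  apply: cvg_EFin; first exact: nearW.
  have -> : 0 = (1 - 1) ^+ 2 :> R by rewrite subrr expr0n.
  have cy : cutoff_error eps n (0, 0) y @[n --> \oo] --> (1 - 1 : R).
    rewrite /cutoff_error; apply: cvgB.
      by rewrite indicE mem_set ?diskE//; exact: cvg_cst.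
    by have := @cvg_flat R _ => /(_ (eps ^+ 2 - ((y.1 - 0) ^+ 2 + (y.2 - 0) ^+ 2)));
      rewrite yz; apply.
  exact: cvgM.
- apply: measurable_bounded_integrable => //.
  + exact: leb2_disk_lty.
  + exact: bounded_cst.
- apply: aeW => y n _; rewrite /h/= lee_fin ger0_norm ?sqr_ge0//.
  rewrite -(real_normK (num_real _)) exprn_ile1//; exact: normr_cutoff_error.
move: cvg0; rewrite integral0 => /fine_cvgP[finh /cvgr_lt/(_ _ d0) smallh].
near \oo => n; exists n => x; apply: le_trans (sqnorm_cutoff_error n x eps0) _.
have fin : (\int[leb2]_(y in disk (0%R, 0%R) eps) h n y)%E \is a fin_num by near: n.
by rewrite -/(h n) -[leLHS](fineK fin) lee_fin ltW//; near: n.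
Unshelve. all: by end_near. Qed.

Section initial_datum.
Variables (f : R * R -> R) (M : R).
Hypothesis mf : measurable_fun setT f.
Hypothesis fM : {ae leb2, forall x, `|f x| <= M}.
Hypothesis f_out : {ae leb2, forall x, 1 < eucl x -> f x = 0}.
Hypothesis f0 : {ae mu, forall r : R, 0 < r -> circle_integral f r = 0%E}.

(** The datum vanishes almost everywhere outside the closed disk; the unit circle itself is null, so
    the inequality may be taken large. *)
Lemma sol_outside (t : R) : {ae leb2, forall x, 1 <= eucl x -> sol f t x = 0}.
Proof.
have ae1 : {ae leb2, forall x, eucl x != 1}.
  apply: (@ae_radial _ (fun r => r != 1)).
  exists [set 1]; split => //; first exact: lebesgue_measure_set1.
  by move=> r /= /negP; rewrite negbK => /eqP.
have := ae_spin 0 (2 * pi * t) f_out; case: ae1 => N [mN N0 hN] [N' [mN' N'0 hN']].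
exists (N `|` N'); split; first exact: measurableU.
  by rewrite measureU0.
move=> x /= H; apply: contrapT => /not_orP[Nx N'x]; apply: H => x1.
rewrite sol_spin; apply: contrapT => fx; apply: N'x; apply: hN' => /= H.
apply: fx; apply: H; rewrite eucl_spin lt_neqAle x1 andbT eq_sym.
by apply: contrapT => x1'; apply: Nx; apply: hN.
Qed.

Lemma measurable_sol (t : R) : measurable_fun setT (sol f t).
Proof. by rewrite sol_spin; exact: measurableT_comp mf (measurable_spin _ _). Qed.

(** The disk may leave the unit disk, but the solution vanishes there almost everywhere, so only the
    part inside contributes. *)
Lemma Rintegral_disk_sol (t eps : R) (x : R * R) :
  Rintegral leb2 (disk x eps) (sol f t) = ip (\1_(disk x eps)) (sol f t).
Proof.
have ms := measurable_sol t; have mD := measurable_disk x eps.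
have mB := @measurable_B1 R.
rewrite /ip /Rintegral; congr fine; rewrite integral_mkcond [RHS]integral_mkcond.
have ms' : measurable_fun setT (EFin \o sol f t) by apply/measurable_EFinP.
apply: ae_eq_integral => //.
- by apply: (measurable_restrictT _ mD).1; apply: measurable_funTS; exact: ms'.
- apply: (measurable_restrictT _ mB).1; apply: measurable_funTS; apply/measurable_EFinP.
  by apply: measurable_funM => //; exact: measurable_indic.
have [N [mN N0 hN]] := sol_outside t; exists N; split => // y /=.
apply: contra_notP => Ny _; have {}Ny : 1 <= eucl y -> sol f t y = 0.
  by apply: contrapT => H; apply: Ny; exact: hN.
rewrite !patchE indicE; case: (y \in disk x eps) => /=; last first.
  by rewrite mul0r; case: ifP.
rewrite mul1r; case: ifPn => // /negP; rewrite inE B1E => /negP; rewrite -leNgt.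
by move=> /Ny ->.
Qed.

Lemma disk_integral_small (eps c : R) : 0 < eps -> 0 < c ->
  exists T : R, forall t, T < t -> forall x,
    `|Rintegral leb2 (disk x eps) (sol f t)| <= c.
Proof.
move=> eps0 c0; have Lf := L2_bounded mf fM.
(* With this [d] the cutoff error contributes at most [d * nrm f <= c / 2]; the [1] covers
   [nrm f = 0]. The smooth part gets the other [c / 2] from the H^-1 level [c / (2 * C)]. *)
pose d := c / (2 * (nrm f + 1)).
have nf0 : 0 < nrm f + 1 by rewrite ltr_wpDl// nrm_ge0.
have d0 : 0 < d by rewrite divr_gt0// mulr_gt0.
have [|n err] := @cutoff_error_small eps (d ^+ 2) eps0; first by rewrite exprn_gt0.
have [K HK] := @derive_cutoff_bounded eps n eps0.
pose C := 1 + 2 * K ^+ 2 * fine (leb2 B1).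
have C0 : 0 < C.
  by rewrite ltr_pwDl// mulr_ge0 ?fine_ge0// mulr_ge0// sqr_ge0.
have [|T HT] := @Hm1_norm_sol_small R f M (c / (2 * C)) mf fM f0.
  by rewrite divr_gt0// mulr_gt0.
exists T => t /HT small x.
have Ls : L2 (sol f t) by rewrite sol_spin; exact: L2_spin.
have ns : nrm (sol f t) = nrm f by rewrite sol_spin nrm_spin.
have Le : L2 (cutoff_error eps n x).
  exact: L2_bounded_everywhere (@measurable_cutoff_error eps n x) (normr_cutoff_error eps n x).
have Lc : L2 (cutoff eps n x).
  apply: (L2_bounded_everywhere _ (normr_cutoff eps n x)).
  apply: continuous_measurable_fun2 => y; apply: differentiable_continuous.
  exact: (Ck_diff (Ck_cutoff eps n x 0) I).
rewrite Rintegral_disk_sol.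
have -> : \1_(disk x eps) = (fun y => cutoff eps n x y + cutoff_error eps n x y).
  by apply/funext => y; rewrite /cutoff_error addrC subrK.
rewrite ipDl//; apply: le_trans (ler_normD _ _) _.
have H1 := Hm1_norm_ip Ls (Ck_cutoff eps n x) (normr_cutoff eps n x)
  (fun y => (HK x y).1) (fun y => (HK x y).2) small.
have H2 := ip_le Le Ls; rewrite ns in H2.
have H3 : nrm (cutoff_error eps n x) <= d by apply: nrm_le => //; exact: ltW.
have H4 : nrm (cutoff_error eps n x) * nrm f <= c / 2.
  apply: (@le_trans _ _ (d * (nrm f + 1))).
    by apply: ler_pM; rewrite ?nrm_ge0// lerDl.
  by rewrite /d le_eqVlt; apply/orP; left; apply/eqP; field; rewrite gt_eqF.
have H5 : C * (c / (2 * C)) = c / 2 by field; rewrite gt_eqF.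
rewrite -/C H5 in H1; lra.
Qed.

End initial_datum.

End geometric_mixing.

(** * Convergence of both mixing scales *)

Section mixing_scales.
Variable R : realType.
Local Notation mu := (@lebesgue_measure R).
Local Notation B1 := (@B1 R).
Local Notation leb2 := (@leb2 R).
Implicit Types f : R * R -> R.

Lemma spinK (tau : R) (x : R * R) : spin 0 tau (spin 0 (- tau) x) = x.
Proof.
rewrite -[LHS]/(Defs.rot (0 + tau * eucl (spin 0 (- tau) x)) (spin 0 (- tau) x)).
rewrite eucl_spin rot_spin /spin !add0r addr0 mulNr subrr.
by rewrite /Defs.rot cos0 sin0 !mulr1 !mulr0 subr0 add0r -surjective_pairing.
Qed.

(** The spin and its inverse both preserve null sets and the disk, so the two functions have the
    same essential bounds. *)
Lemma LinfB1_sol f (t : R) : LinfB1 (sol f t) = LinfB1 f.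
Proof.
rewrite /LinfB1; congr ereal_inf; apply/seteqP; split => M /= H.
  have := ae_spin 0 (- (2 * pi * t)) H; case=> N [mN N0 hN]; exists N; split => // x /=.
  move=> Hx; apply: hN => /= K; apply: Hx => Bx; move: K.
  by rewrite sol_spin B1_spin /= spinK; exact.
have := ae_spin 0 (2 * pi * t) H; case=> N [mN N0 hN]; exists N; split => // x /=.
move=> Hx; apply: hN => /= K; apply: Hx => Bx; move: K.
by rewrite sol_spin B1_spin /=; exact.
Qed.

Lemma leb2_B1_gt0 : (0 < leb2 B1)%E.
Proof.
pose Q := (`[0, 2^-1] `*` `[0, 2^-1])%classic : set (R * R)%type.
have mQ : measurable Q by apply: measurableX; exact: measurable_itv.
apply: (@lt_le_trans _ _ (leb2 Q)).
  rewrite leb2_rectangle// lebesgue_measure_itv/= lte_fin invr_gt0 ltr0n/=.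
  by rewrite -EFinB subr0 -EFinM lte_fin mulr_gt0.
apply: le_measure; rewrite ?inE//; first exact: measurable_B1.
move=> x [/=]; rewrite !in_itv/= => x1 x2; rewrite B1E.
rewrite -(ltr_pXn2r (n := 2))// ?nnegrE ?eucl_ge0// sqr_eucl; nra.
Qed.

(** A negative essential bound would fail at every point of [B1], which has positive measure. *)
Lemma LinfB1_ge0 f : (0 <= LinfB1 f)%E.
Proof.
apply: le_ereal_inf_tmp => M /= [N [mN N0 hN]]; rewrite leNgt; apply/negP => M0.
have : (leb2 B1 <= leb2 N)%E.
  apply: le_measure; rewrite ?inE//; first exact: measurable_B1.
  move=> x Bx; apply: hN => /= /(_ Bx) xM.
  by have := le_lt_trans xM M0; rewrite lte_fin ltNge normr_ge0.
by rewrite N0 leNgt leb2_B1_gt0.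
Qed.

Lemma LinfB1_le f (M : R) : {ae leb2, forall x, `|f x| <= M} -> (LinfB1 f <= M%:E)%E.
Proof.
case=> N [mN N0 hN]; apply: ereal_inf_lbound; exists N; split => // x /= H.
by apply: hN => /= xM; apply: H => _; rewrite lee_fin.
Qed.

Lemma nrm_LinfB1_eq0 f : measurable_fun setT f -> LinfB1 f = 0%E -> nrm f = 0.
Proof.
move=> mf L0.
have small n : {ae leb2, forall x, B1 x -> `|f x| <= n.+1%:R^-1}.
  have : (LinfB1 f < (n.+1%:R^-1)%:E)%E by rewrite L0 lte_fin invr_gt0.
  move=> /ereal_inf_lt[M [N [mN N0 hN]] Mn]; exists N; split => // x /= H.
  apply: hN => /= K; apply: H => Bx; rewrite -lee_fin.
  exact: le_trans (K Bx) (ltW Mn).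
have [N [mN N0 hN]] := ae_foralln small.
rewrite /nrm (_ : sqnorm f = 0%E) ?sqrtr0//.
rewrite /sqnorm -[RHS](integral0 leb2 B1); apply: ae_eq_integral => //.
- exact: measurable_B1.
- exact: measurable_sqr_B1.
- exists N; split => // x /= H; apply: hN => /= K; apply: H => Bx.
  suff -> : f x = 0 by rewrite expr0n.
  apply/eqP; rewrite -normr_le0; apply/ler_addgt0Pr => e e0; rewrite add0r.
  have [n ne] : exists n : nat, n.+1%:R^-1 < e.
    exists (Num.truncn e^-1); rewrite -[ltRHS]invrK ltf_pV2 ?posrE ?invr_gt0//.
    exact: truncnS_gt.
  exact: le_trans (K n Bx) (ltW ne).
Qed.

Lemma leb2_disk_translation (x : R * R) (eps : R) : leb2 (disk x eps) = leb2 (disk (0, 0) eps).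
Proof.
have I y := integral_indic leb2 measurableT (measurable_disk y eps).
have mI : measurable_fun setT (EFin \o (\1_(disk (0, 0) eps) : R * R -> R)).
  by apply/measurable_EFinP; apply: measurable_indic; exact: measurable_disk.
have := I (0, 0); have := I x; rewrite !setIT => <- <-.
rewrite -(ge0_leb2_translation (- x.1, - x.2) mI); last by move=> y; rewrite lee_fin indicE.
apply: eq_integral => y _; rewrite /= !indicE; congr ((_ : bool)%:R%:E).
by apply/idP/idP; rewrite !inE /disk /= !subr0.
Qed.

(** [integral_product_display] reconciles the two displays under which [leb2] is integrated;
    normalising by the disk at the origin makes later thresholds independent of [x]. *)
Lemma disk_avgE f (x : R * R) (eps : R) : measurable_fun setT f ->
  disk_avg f x eps =
  Rintegral leb2 (disk x eps) f / fine (leb2 (disk (0, 0) eps)).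
Proof.
move=> mf; rewrite -(leb2_disk_translation x) /disk_avg; congr (_ / _).
rewrite /Rintegral; congr fine.
rewrite integral_mkcond [RHS]integral_mkcond; apply: integral_product_display.
apply: (measurable_restrictT _ (measurable_disk x eps)).1; apply: measurable_funTS.
exact/measurable_EFinP.
Qed.

Lemma geom_mix_bound (kappa eps : R) f : 0 < eps ->
  (forall x, ((`|disk_avg f x eps|)%:E <= kappa%:E * LinfB1 f)%E) ->
  0 <= geom_mix kappa f <= eps.
Proof.
move=> eps0 H; apply/andP; split.
  by apply: lb_le_inf; [exists eps|move=> r [/ltW]].
by apply: ge_inf; [exists 0 => r [/ltW]|split].
Qed.

Section initial_datum.
Variables (f : R * R -> R) (M : R).
Hypothesis mf : measurable_fun setT f.
Hypothesis fM : {ae leb2, forall x, `|f x| <= M}.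
Hypothesis f_out : {ae leb2, forall x, 1 < eucl x -> f x = 0}.
Hypothesis f0 : {ae mu, forall r : R, 0 < r -> circle_integral f r = 0%E}.

Lemma geom_mix_sol_small (kappa eps : R) : 0 < kappa -> 0 < eps ->
  exists T : R, forall t, T < t -> 0 <= geom_mix kappa (sol f t) <= eps.
Proof.
move=> kappa0 eps0; have Lf := L2_bounded mf fM.
have Lfin : LinfB1 f \is a fin_num.
  by rewrite ge0_fin_numE ?LinfB1_ge0//; exact: le_lt_trans (LinfB1_le fM) (ltry _).
(* Here the allowed average is exactly zero and decay would not suffice; but [f] is then null in L^2
   of the disk, and all averages vanish. *)
have [L0|L0] := eqVneq (LinfB1 f) 0%E.
  exists 0 => t _; apply: geom_mix_bound => // x; rewrite LinfB1_sol L0 mule0 lee_fin.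
  rewrite (disk_avgE _ _ (measurable_sol mf t)) (Rintegral_disk_sol mf f_out).
  have LI : L2 (\1_(disk x eps) : R * R -> R).
    apply: (@L2_bounded_everywhere _ _ 1).
      by apply: measurable_indic; exact: measurable_disk.
    by move=> y; rewrite indicE; case: (_ \in _); rewrite ?normr1 ?normr0.
  have Ls : L2 (sol f t) by rewrite sol_spin; exact: L2_spin.
  have := ip_le LI Ls; rewrite [in nrm (sol f t)]sol_spin nrm_spin//.
  rewrite (nrm_LinfB1_eq0 mf L0) mulr0 normr_le0 => /eqP ->.
  by rewrite mul0r normr0.
set l := fine (LinfB1 f); set A := fine (leb2 (disk (0, 0) eps)).
have l0 : 0 < l by rewrite fine_gt0// lt_neqAle eq_sym L0 LinfB1_ge0 -ge0_fin_numE ?LinfB1_ge0.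
(* Division by zero gives zero, so this case holds without computing the area of a disk. *)
have [A0|A0] := eqVneq A 0.
  exists 0 => t _; apply: geom_mix_bound => // x.
  rewrite (disk_avgE _ _ (measurable_sol mf t)) -/A A0 invr0 mulr0 normr0.
  by rewrite mule_ge0 ?LinfB1_ge0// lee_fin ltW.
have {}A0 : 0 < A by rewrite lt_neqAle eq_sym A0 fine_ge0.
have [|T HT] := disk_integral_small mf fM f_out f0 (c := kappa * l * A) eps0.
  by rewrite !mulr_gt0.
exists T => t /HT small; apply: geom_mix_bound => // x.
rewrite LinfB1_sol -(fineK Lfin) -EFinM lee_fin -/l.
rewrite (disk_avgE _ _ (measurable_sol mf t)) -/A normrM normfV (gtr0_norm A0).
by rewrite ler_pdivrMr.
Qed.

Lemma cvg_geom_mix_sol (kappa : R) : 0 < kappa ->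
  geom_mix kappa (sol f t) @[t --> +oo] --> 0.
Proof.
move=> kappa0; apply/cvgrPdist_le => e e0.
have [T HT] := geom_mix_sol_small kappa0 e0.
near=> t; have /andP[g0 ge] : 0 <= geom_mix kappa (sol f t) <= e.
  by apply: HT; near: t; apply: nbhs_pinfty_gt; exact: num_real.
by rewrite sub0r normrN ger0_norm.
Unshelve. all: by end_near. Qed.

Lemma cvg_Hm1_norm_sol : Hm1_norm (sol f t) @[t --> +oo] --> 0%E.
Proof.
have H (e : R) : 0 < e -> \forall t \near +oo, (Hm1_norm (sol f t) <= e%:E)%E.
  move=> e0; have [T HT] := Hm1_norm_sol_small mf fM f0 e0.
  by near=> t; apply: HT; near: t; apply: nbhs_pinfty_gt; exact: num_real.
(* Convergence in the extended reals splits into eventual finiteness, read off the bound with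
   [e = 1], and convergence of the real values. *)
apply/fine_cvgP; split.
  near=> t; rewrite ge0_fin_numE ?Hm1_norm_ge0//.
  by apply: le_lt_trans (ltry 1); near: t; exact: H.
apply/cvgrPdist_le => e e0; near=> t.
have He : (Hm1_norm (sol f t) <= e%:E)%E by near: t; exact: H.
have fin : Hm1_norm (sol f t) \is a fin_num.
  by rewrite ge0_fin_numE ?Hm1_norm_ge0//; exact: le_lt_trans He (ltry _).
rewrite sub0r normrN /= ger0_norm ?fine_ge0 ?Hm1_norm_ge0//.
by rewrite -lee_fin fineK.
Unshelve. all: by end_near. Qed.

End initial_datum.

End mixing_scales.

Unset Implicit Arguments.

Theorem theorem1 (R : realType) (rho0 : R * R -> R) :
  measurable_fun setT rho0 ->
  (exists M : R, {ae @leb2 R, forall x, `|rho0 x| <= M}) ->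
  {ae @leb2 R, forall x, 1 < eucl x -> rho0 x = 0} ->
  {ae @lebesgue_measure R, forall r : R, 0 < r -> circle_integral rho0 r = 0%E} ->
  forall kappa : R, 0 < kappa < 1 ->
    geom_mix kappa (sol rho0 t) @[t --> +oo] --> 0 /\
    Hm1_norm (sol rho0 t) @[t --> +oo] --> 0%E.
Proof.
move=> mrho0 [M rho0M] rho0_out rho0_mean kappa /andP[kappa0 _]; split.
  exact: cvg_geom_mix_sol mrho0 rho0M rho0_out rho0_mean _ kappa0.
exact: cvg_Hm1_norm_sol mrho0 rho0M rho0_mean.
Qed.
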